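(* Let $U$ be an open connected subset of $\mathbb{C}^k$ which is bounded (or Kobayashi hyperbolic), and let $f:U\to\mathbb{C}^k$ be a holomorphic open map. Assume that every point of $\partial U$ has a plurisubharmonic barrier. Suppose $\mathcal{C}$ is an $f$-invariant set in $U$. Let $V$ be the non-empty interior of $\overline{\mathcal{C}}$, where the closure is taken with respect to $U$. Assume also that a connected component $W$ of $V$ contains a recurrent point $p_0$. Then there are three possibilities for $W$: (1) $W$ is the basin of attraction of an attracting periodic orbit; (2) $W$ is a Siegel domain; (3) if $h$ is a limit of a subsequence of $\{f^n\}_{n\in\mathbb{N}}$ on $W$, then $0<\operatorname{rank}(h)<k$.
   Context: A point $q\in\partial U$ has a plurisubharmonic barrier if there exists a continuous plurisubharmonic function $\rho_q$ on $U$ such that $\rho_q<0$ on $U$ and $\lim_{p\to q}\rho_q(p)=0$. A set $\mathcal{C}$ is $f$-invariant if $f(\mathcal{C})\subset\mathcal{C}$. $f^n$ denotes the $n$-th iterate of $f$. $W$ contains a recurrent point $p_0$ if $p_0\in W$ and $\{f^{n_i}(p_0)\}_i$ is relatively compact in $W$ for some subsequence $n_i\to\infty$. $W$ is a Siegel domain if there is a subsequence $n_i\to\infty$ with $f^{n_i}|_W\to\mathrm{Id}$ (uniformly on compact subsets of $W$). Limits of subsequences of $\{f^n\}$ are taken for uniform convergence on compact subsets. The rank of a holomorphic map $h$ on a connected open set is the maximum over points of the rank of its complex derivative. A periodic orbit of period $m$ through $p$ is attracting if all eigenvalues of the derivative of $f^m$ at $p$ have modulus $<1$; its basin of attraction is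 the set of points whose forward orbits converge to it.
   Formalization: In (1), ''W is the basin'' is false as stated (unit disc, f(z)=z/2, C a smaller disc about 0); it is read as: W is the connected component, containing a point of the orbit, of the basin taken within V. Limits on W require the iterates to be defined on W. *)

(* Defs.v *)
From mathcomp Require Import all_boot all_order all_algebra.
From mathcomp Require Import complex.
From mathcomp Require Import all_classical all_reals all_analysis.

Set Implicit Arguments.
Unset Strict Implicit.
Unset Printing Implicit Defensive.

Import Order.TTheory GRing.Theory Num.Theory.
Import numFieldNormedType.Exports.

Local Open Scope classical_set_scope.
Local Open Scope ring_scope.

(* [R[i]] itself carries no topology; packed as a [numClosedFieldType] it
   inherits the normed topology of a numeric field, and so do its vectors. *)
Definition CC (R : realType) : numClosedFieldType := R[i].

Section ComplexAnalysis.
Context {R : realType}.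
Local Notation C := (CC R).

Definition modulus (z : C) : R := complex.Re `|z|.

(* Complex differentiability at every point: [differentiable] is taken over
   the scalar field C. *)
Definition holomorphic_on (E F : normedModType C) (U : set E) (f : E -> F) :=
  forall z, U z -> differentiable f z.

Definition open_map_on (E F : topologicalType) (U : set E) (f : E -> F) :=
  forall O : set E, open O -> O `<=` U -> open (f @` O).

Definition boundary (E : topologicalType) (U : set E) : set E :=
  closure U `\` U°.

Definition unit_circle (t : R) : C := Complex (cos t) (sin t).

Section Vectors.
Context {k : nat}.
Local Notation Ck := 'rV[C]_k.

(* Upper semicontinuity, and the sub-mean value inequality on every closed
   disc of a complex line that is contained in U. *)
Definition plurisubharmonic (U : set Ck) (rho : Ck -> R) :=
  (forall x, U x -> forall e : R, 0 < e ->
     \forall y \near x, U y -> rho y < rho x + e) /\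
  (forall a b : Ck, (forall z : C, `|z| <= 1 -> U (a + z *: b)) ->
     ((rho a * (2 * pi))%:E <=
      \int[lebesgue_measure]_(t in `[0%R, (2 * pi)%R])
        (rho (a + unit_circle t *: b))%:E)%E).

Definition psh_barrier (U : set Ck) (q : Ck) :=
  exists rho : Ck -> R,
    [/\ {within U, continuous rho},
        plurisubharmonic U rho,
        forall p, U p -> rho p < 0
      & rho p @[p --> within U (nbhs q)] --> (0 : R)].

Definition unit_disc : set C := [set z | `|z| < 1].

Definition poincare_dist (a b : C) : R :=
  let t := modulus ((a - b) / (1 - b^* * a)) in ln ((1 + t) / (1 - t)).

(* [disc_chain U x y l]: x and y are joined by a finite chain of holomorphic
   discs in U, of total Poincare length l. *)
Inductive disc_chain (U : set Ck) : Ck -> Ck -> R -> Prop :=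
| disc_chain_nil x : disc_chain U x x 0
| disc_chain_cons (phi : C -> Ck) (a b : C) (y : Ck) (l : R) :
    holomorphic_on unit_disc phi -> phi @` unit_disc `<=` U ->
    unit_disc a -> unit_disc b ->
    disc_chain U (phi b) y l ->
    disc_chain U (phi a) y (poincare_dist a b + l).

Definition kobayashi_dist (U : set Ck) (x y : Ck) : \bar R :=
  ereal_inf [set l%:E | l in disc_chain U x y].

Definition kobayashi_hyperbolic (U : set Ck) :=
  forall x y, U x -> U y -> x <> y -> (0 < kobayashi_dist U x y)%E.

Definition holomorphic_rank (W : set Ck) (h : Ck -> Ck) : nat :=
  (\max_(r < k.+1 | `[< exists2 z, W z & \rank (jacobian h z) = r >]) r)%N.

(* A map f : U -> C^k need not map U into U, and is represented by a total
   function whose values outside U are irrelevant.  The iterate f^n is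
   defined at z only when z, ..., f^(n-1)(z) all lie in U. *)
Definition iter_defined (U : set Ck) (f : Ck -> Ck) (n : nat) (z : Ck) :=
  forall j, (j < n)%N -> U (iter j f z).

Definition subsequence (s : nat -> nat) := {homo s : i j / (i < j)%N}.

(* f^(s i) -> h uniformly on compact subsets of W; in particular the iterates
   f^(s i) are defined on all of W. *)
Definition iterates_cvg (U : set Ck) (f : Ck -> Ck) (W : set Ck)
    (s : nat -> nat) (h : Ck -> Ck) :=
  (forall i z, W z -> iter_defined U f (s i) z) /\
  (forall K, compact K -> K `<=` W ->
     {uniform K, (fun i => iter (s i) f) @ \oo --> h}).

Definition is_iterate_limit (U : set Ck) (f : Ck -> Ck) (W : set Ck)
    (h : Ck -> Ck) :=
  exists2 s, subsequence s & iterates_cvg U f W s h.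

Definition siegel_domain (U : set Ck) (f : Ck -> Ck) (W : set Ck) :=
  is_iterate_limit U f W id.

Definition recurrent_point (U : set Ck) (f : Ck -> Ck) (W : set Ck) (p : Ck) :=
  W p /\
  exists s, [/\ subsequence s,
    forall i, iter_defined U f (s i) p,
    compact (closure (range (fun i => iter (s i) f p)))
  & closure (range (fun i => iter (s i) f p)) `<=` W].

Definition orbit_of_period (f : Ck -> Ck) (m : nat) (p : Ck) : set Ck :=
  [set iter j f p | j in `I_m].

Definition attracting_periodic (V : set Ck) (f : Ck -> Ck) (m : nat) (p : Ck) :=
  [/\ (0 < m)%N, iter_defined V f m p, iter m f p = p
    & forall a : C, eigenvalue (jacobian (iter m f) p) a -> `|a| < 1].

(* The points of V whose forward orbit under f|_V converges to the finite
   set O. *)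
Definition basin (V : set Ck) (f : Ck -> Ck) (O : set Ck) : set Ck :=
  [set z | (forall n, iter_defined V f n z) /\
     forall N, open N -> O `<=` N -> \forall n \near \oo, N (iter n f z)].

(* W is a component of the basin, within V, of an attracting periodic orbit,
   namely the one containing a point of the orbit.  Neither localization can
   be dropped: for f(z) = z/2 on the unit disc U and the invariant set V = W a
   half-disc containing 0, the basin of 0 in U is all of U; and when the orbit
   meets several components of V, no single component is the entire basin. *)
Definition attracting_basin_component (V : set Ck) (f : Ck -> Ck)
    (W : set Ck) :=
  exists m p, [/\ attracting_periodic V f m p, W p
    & W = connected_component (basin V f (orbit_of_period f m p)) p].

End Vectors.
End ComplexAnalysis.

(* Main.v *)
(* If (3) fails, some subsequence of iterates converges on W to a map h of rank 0 or k,
   all iterates are defined on W, and every f^n(W) is an open connected subset of V.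
   Hence f^n(W) is contained in W as soon as it meets W; this happens exactly for the
   multiples of some m > 0, and g = f^m is a holomorphic self-map of W.

   U, hence W, is hyperbolic, so chains of holomorphic discs define a distance on W that
   induces its topology and that g does not increase. The recurrent orbit accumulates at
   a point q of W, and q is itself recurrent; since g is isometric along the orbit of q,
   that orbit is relatively compact in W, which keeps h(q) away from the boundary.

   If h has rank 0 it is a constant, and an iterate of f carries that constant to a fixed
   point of g to which all of W is attracted. If h has rank k, then h(W) and f^n(W), for
   all large n in the subsequence, contain a common ball, on whose image in W the
   iterates of g along differences of the times tend to the identity; bounded families
   converging near a point converge on larger balls, so this holds on all of W.

   The complex analysis needed for maps that are merely differentiable at each point
   (Cauchy estimates, convergence of derivatives, the two-constants theorem) is drawn
   from the maximum principle, applied on discs and annuli of complex lines. *)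
Require Import Defs.
From mathcomp Require Import all_boot all_order all_algebra.
From mathcomp Require Import complex.
From mathcomp Require Import all_classical all_reals all_analysis.
From mathcomp Require Import ring lra.

Set Implicit Arguments.
Unset Strict Implicit.
Unset Printing Implicit Defensive.

Import Order.TTheory GRing.Theory Num.Theory.
Import numFieldNormedType.Exports.

Local Open Scope classical_set_scope.
Local Open Scope ring_scope.

(** * Goursat's theorem on rectangles *)

(** Two obstacles shape the proof. The times of the given subsequence need not be multiples of the
    return time [m], so the limit map may take values outside [W]; both for rank 0 and for rank [k],
    a fixed number of further steps, chosen to make a total time divisible by [m], brings the
    relevant points back into [W]. Moreover, no limit map is extracted by a normal family argument:
    the only limits of iterates are the given one and those proved to be a constant or the identity.
    Equicontinuity comes from the chain distance, which iterates do not increase; it is used only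
    through the relation of being joined by a chain shorter than [e], so that no infimum has to be
    handled. Since derivatives are not known to be continuous, local estimates rest on Schwarz's
    lemma along complex lines; it bounds increments up to a factor 2, which is the origin of most
    constants. *)

Lemma dist_segment (R : realType) (a b x y : R) :
  a <= x <= b -> a <= y <= b -> `|x - y| <= b - a.
Proof. by move=> /andP[? ?] /andP[? ?]; rewrite ler_norml; apply/andP; split; lra. Qed.

Section Goursat.
Context {R : realType}.
Implicit Types (u v : R -> R) (a b c d : R) (P Q : R -> R -> R).

Local Notation I u c d := (\int[lebesgue_measure]_(x in `[c, d]) u x).

Lemma integrable_segment u c d : {within `[c, d], continuous u} ->
  lebesgue_measure.-integrable `[c, d] (EFin \o u).
Proof. by move=> uc; apply: continuous_compact_integrable => //; exact: segment_compact. Qed.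

Lemma Rintegral_segmentD u c e d : c <= e -> e <= d ->
  {within `[c, d], continuous u} -> I u c d = I u c e + I u e d.
Proof.
move=> ce ed uc; have iu := integrable_segment uc.
have := @Rintegral_itvB R u (BLeft c) (BRight d) e iu.
rewrite !bnd_simp => /(_ ce ed).
rewrite (@Rintegral_itv_obnd_cbnd R e (BRight d)).
  by move=> <-; rewrite addrC subrK.
apply: integrableS iu => //.
by apply: subset_itvr; rewrite bnd_simp.
Qed.

Lemma Rintegral_segmentB u v c d :
  {within `[c, d], continuous u} -> {within `[c, d], continuous v} ->
  I (fun x => u x - v x) c d = I u c d - I v c d.
Proof. by move=> uc vc; rewrite RintegralB //; exact: integrable_segment. Qed.

Lemma Rintegral_segment_cst k c d : c <= d -> I (fun=> k) c d = k * (d - c).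
Proof.
move=> cd; rewrite Rintegral_cst //= lebesgue_measure_itv /= lte_fin.
by case: ltgtP cd => //= -> _; rewrite subrr.
Qed.

Lemma Rintegral_segment_le u k c d : c <= d ->
  {within `[c, d], continuous u} -> (forall x, c <= x <= d -> u x <= k) ->
  I u c d <= k * (d - c).
Proof.
move=> cd uc uk.
rewrite -(Rintegral_segment_cst k cd).
apply: le_Rintegral => //.
- exact: integrable_segment.
- by apply: integrable_segment; apply: continuous_subspaceT => x; exact: cst_continuous.
Qed.

Lemma Rintegral_segment_ge u k c d : c <= d ->
  {within `[c, d], continuous u} -> (forall x, c <= x <= d -> k <= u x) ->
  k * (d - c) <= I u c d.
Proof.
move=> cd uc uk.
rewrite -(Rintegral_segment_cst k cd).
apply: le_Rintegral => //.
- by apply: integrable_segment; apply: continuous_subspaceT => x; exact: cst_continuous.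
- exact: integrable_segment.
Qed.

Lemma Rintegral_segment_near u k e c d : c <= d ->
  {within `[c, d], continuous u} -> (forall x, c <= x <= d -> `|u x - k| <= e) ->
  `|I u c d - k * (d - c)| <= e * (d - c).
Proof.
move=> cd uc uk.
have h1 := @Rintegral_segment_le u (k + e) c d cd uc.
have h2 := @Rintegral_segment_ge u (k - e) c d cd uc.
rewrite ler_norml; apply/andP; split.
  suff : (k - e) * (d - c) <= I u c d by lra.
  by apply: h2 => x /uk; rewrite ler_norml => /andP[]; lra.
suff : I u c d <= (k + e) * (d - c) by lra.
by apply: h1 => x /uk; rewrite ler_norml => /andP[]; lra.
Qed.

(** Complex differentiability of P + iQ at one point, with derivative p + iq, in real coordinates:
    the shape of the affine part expresses the Cauchy-Riemann equations. *)
Definition cr_diff P Q x0 y0 := exists p q, forall e, 0 < e -> exists2 d, 0 < d &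
  forall x y, `|x - x0| < d -> `|y - y0| < d ->
  `|P x y - P x0 y0 - (p * (x - x0) - q * (y - y0))| <= e * (`|x - x0| + `|y - y0|) /\
  `|Q x y - Q x0 y0 - (q * (x - x0) + p * (y - y0))| <= e * (`|x - x0| + `|y - y0|).

(** The imaginary part of the integral of (P + iQ) dz around the rectangle. *)
Definition flux P Q a b c d :=
  I (fun y => P b y - P a y) c d - I (fun x => Q x d - Q x c) a b.

Definition cr_rect P Q a b c d :=
  forall x y, a <= x <= b -> c <= y <= d -> cr_diff P Q x y.

Lemma affine_lip_continuous (f : R -> R) x0 p e0 : 0 < e0 ->
  (exists2 d, 0 < d & forall x, `|x - x0| < d -> `|f x - f x0 - p * (x - x0)| <= e0 * `|x - x0|) ->
  {for x0, continuous f}.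
Proof.
move=> e0p [d d0 h]; apply/cvgrPdist_lt => e e1.
set K := `|p| + e0 + 1.
have K0 : 0 < K by rewrite /K; have := normr_ge0 p; lra.
near=> x.
have xd : `|x - x0| < d.
  by rewrite distrC; near: x; apply/nbhs_ballP; exists d.
have xe : `|x - x0| < e / K.
  by rewrite distrC; near: x; apply/nbhs_ballP; exists (e / K) => //=; rewrite divr_gt0.
have := h x xd.
have h3 : `|f x0 - f x| <= `|f x - f x0 - p * (x - x0)| + `|p * (x - x0)|.
  rewrite distrC; apply: le_trans (ler_normD _ _).
  by rewrite subrK.
move: xe; rewrite ltr_pdivlMr // => xe h2.
rewrite normrM in h3.
by have := normr_ge0 (x - x0); rewrite /K in xe; nra.
Unshelve. all: by end_near. Qed.

Lemma cr_diff_continuous P Q x0 y0 : cr_diff P Q x0 y0 ->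
  {for y0, continuous (P x0)} /\ {for x0, continuous (Q ^~ y0)}.
Proof.
move=> [p [q /(_ 1 ltr01)[d d0 h]]]; split.
  apply: (@affine_lip_continuous _ _ (- q) 1) => //; exists d => // y yd.
  have := (h x0 y _ yd).1; rewrite subrr normr0 => /(_ d0).
  by rewrite mulr0 !sub0r add0r mulNr.
apply: (@affine_lip_continuous _ _ q 1) => //; exists d => // x xd.
have := (h x y0 xd _).2; rewrite subrr normr0 => /(_ d0).
by rewrite mulr0 !addr0.
Qed.

Lemma within_segment_continuous u c d :
  (forall x, c <= x <= d -> {for x, continuous u}) -> {within `[c, d], continuous u}.
Proof.
move=> h; apply: continuous_in_subspaceT => x.
by rewrite inE /= in_itv /= => /h.
Qed.

Lemma cr_rectP P Q a b c d x : cr_rect P Q a b c d -> a <= x <= b ->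
  {within `[c, d], continuous (P x)}.
Proof.
move=> h xab; apply: within_segment_continuous => y ycd.
exact: (cr_diff_continuous (h _ _ xab ycd)).1.
Qed.

Lemma cr_rectQ P Q a b c d y : cr_rect P Q a b c d -> c <= y <= d ->
  {within `[a, b], continuous (Q ^~ y)}.
Proof.
move=> h ycd; apply: within_segment_continuous => x xab.
exact: (cr_diff_continuous (h _ _ xab ycd)).2.
Qed.

Lemma cr_rectS P Q a b c d a' b' c' d' : a <= a' -> b' <= b -> c <= c' -> d' <= d ->
  cr_rect P Q a b c d -> cr_rect P Q a' b' c' d'.
Proof.
move=> h1 h2 h3 h4 h x y /andP[x1 x2] /andP[y1 y2].
by apply: h; apply/andP; split; lra.
Qed.

Lemma fluxE P Q a b c d : a <= b -> c <= d -> cr_rect P Q a b c d ->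
  flux P Q a b c d = I (P b) c d - I (P a) c d - I (Q ^~ d) a b + I (Q ^~ c) a b.
Proof.
move=> ab cd h; rewrite /flux !Rintegral_segmentB; last 4 first.
- by apply: cr_rectQ h _; rewrite lexx cd.
- by apply: cr_rectQ h _; rewrite lexx cd.
- by apply: cr_rectP h _; rewrite lexx ab.
- by apply: cr_rectP h _; rewrite lexx ab.
ring.
Qed.

Lemma flux_split P Q a m b c n d : a <= m -> m <= b -> c <= n -> n <= d ->
  cr_rect P Q a b c d ->
  flux P Q a b c d = flux P Q a m c n + flux P Q a m n d +
                     flux P Q m b c n + flux P Q m b n d.
Proof.
move=> am mb cn nd h.
have ab := le_trans am mb. have cd := le_trans cn nd.
rewrite !fluxE //; try by apply: cr_rectS h => //.
rewrite (Rintegral_segmentD cn nd); last by apply: cr_rectP h _; rewrite lexx ab.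
rewrite (Rintegral_segmentD cn nd (u := P a)); last by apply: cr_rectP h _; rewrite lexx ab.
rewrite (Rintegral_segmentD am mb); last by apply: cr_rectQ h _; rewrite lexx cd.
rewrite (Rintegral_segmentD am mb (u := Q ^~ c)); last by apply: cr_rectQ h _; rewrite lexx cd.
ring.
Qed.

(** The affine part contributes p (b - a) (d - c) to both integrals and cancels. What remains is an
    error of at most e ((b - a) + (d - c)) along each of the four sides. *)
Lemma flux_bound P Q a b c d x0 y0 p q e : a <= b -> c <= d ->
  0 <= e -> a <= x0 <= b -> c <= y0 <= d -> cr_rect P Q a b c d ->
  (forall x y, a <= x <= b -> c <= y <= d ->
  `|P x y - P x0 y0 - (p * (x - x0) - q * (y - y0))| <= e * (`|x - x0| + `|y - y0|) /\
  `|Q x y - Q x0 y0 - (q * (x - x0) + p * (y - y0))| <= e * (`|x - x0| + `|y - y0|)) ->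
  `|flux P Q a b c d| <= 2 * e * ((b - a) + (d - c)) ^+ 2.
Proof.
move=> ab cd e0 x0ab y0cd hr h.
have h' x y : a <= x <= b -> c <= y <= d ->
  `|P x y - P x0 y0 - (p * (x - x0) - q * (y - y0))| <= e * ((b - a) + (d - c)) /\
  `|Q x y - Q x0 y0 - (q * (x - x0) + p * (y - y0))| <= e * ((b - a) + (d - c)).
  move=> xab ycd; have [h1 h2] := h x y xab ycd.
  have hh : e * (`|x - x0| + `|y - y0|) <= e * ((b - a) + (d - c)).
    by apply: ler_wpM2l => //; apply: lerD; exact: dist_segment.
  by split; [exact: le_trans h1 hh|exact: le_trans h2 hh].
have aab : a <= a <= b by rewrite lexx ab.
have bab : a <= b <= b by rewrite lexx ab.
have ccd : c <= c <= d by rewrite lexx cd.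
have dcd : c <= d <= d by rewrite lexx cd.
rewrite /flux.
have k1 : `|I (fun y => P b y - P a y) c d - (p * (b - a)) * (d - c)| <=
   (2 * e * ((b - a) + (d - c))) * (d - c).
  apply: Rintegral_segment_near => //.
    apply: within_segment_continuous => y ycd; apply: continuousB.
      exact: (cr_diff_continuous (hr _ _ bab ycd)).1.
    exact: (cr_diff_continuous (hr _ _ aab ycd)).1.
  move=> y ycd; have := (h' _ _ aab ycd).1; have := (h' _ _ bab ycd).1.
  by rewrite !ler_norml => /andP[? ?] /andP[? ?]; apply/andP; split; lra.
have k2 : `|I (fun x => Q x d - Q x c) a b - (p * (d - c)) * (b - a)| <=
   (2 * e * ((b - a) + (d - c))) * (b - a).
  apply: Rintegral_segment_near => //.
    apply: within_segment_continuous => x xab; apply: continuousB.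
      exact: (cr_diff_continuous (hr _ _ xab dcd)).2.
    exact: (cr_diff_continuous (hr _ _ xab ccd)).2.
  move=> x xab; have := (h' _ _ xab dcd).2; have := (h' _ _ xab ccd).2.
  by rewrite !ler_norml => /andP[? ?] /andP[? ?]; apply/andP; split; lra.
move: k1 k2; rewrite !ler_norml => /andP[? ?] /andP[? ?]; apply/andP; split; nra.
Qed.

Lemma flux_quarter P Q a c A B : 0 <= A -> 0 <= B -> cr_rect P Q a (a + A) c (c + B) ->
  exists a' c', [/\ a <= a' <= a + A / 2, c <= c' <= c + B / 2 &
    `|flux P Q a (a + A) c (c + B)| / 4 <= `|flux P Q a' (a' + A / 2) c' (c' + B / 2)|].
Proof.
move=> A0 B0 h; apply: contrapT => hn.
have hq a' c' : a <= a' <= a + A / 2 -> c <= c' <= c + B / 2 ->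
   `|flux P Q a' (a' + A / 2) c' (c' + B / 2)| < `|flux P Q a (a + A) c (c + B)| / 4.
  by move=> h1 h2; rewrite ltNge; apply/negP => h3; apply: hn; exists a', c'.
have eA : a + A = a + A / 2 + A / 2 by field.
have eB : c + B = c + B / 2 + B / 2 by field.
have a1 : a <= a <= a + A / 2 by apply/andP; split; lra.
have a2 : a <= a + A / 2 <= a + A / 2 by apply/andP; split; lra.
have b1 : c <= c <= c + B / 2 by apply/andP; split; lra.
have b2 : c <= c + B / 2 <= c + B / 2 by apply/andP; split; lra.
have := hq _ _ a1 b1; have := hq _ _ a1 b2; have := hq _ _ a2 b1; have := hq _ _ a2 b2.
rewrite -eA -eB => q1 q2 q3 q4.
have e : flux P Q a (a + A) c (c + B) = flux P Q a (a + A / 2) c (c + B / 2) +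
  flux P Q a (a + A / 2) (c + B / 2) (c + B) +
  flux P Q (a + A / 2) (a + A) c (c + B / 2) +
  flux P Q (a + A / 2) (a + A) (c + B / 2) (c + B).
  by apply: flux_split h; lra.
set f := flux P Q a (a + A) c (c + B) in q1 q2 q3 q4 e *.
have := ler_normD (flux P Q a (a + A / 2) c (c + B / 2) +
  flux P Q a (a + A / 2) (c + B / 2) (c + B) +
  flux P Q (a + A / 2) (a + A) c (c + B / 2))
  (flux P Q (a + A / 2) (a + A) (c + B / 2) (c + B)).
have := ler_normD (flux P Q a (a + A / 2) c (c + B / 2) +
  flux P Q a (a + A / 2) (c + B / 2) (c + B))
  (flux P Q (a + A / 2) (a + A) c (c + B / 2)).
have := ler_normD (flux P Q a (a + A / 2) c (c + B / 2))
  (flux P Q a (a + A / 2) (c + B / 2) (c + B)).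
by rewrite -e; lra.
Qed.

(** Repeated quartering: the n-th rectangle has flux at least F / 4^n, while differentiability at
    the common point of all rectangles bounds it by an arbitrarily small multiple of 4^-n. *)
Theorem goursat P Q a b c d : a <= b -> c <= d -> cr_rect P Q a b c d ->
  flux P Q a b c d = 0.
Proof.
move=> ab cd h; apply/eqP; rewrite -normr_eq0; apply/eqP.
set F := `|flux P Q a b c d|.
have F0 : 0 <= F by exact: normr_ge0.
set A := b - a; set B := d - c.
have A0 : 0 <= A by rewrite subr_ge0.
have B0 : 0 <= B by rewrite subr_ge0.
have eb : b = a + A by rewrite /A addrC subrK.
have ed : d = c + B by rewrite /B addrC subrK.
pose S n (z : R * R) := [/\ a <= z.1, z.1 + A / 2 ^+ n <= b, c <= z.2,
  z.2 + B / 2 ^+ n <= d &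
  F / 4 ^+ n <= `|flux P Q z.1 (z.1 + A / 2 ^+ n) z.2 (z.2 + B / 2 ^+ n)|].
have p2 n : 0 < (2 ^+ n : R) by rewrite exprn_gt0.
(* The selection of a quarter has to be total, so corners violating [S] are left where they are. *)
have step (nz : nat * (R * R)) : exists z', S nz.1 nz.2 -> [/\ S nz.1.+1 z',
    nz.2.1 <= z'.1 <= nz.2.1 + A / 2 ^+ nz.1.+1 &
    nz.2.2 <= z'.2 <= nz.2.2 + B / 2 ^+ nz.1.+1].
  case: nz => n [x y] /=; have [Sxy|] := pselect (S n (x, y)); last by exists (x, y).
  have [/= h1 h2 h3 h4 h5] := Sxy.
  have eA : A / 2 ^+ n.+1 = A / 2 ^+ n / 2 by rewrite exprSr invfM mulrA.
  have eB : B / 2 ^+ n.+1 = B / 2 ^+ n / 2 by rewrite exprSr invfM mulrA.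
  have A1 : 0 <= A / 2 ^+ n by rewrite divr_ge0 // ltW.
  have B1 : 0 <= B / 2 ^+ n by rewrite divr_ge0 // ltW.
  have [x' [y' [hx hy hf]]] := flux_quarter A1 B1 (cr_rectS h1 h2 h3 h4 h).
  exists (x', y') => _; rewrite /S /= eA eB; split => //.
  move/andP: hx => [hx1 hx2]; move/andP: hy => [hy1 hy2].
  split; try lra.
  apply: le_trans hf; rewrite exprSr invfM mulrA; lra.
have [nx hnx] := choice step.
pose z := fix z n := if n is m.+1 then nx (m, z m) else (a, c).
have Sz n : S n (z n).
  elim: n => [|n IH]; last by case: (hnx (n, z n) IH).
  by rewrite /S /= !expr0 !divr1 -eb -ed !lexx.
have zm (n k : nat) : (n <= k)%N ->
   [/\ (z n).1 <= (z k).1, (z k).1 + A / 2 ^+ k <= (z n).1 + A / 2 ^+ n,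
      (z n).2 <= (z k).2 & (z k).2 + B / 2 ^+ k <= (z n).2 + B / 2 ^+ n].
  move=> /subnKC <-; elim: (k - n)%N => [|j [i1 i2 i3 i4]]; first by rewrite addn0.
  rewrite addnS; have [_ /andP[k1 k2] /andP[k3 k4]] := hnx (_, z _) (Sz (n + j)%N).
  rewrite /= in k1 k2 k3 k4 *.
  have eA : A / 2 ^+ (n + j) = A / 2 ^+ (n + j).+1 + A / 2 ^+ (n + j).+1.
    by rewrite exprSr; field; rewrite gt_eqF.
  have eB : B / 2 ^+ (n + j) = B / 2 ^+ (n + j).+1 + B / 2 ^+ (n + j).+1.
    by rewrite exprSr; field; rewrite gt_eqF.
  by split; lra.
have sq0 (r : R) n : 0 <= r -> 0 <= r / 2 ^+ n by move=> r0; rewrite divr_ge0 // ltW.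
have nest n k : (z k).1 <= (z n).1 + A / 2 ^+ n /\ (z k).2 <= (z n).2 + B / 2 ^+ n.
  have hAk := sq0 A k A0; have hBk := sq0 B k B0.
  have hAn := sq0 A n A0; have hBn := sq0 B n B0.
  have [nk|/ltnW kn] := leqP n k.
    by have [? ? ? ?] := zm _ _ nk; split; lra.
  by have [? ? ? ?] := zm _ _ kn; split; lra.
pose x0 := sup (range (fun n => (z n).1)).
pose y0 := sup (range (fun n => (z n).2)).
have x0le n : (z n).1 <= x0 <= (z n).1 + A / 2 ^+ n.
  apply/andP; split.
    apply: ub_le_sup; last by exists n.
    by exists ((z n).1 + A / 2 ^+ n) => _ [k _ <-]; case: (nest n k).
  apply: ge_sup; first by exists (z n).1, n.
  by move=> _ [k _ <-]; case: (nest n k).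
have y0le n : (z n).2 <= y0 <= (z n).2 + B / 2 ^+ n.
  apply/andP; split.
    apply: ub_le_sup; last by exists n.
    by exists ((z n).2 + B / 2 ^+ n) => _ [k _ <-]; case: (nest n k).
  apply: ge_sup; first by exists (z n).2, n.
  by move=> _ [k _ <-]; case: (nest n k).
have x0ab : a <= x0 <= b by have := x0le 0%N; rewrite /= expr0 divr1 -eb.
have y0cd : c <= y0 <= d by have := y0le 0%N; rewrite /= expr0 divr1 -ed.
have [p [q hpq]] := h _ _ x0ab y0cd.
apply/eqP; rewrite eq_le F0 andbT leNgt; apply/negP => Fp.
set T := A + B; have T0 : 0 <= T by rewrite addr_ge0.
have K0 : 0 < 2 * T ^+ 2 + 1 by have := sqr_ge0 T; lra.
(* Makes 2 e T^2 smaller than F, against [flux_bound] on a rectangle of half-perimeter T / 2^n. *)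
set e := F / (2 * T ^+ 2 + 1).
have e0 : 0 < e by rewrite divr_gt0.
have [dl dl0 hd] := hpq e e0.
have [n hn] : exists n, T / 2 ^+ n < dl.
  exists (Num.bound (T / dl)).
  have h1 : T / dl < (Num.bound (T / dl))%:R by rewrite archi_boundP // divr_ge0 // ltW.
  rewrite ltr_pdivrMr // mulrC -ltr_pdivrMr //; apply: lt_trans h1 _.
  by rewrite -natrX ltr_nat ltn_expl.
have [s1 s2 s3 s4 s5] := Sz n.
have TA : A / 2 ^+ n + B / 2 ^+ n = T / 2 ^+ n by rewrite -mulrDl.
have hA := sq0 A n A0; have hB := sq0 B n B0.
have := @flux_bound P Q (z n).1 ((z n).1 + A / 2 ^+ n) (z n).2 ((z n).2 + B / 2 ^+ n)
  x0 y0 p q e.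
rewrite !lerDl => /(_ hA hB (ltW e0) (x0le n) (y0le n) (cr_rectS s1 s2 s3 s4 h)).
have -> : (z n).1 + A / 2 ^+ n - (z n).1 + ((z n).2 + B / 2 ^+ n - (z n).2) = T / 2 ^+ n.
  by rewrite -TA; ring.
have hh : forall x y, (z n).1 <= x <= (z n).1 + A / 2 ^+ n ->
    (z n).2 <= y <= (z n).2 + B / 2 ^+ n -> `|x - x0| < dl /\ `|y - y0| < dl.
  move=> x y hx hy; split.
    apply: le_lt_trans (dist_segment hx (x0le n)) _; apply: le_lt_trans hn.
    by rewrite addrAC subrr add0r -TA lerDl.
  apply: le_lt_trans (dist_segment hy (y0le n)) _; apply: le_lt_trans hn.
  by rewrite addrAC subrr add0r -TA lerDr.
move=> /(_ (fun x y hx hy => let: conj h1 h2 := hh x y hx hy in hd x y h1 h2)) => h6.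
have := le_trans s5 h6.
have -> : (T / 2 ^+ n) ^+ 2 = T ^+ 2 / 4 ^+ n.
  rewrite expr_div_n -exprM mulnC exprM; congr (_ / _ ^+ n); ring.
rewrite mulrA ler_pM2r ?invr_gt0 ?exprn_gt0 //.
apply/negP; rewrite -ltNge /e mulrAC mulrA ltr_pdivrMr //.
by rewrite [ltLHS]mulrAC [ltLHS]mulrC mulrDr mulr1; lra.
Qed.

End Goursat.

(** * The norm of a complex normed space as a real number *)

Section RealNorm.
Context {R : realType}.
Local Notation C := (CC R).

Definition cc (r : R) : C := Complex r 0.

Lemma cc_le (x y : R) : (cc x <= cc y) = (x <= y).
Proof. exact: lecR. Qed.

Lemma cc_lt (x y : R) : (cc x < cc y) = (x < y).
Proof. exact: ltcR. Qed.

Lemma ccD (x y : R) : cc (x + y) = cc x + cc y.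
Proof. by apply/eqP; rewrite eq_complex /= addr0 !eqxx. Qed.

Lemma ccN (x : R) : cc (- x) = - cc x.
Proof. by apply/eqP; rewrite eq_complex /= oppr0 !eqxx. Qed.

Lemma ccB (x y : R) : cc (x - y) = cc x - cc y.
Proof. by rewrite ccD ccN. Qed.

Lemma ccM (x y : R) : cc (x * y) = cc x * cc y.
Proof. by apply/eqP; rewrite eq_complex /= !mul0r mulr0 subr0 addr0 !eqxx. Qed.

Lemma cc0 : cc 0 = 0.
Proof. by []. Qed.

Lemma cc1 : cc 1 = 1.
Proof. by []. Qed.

Lemma cc_inj : injective cc.
Proof. by move=> x y []. Qed.

Lemma ReCD (x y : C) : complex.Re (x + y) = complex.Re x + complex.Re y.
Proof. by case: x => a b; case: y. Qed.

Lemma ImCD (x y : C) : complex.Im (x + y) = complex.Im x + complex.Im y.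
Proof. by case: x => a b; case: y. Qed.

Lemma ReCN (x : C) : complex.Re (- x) = - complex.Re x.
Proof. by case: x. Qed.

Lemma ImCN (x : C) : complex.Im (- x) = - complex.Im x.
Proof. by case: x. Qed.

Lemma ReCM (x y : C) : complex.Re (x * y) =
  complex.Re x * complex.Re y - complex.Im x * complex.Im y.
Proof. by case: x => a b; case: y. Qed.

Lemma ImCM (x y : C) : complex.Im (x * y) =
  complex.Re x * complex.Im y + complex.Im x * complex.Re y.
Proof. by case: x => a b; case: y. Qed.

Lemma ge0_cc (x : C) : 0 <= x -> x = cc (complex.Re x).
Proof. by case: x => a b; rewrite lecE /= => /andP[/eqP-> _]. Qed.

Section Module.
Context {E : normedModType C}.
Implicit Types x y : E.

(** The norm of a complex normed module is valued in [C], whose order is partial; its real part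
    gives access to real arithmetic. *)
Definition rnorm x : R := complex.Re `|x|.

Lemma rnormE x : `|x| = cc (rnorm x).
Proof. exact: ge0_cc. Qed.

Lemma rnorm_ge0 x : 0 <= rnorm x.
Proof. by rewrite -cc_le -rnormE cc0. Qed.

Lemma rnorm0 : rnorm 0 = 0.
Proof. by rewrite /rnorm normr0. Qed.

Lemma rnorm_eq0 x : (rnorm x == 0) = (x == 0).
Proof.
rewrite -[in RHS]normr_eq0 rnormE; apply/eqP/eqP => [->//|].
by rewrite -cc0 => /cc_inj.
Qed.

Lemma rnormN x : rnorm (- x) = rnorm x.
Proof. by rewrite /rnorm normrN. Qed.

Lemma rnormD x y : rnorm (x + y) <= rnorm x + rnorm y.
Proof. by rewrite -cc_le ccD -!rnormE ler_normD. Qed.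

Lemma rnorm_dist x y : rnorm (x - y) = rnorm (y - x).
Proof. by rewrite -rnormN opprB. Qed.

Lemma rnorm_tri z x y : rnorm (x - y) <= rnorm (x - z) + rnorm (z - y).
Proof. by apply: le_trans (rnormD _ _); rewrite addrA subrK. Qed.

Lemma rnorm_gt0 x : (0 < rnorm x) = (x != 0).
Proof. by rewrite lt_neqAle rnorm_ge0 andbT eq_sym rnorm_eq0. Qed.

Lemma nbhs_rnormP x (A : set E) :
  nbhs x A <-> exists2 d, 0 < d & forall y, rnorm (y - x) < d -> A y.
Proof.
split => [/nbhs_normP[e /= e0 h]|[d d0 h]].
  have ee := ge0_cc (ltW e0).
  exists (complex.Re e); first by move: e0; rewrite ee cc_lt.
  move=> y yd; apply: h; rewrite /ball_ /= ee -normrN opprB rnormE cc_lt.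
  by [].
apply/nbhs_normP; exists (cc d); first by rewrite /= -cc0 cc_lt.
by move=> y; rewrite /ball_ /= -normrN opprB rnormE cc_lt => /h.
Qed.

Lemma open_rnormP (A : set E) : open A <->
  forall x, A x -> exists2 d, 0 < d & forall y, rnorm (y - x) < d -> A y.
Proof.
rewrite openE; split=> [h x /h/nbhs_rnormP//|h x /h hx]; exact/nbhs_rnormP.
Qed.

Lemma rnorm_eps (x : E) : (forall e, 0 < e -> rnorm x <= e) -> x = 0.
Proof.
move=> h; apply/eqP; rewrite -rnorm_eq0 eq_le rnorm_ge0 andbT.
by apply/ler_addgt0Pl => e /h; rewrite addr0.
Qed.

End Module.

Lemma rnormZ (E : normedModType C) (a : C) (x : E) :
  rnorm (a *: x) = rnorm a * rnorm x.
Proof. by apply: cc_inj; rewrite ccM -!rnormE normrZ. Qed.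

Lemma rnormM (a b : C) : rnorm (a * b) = rnorm a * rnorm b.
Proof. exact: rnormZ. Qed.

Lemma rnorm1 : rnorm (1 : C) = 1.
Proof. by rewrite /rnorm normr1. Qed.

Lemma rnormX (a : C) n : rnorm (a ^+ n) = rnorm a ^+ n.
Proof. by elim: n => [|n IH]; rewrite ?expr0 ?rnorm1 // !exprS rnormM IH. Qed.

Lemma rnormV (a : C) : rnorm a^-1 = (rnorm a)^-1.
Proof.
have [->|a0] := eqVneq a 0; first by rewrite invr0 rnorm0 invr0.
apply: (mulfI (x := rnorm a)); first by rewrite rnorm_eq0.
by rewrite -rnormM !divff ?rnorm1 ?rnorm_eq0.
Qed.

Lemma rnorm_sqr (z : C) : rnorm z ^+ 2 = complex.Re z ^+ 2 + complex.Im z ^+ 2.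
Proof.
rewrite /rnorm normc_def /= sqr_sqrtr //.
by rewrite addr_ge0 ?sqr_ge0.
Qed.

Lemma mulcJ (z : C) : z * (z^*%C : C) = cc (rnorm z ^+ 2).
Proof.
apply/eqP; rewrite rnorm_sqr eq_complex; case: z => a b /=.
by apply/andP; split; apply/eqP; ring.
Qed.

Lemma Re_le_rnorm (z : C) : `|complex.Re z| <= rnorm z.
Proof.
rewrite -(@ler_pXn2r _ 2) ?nnegrE ?rnorm_ge0 // rnorm_sqr.
by rewrite real_normK ?num_real // lerDl sqr_ge0.
Qed.

Lemma Im_le_rnorm (z : C) : `|complex.Im z| <= rnorm z.
Proof.
rewrite -(@ler_pXn2r _ 2) ?nnegrE ?rnorm_ge0 // rnorm_sqr.
by rewrite real_normK ?num_real // lerDr sqr_ge0.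
Qed.

Lemma rnorm_cc (r : R) : rnorm (cc r) = `|r|.
Proof.
apply/eqP; rewrite -(@eqrXn2 _ 2) ?rnorm_ge0 // rnorm_sqr /= real_normK ?num_real //.
by rewrite expr0n addr0.
Qed.

Lemma rnorm_le_ReIm (z : C) : rnorm z <= `|complex.Re z| + `|complex.Im z|.
Proof.
rewrite -(@ler_pXn2r _ 2) ?nnegrE ?rnorm_ge0 ?addr_ge0 // rnorm_sqr.
rewrite sqrrD !real_normK ?num_real //.
by have := normr_ge0 (complex.Re z); have := normr_ge0 (complex.Im z); nra.
Qed.

Lemma rnormJ (z : C) : rnorm (z^*%C : C) = rnorm z.
Proof.
apply/eqP; rewrite -(@eqrXn2 _ 2) ?rnorm_ge0 // !rnorm_sqr.
by case: z => a b /=; rewrite sqrrN.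
Qed.

Lemma cvg_rnormP (T : Type) (F : set_system T) (FF : Filter F) (E : normedModType C)
  (u : T -> E) (l : E) : u @ F --> l <->
  forall e : R, 0 < e -> \forall t \near F, rnorm (u t - l) < e.
Proof.
split=> [h e e0|h].
  have : nbhs l [set y | rnorm (y - l) < e] by apply/nbhs_rnormP; exists e.
  exact: h.
move=> A /nbhs_rnormP[d d0 hd].
by have := h d d0; apply: filterS => t /= /hd.
Qed.

Lemma rnorm_continuous_at (E F : normedModType C) (u : E -> F) x :
  {for x, continuous u} <->
  forall e, 0 < e -> exists2 d, 0 < d & forall y, rnorm (y - x) < d -> rnorm (u y - u x) < e.
Proof.
by split=> [/cvg_rnormP h e /h/nbhs_rnormP|h]; [|apply/cvg_rnormP => e /h/nbhs_rnormP].
Qed.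

Lemma continuous_real_atP (E : normedModType C) (u : E -> R) x :
  (forall e, 0 < e -> exists2 d, 0 < d & forall y, rnorm (y - x) < d -> `|u y - u x| < e) ->
  {for x, continuous u}.
Proof.
move=> h; apply/cvgrPdist_lt => e /h[d d0 hd].
by apply/nbhs_rnormP; exists d => // y /hd; rewrite distrC.
Qed.

Lemma rnorm_continuous (E : normedModType C) : continuous (rnorm : E -> R).
Proof.
move=> x; apply: continuous_real_atP => e e0; exists e => // y; apply: le_lt_trans.
rewrite ler_norml; have := rnormD (y - x) x; have := rnormD (x - y) y.
by rewrite !subrK (rnorm_dist x y); lra.
Qed.

Lemma closed_rnorm_le (E : normedModType C) (a : E) (r : R) :
  closed [set x : E | rnorm (x - a) <= r].
Proof.
move=> x hx /=; rewrite leNgt; apply/negP => rx.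
have d0 : 0 < rnorm (x - a) - r by rewrite subr_gt0.
have : nbhs x [set y | rnorm (y - x) < rnorm (x - a) - r].
  by apply/nbhs_rnormP; exists (rnorm (x - a) - r).
move=> /hx[y []] /=.
by have := rnorm_tri y x a; rewrite (rnorm_dist x y); lra.
Qed.

Lemma closed_rnorm_ge (E : normedModType C) (a : E) (r : R) :
  closed [set x : E | r <= rnorm (x - a)].
Proof.
move=> x hx /=; rewrite leNgt; apply/negP => rx.
have d0 : 0 < r - rnorm (x - a) by rewrite subr_gt0.
have : nbhs x [set y | rnorm (y - x) < r - rnorm (x - a)].
  by apply/nbhs_rnormP; exists (r - rnorm (x - a)).
move=> /hx[y []] /=.
by have := rnorm_tri x y a; lra.
Qed.

(** The closed set lies in the image of the square [-r, r]^2 under the continuous map (x, y) -> x +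
    iy. *)
Lemma rnorm_bounded_compact (A : set C) (r : R) :
  closed A -> (forall z, A z -> rnorm z <= r) -> compact A.
Proof.
move=> Acl Ar.
pose h (p : R * R) : C := Complex p.1 p.2.
have hc : continuous h.
  move=> p; apply/cvg_rnormP => e e0.
  have e2 : 0 < e / 2 by rewrite divr_gt0.
  have [h1 h2] : nbhs p.1 (ball p.1 (e / 2)) /\ nbhs p.2 (ball p.2 (e / 2)).
    by split; exact: nbhsx_ballx.
  exists (ball p.1 (e / 2), ball p.2 (e / 2)) => // -[x y] [/= hx hy].
  apply: le_lt_trans (rnorm_le_ReIm _) _ => /=.
  by rewrite [e]splitr ltrD // distrC.
have hK : compact (h @` (`[- r, r] `*` `[- r, r])).
  apply: continuous_compact; last by apply: compact_setX; exact: segment_compact.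
  exact: continuous_subspaceT.
apply: subclosed_compact hK _ => // z /Ar zr.
exists (complex.Re z, complex.Im z); last by case: z zr.
split; rewrite /= in_itv /= -ler_norml.
  exact: le_trans (Re_le_rnorm _) zr.
exact: le_trans (Im_le_rnorm _) zr.
Qed.

End RealNorm.

(* Norms of the same vector may differ in the inferred algebraic structure of its type;
   ssreflect matching identifies them, which is much faster than leaving it to [lra]. *)
Ltac rlra :=
  repeat match goal with H : is_true (_ <= _) |- _ => revert H
                       | H : is_true (_ < _) |- _ => revert H end;
  repeat match goal with |- context [@rnorm ?R ?E ?x] => move: (@rnorm R E x) => ? end;
  intros; lra.

(** * The maximum modulus principle *)

Lemma differentiable_eps (K : numFieldType) (V W : normedModType K) (f : V -> W) (x : V) :
  differentiable f x -> forall e : K, 0 < e -> exists2 d : K, 0 < d &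
  forall v, `|v| < d -> `|f (x + v) - f x - 'd f x v| <= e * `|v|.
Proof.
move=> /diff_locallyP[_ /eqaddoP h] e /h/nbhs_normP[d /= d0 hd].
exists d => // v vd; have := hd v; rewrite /ball_ /= sub0r normrN => /(_ vd).
by rewrite !fctE /= opprD addrA (addrC v).
Qed.

Lemma is_derive_eps (R : realType) (f : R -> R) (x l : R) : is_derive x 1 f l ->
  forall e, 0 < e -> exists2 d : R, 0 < d &
  forall h, `|h| < d -> `|f (x + h) - f x - l * h| <= e * `|h|.
Proof.
move=> [fd fl] e e0; have /derivable1_diffP/differentiable_eps/(_ e e0)[d d0 hd] := fd.
exists d => // h /hd; rewrite deriv1E // derive1E fl.
by rewrite /= /GRing.scale /= (mulrC h).
Qed.

Section MeanValue.
Context {R : realType}.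
Local Notation C := (CC R).
Implicit Types (F G : C -> C) (z w c : C).

Definition cderiv F z l := forall e : R, 0 < e -> exists2 d : R, 0 < d &
  forall w, rnorm (w - z) < d -> rnorm (F w - F z - l * (w - z)) <= e * rnorm (w - z).

Definition cdiff F z := exists l, cderiv F z l.

Lemma cderiv_continuous F z l : cderiv F z l -> {for z, continuous F}.
Proof.
move=> h; apply/rnorm_continuous_at => e e0; have [d d0 hd] := h 1 ltr01.
have K0 : 0 < rnorm l + 1 by have := rnorm_ge0 l; lra.
exists (Num.min d (e / (rnorm l + 1))); first by rewrite lt_min d0 divr_gt0.
move=> y; rewrite lt_min => /andP[/hd h1]; rewrite ltr_pdivlMr // => h2.
have := rnormD (F y - F z - l * (y - z)) (l * (y - z)).
by rewrite subrK rnormM; lra.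
Qed.

Lemma cdiff_continuous F z : cdiff F z -> {for z, continuous F}.
Proof. by move=> [l]; exact: cderiv_continuous. Qed.

(** The map c + exp (x + iy): rectangles of height 2 pi become annuli around c, so that Goursat's
    theorem applies to circles. *)
Definition polar c (x y : R) : C := c + Complex (expR x * cos y) (expR x * sin y).

Lemma rnorm_cis (r y : R) : rnorm (Complex (r * cos y) (r * sin y) : C) = `|r|.
Proof.
apply/eqP; rewrite -(@eqrXn2 _ 2) ?rnorm_ge0 // rnorm_sqr /= !exprMn -mulrDr.
by rewrite cos2Dsin2 mulr1 real_normK ?num_real.
Qed.

Lemma polarB c (x y : R) :
  polar c x y - c = Complex (expR x * cos y) (expR x * sin y).
Proof. by rewrite /polar addrAC subrr add0r. Qed.

Lemma rnorm_polar c (x y : R) : rnorm (polar c x y - c) = expR x.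
Proof. by rewrite polarB rnorm_cis ger0_norm ?expR_ge0. Qed.

(** The derivative of exp at 0, put together from those of [expR], [cos] and [sin]; by [polarD] it
    yields the derivative everywhere. *)
Lemma polar_expand0 (e : R) : 0 < e -> exists2 d : R, 0 < d & forall s t : R,
  `|s| < d -> `|t| < d ->
  rnorm (polar 0 s t - 1 - (Complex s t : C)) <= e * (`|s| + `|t|).
Proof.
move=> e0; set e' := Num.min (e / 8) 1.
have e'0 : 0 < e' by rewrite lt_min divr_gt0 /=.
have e'1 : e' <= 1 by rewrite ge_min lexx orbT.
have e'e : e' <= e / 8 by rewrite ge_min lexx.
have [d1 d10 h1] := is_derive_eps (is_derive_expR (0 : R)) e'0.
have [d2 d20 h2] := is_derive_eps (is_derive_sin (0 : R)) e'0.
have [d3 d30 h3] := is_derive_eps (is_derive_cos (0 : R)) e'0.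
exists (Num.min (Num.min d1 d2) (Num.min d3 (e' / 2))).
  by rewrite !lt_min d10 d20 d30 divr_gt0.
move=> s t; rewrite !lt_min => /andP[/andP[s1 s2] /andP[s3 s4]] /andP[/andP[t1 t2] /andP[t3 t4]].
have := h1 s s1; have := h2 t t2; have := h3 t t3.
rewrite !add0r expR0 sin0 cos0 !mul1r oppr0 mul0r !addr0 !subr0 => ht hs hx.
apply: le_trans (rnorm_le_ReIm _) _.
rewrite !(ReCD, ImCD, ReCN, ImCN) /= subr0 !add0r.
have s0 := normr_ge0 s; have t0 := normr_ge0 t.
have hx1 : `|expR s - 1| <= 2 * `|s|.
  have := ler_normD (expR s - 1 - s) s; rewrite subrK.
  have := ler_wpM2r s0 e'1; lra.
have hxe : `|expR s| <= 2.
  have := ler_normD (expR s - 1) 1; rewrite subrK normr1; lra.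
have -> : expR s * cos t - 1 - s = expR s * (cos t - 1) + (expR s - 1 - s) by ring.
have -> : expR s * sin t - t = expR s * (sin t - t) + t * (expR s - 1) by ring.
have := ler_normD (expR s * (cos t - 1)) (expR s - 1 - s).
have := ler_normD (expR s * (sin t - t)) (t * (expR s - 1)).
rewrite !normrM => k1 k2.
have k3 : `|expR s| * `|cos t - 1| <= 2 * (e' * `|t|) by apply: ler_pM => //; rewrite ?mulr_ge0 // ltW.
have k4 : `|expR s| * `|sin t - t| <= 2 * (e' * `|t|) by apply: ler_pM => //; rewrite ?mulr_ge0 // ltW.
have k5 : `|t| * `|expR s - 1| <= `|t| * e' by apply: ler_wpM2l => //; lra.
have := ler_wpM2r s0 e'e; have := ler_wpM2r t0 e'e.
have := mulr_ge0 (ltW e0) s0; have := mulr_ge0 (ltW e0) t0.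
lra.
Qed.

Lemma polarD c (x y s t : R) :
  polar c (x + s) (y + t) - c = (polar c x y - c) * polar 0 s t.
Proof.
rewrite !polarB /polar add0r expRD cosD sinD.
by apply/eqP; rewrite eq_complex /=; apply/andP; split; apply/eqP; ring.
Qed.

Lemma cdiff_polar F c (x0 y0 : R) : cdiff F (polar c x0 y0) ->
  cr_diff (fun x y => complex.Re (F (polar c x y)))
          (fun x y => complex.Im (F (polar c x y))) x0 y0.
Proof.
move=> [l hl]; set z0 := polar c x0 y0 in hl *.
set E := z0 - c.
exists (complex.Re (l * E)), (complex.Im (l * E)) => e e0.
have El0 : 0 < rnorm E by rewrite rnorm_polar expR_gt0.
set a := rnorm E in El0; set b := rnorm l.
have b0 : 0 <= b by exact: rnorm_ge0.
have ab0 : 0 < 2 * (a * b + 1) by have := mulr_ge0 (ltW El0) b0; lra.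
(* [e1] bounds the error of the exponential, which is later multiplied by the derivative [l], and
   [e2] the error of [F]; they use up e / 2 and e / 3 of the allowed error. The factor 6 a comes
   from |polar c x y - z0| <= 2 a (|s| + |t|). *)
set e1 := Num.min 1 (e / (2 * (a * b + 1))).
have e10 : 0 < e1 by rewrite lt_min ltr01 divr_gt0.
set e2 := e / (6 * a).
have e20 : 0 < e2 by rewrite divr_gt0 // mulr_gt0.
have [d1 d10 h1] := polar_expand0 e10.
have [d2 d20 h2] := hl e2 e20.
exists (Num.min d1 (d2 / (4 * a))); first by rewrite lt_min d10 divr_gt0 // mulr_gt0.
move=> x y; rewrite !lt_min => /andP[x1 x2] /andP[y1 y2].
set s := x - x0 in x1 x2 *; set t := y - y0 in y1 y2 *.
have := h1 s t x1 y1; set w := _ - _ - _ => hw.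
have s0 := normr_ge0 s; have t0 := normr_ge0 t.
have zE : polar c x y - z0 = E * (Complex s t : C) + E * w.
  have := polarD c x0 y0 s t; rewrite /s /t !(addrC x0, addrC y0) !subrK => h.
  have -> : polar c x y - z0 = (polar c x y - c) - E by rewrite /E; ring.
  by rewrite h -/z0 -/E /w /s /t; ring.
have nst : rnorm (Complex s t : C) <= `|s| + `|t| by exact: rnorm_le_ReIm.
have w1 : rnorm w <= `|s| + `|t|.
  apply: le_trans hw _; rewrite -[leRHS]mul1r; apply: ler_wpM2r; first lra.
  by rewrite ge_min lexx.
have dz : rnorm (polar c x y - z0) <= 2 * a * (`|s| + `|t|).
  rewrite zE; apply: le_trans (rnormD _ _) _; rewrite !rnormM -/a.
  by have := ler_wpM2l (ltW El0) nst; have := ler_wpM2l (ltW El0) w1; lra.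
have dz2 : rnorm (polar c x y - z0) < d2.
  apply: le_lt_trans dz _; move: x2 y2; rewrite !ltr_pdivlMr ?mulr_gt0 //; lra.
have := h2 _ dz2; set r := (X in rnorm X <= _) => hr.
have FE : F (polar c x y) - F z0 = l * E * (Complex s t : C) + (l * E * w + r).
  by rewrite /r zE; ring.
have nr : rnorm (l * E * w + r) <= e * (`|s| + `|t|).
  apply: le_trans (rnormD _ _) _; rewrite !rnormM -/a -/b.
  have k1 : b * a * rnorm w <= e / 2 * (`|s| + `|t|).
    have k : b * a * e1 <= e / 2.
      have : e1 <= e / (2 * (a * b + 1)) by rewrite ge_min lexx orbT.
      rewrite ler_pdivlMr // => k; have := mulr_ge0 (ltW El0) b0.
      by have := ltW e10; lra.
    apply: (le_trans (y := b * a * (e1 * (`|s| + `|t|)))).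
      by apply: ler_wpM2l => //; rewrite mulr_ge0 // ltW.
    by rewrite mulrA; apply: ler_wpM2r => //; rewrite addr_ge0.
  have k2 : e2 * rnorm (polar c x y - z0) <= e / 3 * (`|s| + `|t|).
    apply: le_trans (ler_wpM2l (ltW e20) dz) _.
    rewrite le_eqVlt; apply/orP; left; apply/eqP; rewrite /e2; field.
    by rewrite gt_eqF.
  have k3 : 0 <= e * (`|s| + `|t|) by rewrite mulr_ge0 ?addr_ge0 // ltW.
  lra.
split.
  have -> : complex.Re (F (polar c x y)) - complex.Re (F z0) -
     (complex.Re (l * E) * s - complex.Im (l * E) * t) = complex.Re (l * E * w + r).
    by rewrite -ReCN -ReCD FE ReCD (ReCM (l * E)) /=; ring.
  exact: le_trans (Re_le_rnorm _) nr.
have -> : complex.Im (F (polar c x y)) - complex.Im (F z0) -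
     (complex.Im (l * E) * s + complex.Re (l * E) * t) = complex.Im (l * E * w + r).
  by rewrite -ImCN -ImCD FE ImCD (ImCM (l * E)) /=; ring.
exact: le_trans (Im_le_rnorm _) nr.
Qed.

(* Goursat's theorem for [w |-> G (c + exp w)] on a rectangle of height [2 pi]: the
   horizontal sides cancel by periodicity, and the left side tends to [G c]. *)
Lemma mean_value_lt G c (r rho d : R) : 0 < rho < r -> 0 < d ->
  (forall z, 0 < rnorm (z - c) < r -> cdiff G z) -> {for c, continuous G} ->
  ~ (forall z, rnorm (z - c) = rho -> complex.Re (G z) <= complex.Re (G c) - d).
Proof.
move=> /andP[rho0 rhor] d0 Gd Gc hlt.
have d2 : 0 < d / 2 by rewrite divr_gt0.
have [n n0 hn] := (rnorm_continuous_at _ _).1 Gc _ d2.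
set b := ln rho; have eb : expR b = rho by rewrite lnK.
(* The inner circle has to lie inside the circle of radius rho and where [G] is within d / 2 of
   [G c]. *)
set a := ln (Num.min n rho / 2).
have mn0 : 0 < Num.min n rho by rewrite lt_min n0.
have ea : expR a = Num.min n rho / 2 by rewrite lnK // posrE divr_gt0.
have mn1 : Num.min n rho <= n by rewrite ge_min lexx.
have mn2 : Num.min n rho <= rho by rewrite ge_min lexx orbT.
have en : expR a < n by rewrite ea; lra.
have ab : a <= b.
  by rewrite -ler_expR eb ea; lra.
set P := fun x y => complex.Re (G (polar c x y)).
set Q := fun x y => complex.Im (G (polar c x y)).
have pi0 : 0 <= pi *+ 2 :> R by rewrite mulrn_wge0 // pi_ge0.
have hcr : cr_rect P Q a b 0 (pi *+ 2).
  move=> x y /andP[_ xb] _; apply: cdiff_polar; apply: Gd.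
  by rewrite rnorm_polar expR_gt0 /=; apply: le_lt_trans rhor; rewrite -eb ler_expR.
have := goursat ab pi0 hcr; rewrite /flux.
have -> : (fun x => Q x (pi *+ 2) - Q x 0) = (fun=> 0).
  apply/funext => x; rewrite /Q /polar cos2pi sin2pi cos0 sin0.
  by rewrite subrr.
rewrite Rintegral_segment_cst // mul0r subr0 => h0.
have := @Rintegral_segment_le R (fun y => P b y - P a y) (- (d / 2)) 0 (pi *+ 2) pi0.
rewrite h0 subr0 => h1.
suff : 0 <= - (d / 2) * pi *+ 2.
  have := pi_gt0 R; rewrite mulNr mulNrn oppr_ge0 => p0.
  by rewrite leNgt mulrn_wgt0 // mulr_gt0.
rewrite -mulrnAr; apply: h1.
  apply: within_segment_continuous => y yp; apply: continuousB.
    by apply: (cr_diff_continuous (hcr _ _ _ yp)).1; rewrite lexx ab.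
  by apply: (cr_diff_continuous (hcr _ _ _ yp)).1; rewrite lexx ab.
move=> y _.
have : P b y <= complex.Re (G c) - d by apply: hlt; rewrite rnorm_polar.
have := hn (polar c a y); rewrite rnorm_polar => /(_ en).
have := Re_le_rnorm (G (polar c a y) - G c); rewrite ReCD ReCN ler_norml -/(P a y).
by move=> /andP[? ?]; lra.
Qed.

(* The quotient [F z / z] in Schwarz's lemma is not known to be differentiable at [0],
   so the maximum principle has to allow for an exceptional point. *)
Definition cdiff_off F c (r : R) :=
  {for c, continuous F} /\ forall z, 0 < rnorm (z - c) < r -> cdiff F z.

(** At a maximum of |F| + e |z|^2 with |F| > M, a rotation of F plus a linear term would violate the
    mean value inequality. Discs contained in K take the place of a topological interior, so that
    one statement serves discs and annuli. *)
Theorem maximum_modulus (K : set C) F (M : R) : compact K -> 0 <= M ->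
  (forall z, K z -> {for z, continuous F}) ->
  (forall z, K z -> rnorm (F z) <= M \/
     exists r : R, [/\ 0 < r, forall w, rnorm (w - z) < r -> K w & cdiff_off F z r]) ->
  forall z, K z -> rnorm (F z) <= M.
Proof.
move=> Kc M0 Fc hK z1 Kz1; rewrite leNgt; apply/negP => Mz1.
have K0 : K !=set0 by exists z1.
have [b _ hb] : exists2 b, b \in K & forall t, t \in K -> rnorm t <= rnorm b.
  by apply: compact_EVT_max => //; apply: continuous_subspaceT; exact: rnorm_continuous.
set B := rnorm b ^+ 2 + 1.
have B0 : 0 < B by have := sqr_ge0 (rnorm b); rewrite /B; lra.
(* On [K] the quadratic term of [u] is at most half of [rnorm (F z1) - M], so a maximum point [c] of
   [u] still has [rnorm (F c) > M]. *)
set e := (rnorm (F z1) - M) / (2 * B).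
have e0 : 0 < e by rewrite divr_gt0 ?subr_gt0 // mulr_gt0.
(* The mean of [u] over a small circle exceeds its value at the center. *)
pose u z := rnorm (F z) + e * rnorm z ^+ 2.
have [c cK hc] : exists2 c, c \in K & forall t, t \in K -> u t <= u c.
  apply: compact_EVT_max => //; apply: continuous_in_subspaceT => z.
  rewrite inE => Kz; have nz := @rnorm_continuous R C z.
  apply: (@cvgD _ _ _ _ (nbhs_filter z)).
    exact: (cvg_comp _ _ (Fc z Kz) (@rnorm_continuous R C (F z))).
  apply: (@cvgM _ _ _ (nbhs_filter z)); first exact: cvg_cst.
  exact: (@cvgM _ _ _ (nbhs_filter z)).
have Kc' : K c by rewrite inE in cK.
have Fc1 : M < rnorm (F c).
  have := hc z1; rewrite inE => /(_ Kz1); rewrite /u.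
  have := hb c cK; have := rnorm_ge0 c => c0 cb.
  have k1 : rnorm c ^+ 2 <= B.
    by rewrite /B; have : rnorm c ^+ 2 <= rnorm b ^+ 2 by [rewrite ler_pXn2r // nnegrE rnorm_ge0]; lra.
  have k2 : e * rnorm c ^+ 2 <= (rnorm (F z1) - M) / 2.
    apply: le_trans (ler_wpM2l (ltW e0) k1) _.
    rewrite le_eqVlt; apply/orP; left; apply/eqP; rewrite /e; field.
    by rewrite gt_eqF.
  have k3 : 0 <= e * rnorm z1 ^+ 2 by rewrite mulr_ge0 ?sqr_ge0 // ltW.
  lra.
have [|[r [r0 rK [Fcc Fd]]]] := hK c Kc'; first by rewrite leNgt Fc1.
have Fn0 : 0 < rnorm (F c) by exact: le_lt_trans Fc1.
pose v : C := (F c)^*%C / cc (rnorm (F c)).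
have vn : rnorm v = 1.
  rewrite /v rnormM rnormV rnorm_cc ger0_norm ?rnorm_ge0 // rnormJ divff //.
  by rewrite gt_eqF.
have vFc : v * F c = cc (rnorm (F c)).
  have -> : v * F c = (F c * (F c)^*%C) / cc (rnorm (F c)) by rewrite /v; ring.
  rewrite mulcJ expr2 ccM mulfK //.
  by rewrite -rnorm_eq0 rnorm_cc normr_eq0 gt_eqF.
(* |z|^2 exceeds |c|^2 by |z - c|^2 plus a term linear in z - c. The linear term is moved into [G],
   whose real part on the circle of radius r / 2 then stays e (r / 2)^2 below its value at [c]. *)
pose L : C := cc (2 * e) * (c^*%C : C).
pose G z := v * F z + L * (z - c).
have GD z : cdiff F z -> cdiff G z.
  move=> [l hl]; exists (v * l + L) => e1 /hl[d d0 hd]; exists d => // w /hd.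
  have -> : G w - G z - (v * l + L) * (w - z) = v * (F w - F z - l * (w - z)).
    by rewrite /G; ring.
  by rewrite rnormM vn mul1r.
apply: (@mean_value_lt G c r (r / 2) (e * (r / 2) ^+ 2)).
- by apply/andP; split; lra.
- by rewrite mulr_gt0 // exprn_gt0 // divr_gt0.
- by move=> z /Fd/GD.
- apply/rnorm_continuous_at => e1 e10.
  have e12 : 0 < e1 / 2 by rewrite divr_gt0.
  have [d d0 hd] := (rnorm_continuous_at _ _).1 Fcc _ e12.
  have L0 : 0 < 2 * (rnorm L + 1) by have := rnorm_ge0 L; lra.
  exists (Num.min d (e1 / (2 * (rnorm L + 1)))); first by rewrite lt_min d0 divr_gt0.
  move=> y; rewrite lt_min => /andP[/hd h1]; rewrite ltr_pdivlMr // => h2.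
  have -> : G y - G c = v * (F y - F c) + L * (y - c) by rewrite /G; ring.
  apply: le_lt_trans (rnormD _ _) _; rewrite (rnormM v) (rnormM L) vn mul1r.
  have := rnorm_ge0 (y - c); lra.
move=> z zr.
have Kz : z \in K by rewrite inE; apply: rK; rewrite zr; lra.
have := hc z Kz; rewrite /u.
have -> : complex.Re (G c) = rnorm (F c).
  by rewrite /G subrr mulr0 addr0 vFc.
have k1 : complex.Re (v * F z) <= rnorm (F z).
  apply: le_trans (ler_norm _) _; apply: le_trans (Re_le_rnorm _) _.
  by rewrite rnormM vn mul1r.
have k2 : rnorm z ^+ 2 = rnorm c ^+ 2 + (r / 2) ^+ 2 + 2 * complex.Re ((c^*%C : C) * (z - c)).
  rewrite -zr !rnorm_sqr.
  by case: (z) => z1' z2; case: (c) => c1 c2 /=; ring.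
have k3 : complex.Re (L * (z - c)) = 2 * e * complex.Re ((c^*%C : C) * (z - c)).
  rewrite /L -mulrA ReCM /= mul0r subr0 //.
by rewrite /G ReCD k3 k2; nra.
Qed.

End MeanValue.

(** * One complex variable *)

Section OneVariable.
Context {R : realType}.
Local Notation C := (CC R).
Implicit Types (F G : C -> C) (z w c : C).

Lemma cdiff_derivable F z : cdiff F z -> derivable F z 1.
Proof.
move=> [l hl]; apply/cvg_ex; exists l; apply/cvg_rnormP => e e0.
have e2 : 0 < e / 2 by rewrite divr_gt0.
have [d d0 hd] := hl _ e2.
have : nbhs (0 : C) [set h : C | rnorm (h - 0) < d] by apply/nbhs_rnormP; exists d.
move=> /nbhs_normP[r /= r0 hr]; exists r => // h /hr /=; rewrite subr0 => hd1 h0.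
have := hd (h + z); rewrite addrK => /(_ hd1) hd2.
have hn0 : 0 < rnorm h by rewrite rnorm_gt0.
have -> : h^-1 *: (F (h *: 1 + z) - F z) - l = h^-1 * (F (h + z) - F z - l * h).
  have -> : h *: 1 = h :> C by rewrite /GRing.scale /= mulr1.
  by rewrite -[LHS]/(h^-1 * (F (h + z) - F z) - l : C); field.
rewrite rnormM rnormV mulrC ltr_pdivrMr //; apply: le_lt_trans hd2 _.
by rewrite ltr_pM2r //; lra.
Qed.

Lemma derivable_cdiff F z : derivable F z 1 -> cdiff F z.
Proof.
move=> /derivable1_diffP Fd; exists ('d F z 1) => e e0.
have [|d d0 hd] := differentiable_eps Fd (e := cc e); first by rewrite -cc0 cc_lt.
have dE := ge0_cc (ltW d0).
exists (complex.Re d); first by move: d0; rewrite dE -cc0 cc_lt.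
move=> w wd; have := hd (w - z); rewrite (addrC z) subrK !rnormE -ccM cc_le {1}dE cc_lt.
move=> /(_ wd).
have -> // : 'd F z (w - z) = 'd F z 1 * (w - z).
by rewrite -[w - z in LHS]mulr1 -[_ * 1]/((w - z) *: (1 : C)) linearZ /= mulrC.
Qed.

Lemma cdiffM F G z : cdiff F z -> cdiff G z -> cdiff (fun w => F w * G w) z.
Proof.
move=> /cdiff_derivable hF /cdiff_derivable hG.
exact: (@derivable_cdiff (F * G) z (derivableM hF hG)).
Qed.

Lemma cdiffB F G z : cdiff F z -> cdiff G z -> cdiff (fun w => F w - G w) z.
Proof.
move=> /cdiff_derivable hF /cdiff_derivable hG.
exact: (@derivable_cdiff (F - G) z (derivableB hF hG)).
Qed.

Lemma cdiff_cst a z : cdiff (fun=> a) z.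
Proof. exact: (derivable_cdiff (derivable_cst a z 1)). Qed.

Lemma cdiffV F z : F z != 0 -> cdiff F z -> cdiff (fun w => (F w)^-1) z.
Proof. by move=> F0 /cdiff_derivable hF; exact: (derivable_cdiff (derivableV F0 hF)). Qed.

Lemma cdiff_near F G z (r : R) : 0 < r -> (forall w, rnorm (w - z) < r -> F w = G w) ->
  cdiff F z -> cdiff G z.
Proof.
move=> r0 h [l hl]; exists l => e /hl[d d0 hd].
exists (Num.min d r); first by rewrite lt_min d0.
move=> w; rewrite lt_min => /andP[/hd wd wr].
by rewrite -!h // subrr rnorm0.
Qed.

Lemma cdiff_id z : cdiff id z.
Proof. exact: (derivable_cdiff (@derivable_id _ _ z 1)). Qed.

Lemma cdiffX n z : cdiff (fun w => w ^+ n) z.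
Proof.
elim: n => [|n IH].
  by apply: (@cdiff_near (fun=> 1) _ _ 1) => //; exact: cdiff_cst.
apply: (@cdiff_near (fun w => w * w ^+ n) _ _ 1) => // [w _|]; first by rewrite exprS.
by apply: cdiffM => //; exact: cdiff_id.
Qed.

(** The maximum principle for F z / z on discs of radius rho < r gives |F z| rho <= M |z|; then rho
    tends to r. *)
Lemma schwarz0 F (r M : R) z : (forall w, rnorm w < r -> cdiff F w) ->
  (forall w, rnorm w < r -> rnorm (F w) <= M) -> F 0 = 0 -> rnorm z < r ->
  rnorm (F z) * r <= M * rnorm z.
Proof.
move=> Fd FM F0 zr.
have r0 : 0 < r by apply: le_lt_trans zr; exact: rnorm_ge0.
have M0 : 0 <= M by apply: le_trans (FM 0 _); rewrite ?rnorm_ge0 // rnorm0.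
have [l hl] := Fd 0 ltac:(by rewrite rnorm0).
(* The value F'(0) makes the quotient continuous at 0. *)
pose G w := if w == 0 then l else F w / w.
have Gd w : w != 0 -> rnorm w < r -> cdiff G w.
  move=> w0 wr; have wn0 : 0 < rnorm w by rewrite rnorm_gt0.
  apply: (@cdiff_near (fun w => F w * w^-1) _ _ (rnorm w)) => // [y yw|].
    rewrite /G; case: eqVneq => // y0.
    by move: yw; rewrite y0 sub0r rnormN ltxx.
  apply: cdiffM; [exact: Fd|apply: cdiffV => //].
  exact: cdiff_id.
have G0 : {for 0, continuous G}.
  apply/rnorm_continuous_at => e e0; have e2 : 0 < e / 2 by rewrite divr_gt0.
  have [d d0 hd] := hl _ e2; exists d => // y yd; rewrite /G eqxx.
  case: eqVneq => [_|y0]; first by rewrite subrr rnorm0.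
  have := hd y yd; rewrite F0 !subr0 => h.
  have yn0 : 0 < rnorm y by rewrite rnorm_gt0.
  have -> : F y / y - l = (F y - l * y) / y by rewrite mulrBl mulfK.
  rewrite rnormM rnormV ltr_pdivrMr //; apply: le_lt_trans h _.
  by rewrite ltr_pM2r //; lra.
have Gc w : rnorm w < r -> {for w, continuous G}.
  by have [->//|w0] := eqVneq w 0 => wr; apply: cdiff_continuous; exact: Gd.
have key rho : rnorm z < rho -> rho < r -> rnorm (F z) * rho <= M * rnorm z.
  move=> zrho rhor; have rho0 : 0 < rho by apply: le_lt_trans zrho; exact: rnorm_ge0.
  have [->|z0] := eqVneq z 0; first by rewrite F0 rnorm0 mul0r mulr0.
  have zn0 : 0 < rnorm z by rewrite rnorm_gt0.
  suff : rnorm (G z) <= M / rho.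
    by rewrite /G (negbTE z0) rnormM rnormV ler_pdivrMr // mulrAC ler_pdivlMr.
  apply: (@maximum_modulus R [set w | rnorm (w - 0) <= rho] G).
  - apply: rnorm_bounded_compact; first exact: closed_rnorm_le.
    by move=> w /=; rewrite subr0; apply.
  - by rewrite divr_ge0 // ltW.
  - by move=> w /=; rewrite subr0 => h; apply: Gc; exact: le_lt_trans rhor.
  - move=> w /=; rewrite subr0 le_eqVlt => /orP[/eqP wrho|wrho].
      left; have w0 : w != 0 by rewrite -rnorm_gt0 wrho.
      rewrite /G (negbTE w0) rnormM rnormV wrho ler_pM2r ?invr_gt0 //.
      by apply: FM; rewrite wrho.
    right; have [->|w0] := eqVneq w 0.
      exists rho; split=> //; first by move=> ? /ltW.
      split => // y; rewrite subr0 => /andP[y0 yr]; apply: Gd.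
        by rewrite -rnorm_gt0.
      exact: lt_trans rhor.
    have wn0 : 0 < rnorm w by rewrite rnorm_gt0.
    exists (Num.min (rho - rnorm w) (rnorm w)).
    have tri y : rnorm y <= rnorm (y - w) + rnorm w.
      by apply: le_trans (rnormD _ _); rewrite subrK.
    split; first by rewrite lt_min subr_gt0 wrho.
      move=> y; rewrite lt_min => /andP[h _]; rewrite subr0.
      by have := tri y; lra.
    split; first by apply: Gc; exact: lt_trans rhor.
    move=> y /andP[_]; rewrite lt_min => /andP[h1 h2]; apply: Gd.
      by apply/eqP => y0; move: h2; rewrite y0 sub0r rnormN ltxx.
    by have := tri y; lra.
  - by rewrite /= subr0 ltW.
rewrite leNgt; apply/negP => hlt.
set x := rnorm (F z) in key hlt; set y := M * rnorm z in key hlt.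
have x0 : 0 < x.
  rewrite lt_neqAle rnorm_ge0 andbT; apply/eqP => x0.
  by move: hlt; rewrite -x0 mul0r ltNge /y mulr_ge0 ?rnorm_ge0.
have yx : y / x < r by rewrite ltr_pdivrMr // mulrC.
set m := Num.max (rnorm z) (y / x).
have mr : m < r by rewrite gt_max zr.
have m1 : rnorm z <= m by rewrite le_max lexx.
have m2 : y / x <= m by rewrite le_max lexx orbT.
have := key ((m + r) / 2).
have h1 : rnorm z < (m + r) / 2 by lra.
have h2 : (m + r) / 2 < r by lra.
move=> /(_ h1 h2); rewrite mulrC -ler_pdivlMr //; lra.
Qed.

Lemma schwarz F (r M : R) z : (forall w, rnorm w < r -> cdiff F w) ->
  (forall w, rnorm w < r -> rnorm (F w) <= M) -> rnorm z < r ->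
  rnorm (F z - F 0) * r <= 2 * M * rnorm z.
Proof.
move=> Fd FM zr; have r0 : 0 < r by apply: le_lt_trans zr; exact: rnorm_ge0.
apply: (@schwarz0 (fun w => F w - F 0)) => //; last by rewrite subrr.
  by move=> w wr; apply: cdiffB; [exact: Fd|exact: cdiff_cst].
move=> w wr; apply: le_trans (rnormD _ _) _; rewrite rnormN.
have := FM w wr; have := FM 0; rewrite rnorm0 => /(_ r0); lra.
Qed.

(** The maximum principle on an annulus for F w / w^q: Hadamard's three circles estimate with an
    integer power in place of a logarithm. *)
Lemma three_circles F (e rho M d : R) q z : 0 < e -> e < rho -> 0 <= M -> 0 <= d ->
  (forall w, e / 2 < rnorm w -> rnorm w <= rho -> cdiff F w) ->
  (forall w, rnorm w = rho -> rnorm (F w) <= M) ->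
  (forall w, rnorm w = e -> rnorm (F w) <= d) -> e <= rnorm z <= rho ->
  rnorm (F z) <= (rnorm z / rho) ^+ q * M + (rnorm z / e) ^+ q * d.
Proof.
move=> e0 erho M0 d0 Fd FM Fdl /andP[ez zrho].
have rho0 : 0 < rho by exact: lt_trans erho.
have zn0 : 0 < rnorm z by exact: lt_le_trans ez.
pose G w := F w * (w ^+ q)^-1.
have Gd w : e / 2 < rnorm w -> rnorm w <= rho -> cdiff G w.
  move=> w1 w2; apply: cdiffM; first exact: Fd.
  apply: cdiffV; last exact: cdiffX.
  by rewrite expf_neq0 // -rnorm_gt0; apply: lt_trans w1; rewrite divr_gt0.
have h1 : 0 <= M / rho ^+ q by rewrite divr_ge0 // exprn_ge0 // ltW.
have h2 : 0 <= d / e ^+ q by rewrite divr_ge0 // exprn_ge0 // ltW.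
have : rnorm (G z) <= M / rho ^+ q + d / e ^+ q.
  apply: (@maximum_modulus R ([set w | rnorm (w - 0) <= rho] `&` [set w | e <= rnorm (w - 0)]) G).
  - apply: (@rnorm_bounded_compact _ _ rho).
      by apply: closedI; [exact: closed_rnorm_le|exact: closed_rnorm_ge].
    by move=> w /= []; rewrite subr0.
  - exact: addr_ge0.
  - by move=> w /=; rewrite subr0 => -[? ?]; apply: cdiff_continuous; apply: Gd => //; lra.
  - move=> w /=; rewrite subr0 => -[]; rewrite le_eqVlt => /orP[/eqP wr _|wr].
      left; rewrite /G rnormM rnormV rnormX wr.
      apply: (le_trans (y := M / rho ^+ q)); last by rewrite lerDl.
      by rewrite ler_pM2r ?invr_gt0 ?exprn_gt0 //; exact: FM.
    rewrite le_eqVlt => /orP[/eqP we|we].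
      left; rewrite /G rnormM rnormV rnormX -we.
      apply: (le_trans (y := d / e ^+ q)); last by rewrite lerDr.
      by rewrite ler_pM2r ?invr_gt0 ?exprn_gt0 //; exact: Fdl.
    right; exists (Num.min (rho - rnorm w) (rnorm w - e)).
    have tri y : rnorm y <= rnorm (y - w) + rnorm w.
      by apply: le_trans (rnormD _ _); rewrite subrK.
    have tri' y : rnorm w <= rnorm (y - w) + rnorm y.
      by rewrite rnorm_dist; apply: le_trans (rnormD _ _); rewrite subrK.
    split; first by rewrite lt_min !subr_gt0 wr.
      move=> y; rewrite lt_min => /andP[? ?]; rewrite subr0.
      by have := tri y; have := tri' y; split; lra.
    split; first by apply: cdiff_continuous; apply: Gd; lra.
    move=> y /andP[_]; rewrite lt_min => /andP[? ?].
    by have := tri y; have := tri' y; move=> *; apply: Gd; lra.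
  - by rewrite /= subr0.
rewrite /G rnormM rnormV rnormX ler_pdivrMr ?exprn_gt0 // => h.
apply: le_trans h _; rewrite le_eqVlt; apply/orP; left; apply/eqP.
by rewrite !expr_div_n; ring.
Qed.

(** In [three_circles] the exponent q makes the term with M small, since tau < rho, and [d] is then
    chosen against the factor (tau / e)^q. The order of the quantifiers matters: one [d] serves all
    F with the bound M. *)
Lemma small_propagates (e tau r M eta : R) : 0 < e -> tau < r -> 0 <= M -> 0 < eta ->
  exists2 d : R, 0 < d & forall F,
  (forall w, rnorm w < r -> cdiff F w) -> (forall w, rnorm w < r -> rnorm (F w) <= M) ->
  (forall w, rnorm w <= e -> rnorm (F w) <= d) ->
  forall z, rnorm z <= tau -> rnorm (F z) <= eta.
Proof.
move=> e0 tr M0 eta0.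
have [te|et] := leP tau e.
  by exists eta => // F _ _ h z zt; apply: h; exact: le_trans te.
have tau0 : 0 < tau by exact: lt_trans et.
pose rho := (tau + r) / 2; have rt : tau < rho by rewrite /rho; lra.
have rr : rho < r by rewrite /rho; lra.
have rho0 : 0 < rho by exact: lt_trans rt.
have [q hq] : exists q, (tau / rho) ^+ q * M <= eta / 2.
  have tr0 : 0 <= tau / rho by apply: divr_ge0; exact: ltW.
  have t1 : `|tau / rho| < 1 by rewrite ger0_norm // ltr_pdivrMr // mul1r.
  have M1 : 0 < M + 1 by lra.
  have k0 : 0 < eta / 2 / (M + 1) by rewrite !divr_gt0.
  have /cvgrPdist_lt/(_ _ k0)[q _ hq] := cvg_expr t1.
  exists q; have := hq q (leqnn q); rewrite /= sub0r normrN ger0_norm ?exprn_ge0 //.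
  rewrite ltr_pdivlMr // => h.
  have k1 : 0 <= (tau / rho) ^+ q by rewrite exprn_ge0.
  lra.
have te0 : 0 < (tau / e) ^+ q by rewrite exprn_gt0 // divr_gt0.
pose d := Num.min eta (eta / 2 / (tau / e) ^+ q).
have d0 : 0 < d by rewrite lt_min eta0 !divr_gt0.
exists d => // F Fd FM Fe z zt.
have [ze|ez] := leP (rnorm z) e.
  by apply: le_trans (Fe z ze) _; rewrite /d ge_min lexx.
apply: le_trans (@three_circles F e rho M d q z _ _ _ _ _ _ _ _) _ => //.
- exact: lt_trans rt.
- exact: ltW.
- by move=> w _ wr; apply: Fd; exact: le_lt_trans rr.
- by move=> w wr; apply: FM; rewrite wr.
- by move=> w we; apply: Fe; rewrite we.
- by apply/andP; split; lra.
have z0 : 0 < rnorm z by exact: lt_trans ez.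
have mono s : 0 < s -> (rnorm z / s) ^+ q <= (tau / s) ^+ q.
  move=> s0; have p1 : 0 <= rnorm z / s by apply: divr_ge0; exact: ltW.
  have p2 : 0 <= tau / s by apply: divr_ge0; exact: ltW.
  by apply: lerXn2r; rewrite ?nnegrE // ler_pM2r ?invr_gt0.
have k1 := ler_wpM2r M0 (mono _ rho0).
have k2 := ler_wpM2r (ltW d0) (mono _ e0).
have k3 : (tau / e) ^+ q * d <= eta / 2.
  by rewrite mulrC -ler_pdivlMr // /d ge_min lexx orbT.
lra.
Qed.

Lemma cauchy_limit (u : nat -> C) :
  (forall e : R, 0 < e -> exists N, forall i j, (N <= i)%N -> (N <= j)%N -> rnorm (u i - u j) < e) ->
  exists l, forall e : R, 0 < e -> exists N, forall i, (N <= i)%N -> rnorm (u i - l) < e.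
Proof.
move=> hu.
have real_lim (p : C -> R) : (forall x y, `|p x - p y| <= rnorm (x - y)) ->
   exists l : R, forall e : R, 0 < e -> exists N, forall i, (N <= i)%N -> `|p (u i) - l| < e.
  move=> hp; have : cvg (p \o u @ \oo).
    apply: R_complete; apply: cauchy_exP => e e0; have [N hN] := hu e e0.
    exists (p (u N)); exists N => // i /= Ni.
    by rewrite /ball /=; apply: le_lt_trans (hp _ _) _; exact: hN.
  move=> /cvg_ex[l hl]; exists l => e e0.
  have /cvgrPdist_lt/(_ e e0)[N _ hN] := hl.
  by exists N => i /hN; rewrite distrC.
have [|a ha] := real_lim (@complex.Re R).
  by move=> x y; rewrite -ReCN -ReCD; exact: Re_le_rnorm.
have [|b hb] := real_lim (@complex.Im R).
  by move=> x y; rewrite -ImCN -ImCD; exact: Im_le_rnorm.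
exists (Complex a b) => e e0; have e2 : 0 < e / 2 by rewrite divr_gt0.
have [N1 h1] := ha _ e2; have [N2 h2] := hb _ e2.
exists (maxn N1 N2) => i; rewrite geq_max => /andP[/h1 k1 /h2 k2].
apply: le_lt_trans (rnorm_le_ReIm _) _; rewrite ReCD ReCN ImCD ImCN /=; lra.
Qed.

End OneVariable.

(** * Several complex variables *)

Section SeveralVariables.
Context {R : realType}.
Local Notation C := (CC R).

Lemma differentiable_rnorm (E F : normedModType C) (f : E -> F) x :
  differentiable f x -> forall e : R, 0 < e -> exists2 d : R, 0 < d &
  forall y, rnorm (y - x) < d -> rnorm (f y - f x - 'd f x (y - x)) <= e * rnorm (y - x).
Proof.
move=> fd e e0.
have [|d d0 hd] := differentiable_eps fd (e := cc e); first by rewrite -cc0 cc_lt.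
have dE := ge0_cc (ltW d0).
exists (complex.Re d); first by move: d0; rewrite dE -cc0 cc_lt.
move=> y yd; have := hd (y - x); rewrite (addrC x) subrK !rnormE -ccM cc_le {1}dE cc_lt.
exact.
Qed.

Lemma differentiable_of_rnorm (E F : normedModType C) (f : E -> F) x (L : {linear E -> F}) :
  continuous L -> (forall e : R, 0 < e -> exists2 d : R, 0 < d &
  forall y, rnorm (y - x) < d -> rnorm (f y - f x - L (y - x)) <= e * rnorm (y - x)) ->
  differentiable f x.
Proof.
move=> Lc h.
have ho : f \o shift x = cst (f x) + L +o_0 id.
  apply/eqaddoP => e e0; have eE := ge0_cc (ltW e0).
  have [|d d0 hd] := h (complex.Re e); first by move: e0; rewrite eE -cc0 cc_lt.
  apply/nbhs_rnormP; exists d => // v; rewrite subr0 => vd.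
  have := hd (v + x); rewrite addrK => /(_ vd).
  by rewrite eE !rnormE -ccM cc_le !fctE /= opprD addrA.
have dE := diff_unique Lc ho.
by apply/diff_locallyP; rewrite dE.
Qed.

Section RowVectors.
Context {k : nat}.
Implicit Types x y v : 'rV[C]_k.

Lemma rnorm_coord x j : rnorm (x 0 j) <= rnorm x.
Proof.
rewrite leNgt; apply/negP => h.
have : ball (0 : 'rV[C]_k) (cc (rnorm (x 0 j))) x.
  by rewrite -ball_normE /ball_ /= sub0r normrN rnormE cc_lt.
move=> [_ /(_ 0 j)]; rewrite -ball_normE /ball_ /= mxE sub0r normrN rnormE.
by rewrite cc_lt ltxx.
Qed.

Lemma rnorm_rV_le x (e : R) : 0 <= e -> (forall j, rnorm (x 0 j) <= e) -> rnorm x <= e.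
Proof.
move=> e0 h; apply/ler_addgt0Pl => d d0; apply: ltW.
have : ball (0 : 'rV[C]_k) (cc (d + e)) x.
  split=> [|i j]; first by rewrite -cc0 cc_lt; lra.
  rewrite -ball_normE /ball_ /= mxE sub0r normrN rnormE cc_lt ord1.
  by have := h j; lra.
by rewrite -ball_normE /ball_ /= sub0r normrN rnormE cc_lt.
Qed.

Lemma compact_rnorm_ball x (r : R) : compact [set y | rnorm (y - x) <= r].
Proof.
have [r0|r0] := ltP r 0.
  have -> : [set y | rnorm (y - x) <= r] = set0.
    by apply/seteqP; split => // y /= /(le_trans (rnorm_ge0 _)); lra.
  exact: compact0.
have -> : [set y | rnorm (y - x) <= r] =
    [set y | forall j, [set z : C | rnorm (z - x 0 j) <= r] (y ord0 j)].
  apply/seteqP; split=> y /= h.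
    move=> j; apply: le_trans h; have := rnorm_coord (y - x) j.
    by rewrite !mxE.
  by apply: rnorm_rV_le => // j; rewrite !mxE.
have hc j : compact [set z : C | rnorm (z - x 0 j) <= r].
  apply: (@rnorm_bounded_compact _ _ (r + rnorm (x 0 j))).
    exact: closed_rnorm_le.
  move=> z /= h; have := rnormD (z - x 0 j) (x 0 j); rewrite subrK; lra.
exact: (rV_compact hc).
Qed.

End RowVectors.

Lemma mulmx_rnorm k l (v : 'rV[C]_l) (A : 'M[C]_(l, k)) (c : R) : 0 <= c ->
  (forall i j, rnorm (A i j) <= c) -> rnorm (v *m A) <= l%:R * c * rnorm v.
Proof.
move=> c0 hA; apply: rnorm_rV_le => [|j]; first by rewrite !mulr_ge0 ?rnorm_ge0.
rewrite mxE.
have -> : l%:R * c * rnorm v = \sum_(i < l) c * rnorm v.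
  by rewrite sumr_const card_ord -[RHS]mulr_natl mulrA.
elim/big_ind2 : _ => [|x1 y1 x2 y2 h1 h2|i _]; first by rewrite rnorm0.
  by apply: le_trans (rnormD _ _) _; exact: lerD.
rewrite rnormM mulrC; apply: ler_pM => //; rewrite ?rnorm_ge0 //.
exact: rnorm_coord.
Qed.

Lemma slice_cdiff (E : normedModType C) k (f : E -> 'rV[C]_k) (a v : E) z j :
  differentiable f (a + z *: v) -> cdiff (fun t => f (a + t *: v) 0 j) z.
Proof.
move=> fd; exists ('d f (a + z *: v) v 0 j) => e e0.
have v1 : 0 < rnorm v + 1 by have := rnorm_ge0 v; lra.
have [|d d0 hd] := differentiable_rnorm fd (e := e / (rnorm v + 1)).
  by rewrite divr_gt0.
exists (d / (rnorm v + 1)); first by rewrite divr_gt0.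
move=> w; rewrite ltr_pdivlMr // => wz.
have dE : a + w *: v - (a + z *: v) = (w - z) *: v.
  by rewrite opprD addrACA subrr add0r scalerBl.
have nE : rnorm ((w - z) *: v) <= rnorm (w - z) * (rnorm v + 1).
  by rewrite rnormZ; apply: ler_wpM2l; [exact: rnorm_ge0|lra].
have := hd (a + w *: v); rewrite dE => /(_ (le_lt_trans nE wz)) h.
have -> : f (a + w *: v) 0 j - f (a + z *: v) 0 j - 'd f (a + z *: v) v 0 j * (w - z)
   = (f (a + w *: v) - f (a + z *: v) - 'd f (a + z *: v) ((w - z) *: v)) 0 j.
  have -> : 'd f (a + z *: v) ((w - z) *: v) = (w - z) *: 'd f (a + z *: v) v.
    by rewrite linearZ.
  by rewrite !mxE [(w - z) * _]mulrC.
apply: le_trans (rnorm_coord _ _) _; apply: le_trans h _.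
rewrite mulrAC ler_pdivrMr // -mulrA; apply: ler_wpM2l => //; exact: ltW.
Qed.

(** * Schwarz and Cauchy estimates on balls *)

Section Balls.
Context {k : nat} {E : normedModType C}.
Implicit Types (f g : E -> 'rV[C]_k) (a x y v : E).

Lemma unit_direction v : exists2 u, rnorm u <= 1 & v = cc (rnorm v) *: u.
Proof.
have [->|v0] := eqVneq v 0; first by exists 0; rewrite ?scaler0 // rnorm0.
exists ((cc (rnorm v))^-1 *: v).
  rewrite rnormZ rnormV rnorm_cc ger0_norm ?rnorm_ge0 // mulVf //.
  by rewrite rnorm_eq0.
by rewrite scalerA divff ?scale1r // -rnorm_eq0 rnorm_cc normr_eq0 rnorm_eq0.
Qed.

(** Schwarz's lemma on the complex line through a and y, one coordinate at a time; the norm of a row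
    is the maximum over its coordinates, so the dimension does not enter the constant. *)
Lemma schwarz_ball f a (r M : R) y :
  (forall x, rnorm (x - a) < r -> differentiable f x) ->
  (forall x, rnorm (x - a) < r -> rnorm (f x) <= M) -> rnorm (y - a) < r ->
  rnorm (f y - f a) * r <= 2 * M * rnorm (y - a).
Proof.
move=> fd fM yr; have r0 : 0 < r by apply: le_lt_trans yr; exact: rnorm_ge0.
have [u u1 vE] := unit_direction (y - a).
have ur (t : C) : rnorm t < r -> rnorm (a + t *: u - a) < r.
  rewrite addrAC subrr add0r rnormZ => tr; apply: le_lt_trans tr.
  by rewrite -[leRHS]mulr1; apply: ler_wpM2l => //; exact: rnorm_ge0.
have M0 : 0 <= M by apply: le_trans (fM a _); rewrite ?rnorm_ge0 // subrr rnorm0.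
rewrite -ler_pdivlMr //; apply: rnorm_rV_le => [|j].
  by rewrite divr_ge0 ?(ltW r0) // !mulr_ge0 ?rnorm_ge0.
rewrite !mxE ler_pdivlMr //.
have := @schwarz R (fun t => f (a + t *: u) 0 j) r M (cc (rnorm (y - a))).
rewrite rnorm_cc ger0_norm ?rnorm_ge0 // scale0r addr0 -vE (addrC a) subrK; apply => //.
  by move=> w /ur/fd/slice_cdiff.
by move=> w /ur/fM h; apply: le_trans h; exact: rnorm_coord.
Qed.

(** If y is within r of x, Schwarz's lemma applies on the ball of radius r around x, which lies in
    the given ball of radius 2 r; otherwise the trivial bound 2 M is enough. *)
Lemma lipschitz_ball f a (r M : R) x y :
  (forall x, rnorm (x - a) < 2 * r -> differentiable f x) ->
  (forall x, rnorm (x - a) < 2 * r -> rnorm (f x) <= M) ->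
  rnorm (x - a) < r -> rnorm (y - a) < r ->
  rnorm (f y - f x) * r <= 2 * M * rnorm (y - x).
Proof.
move=> fd fM xr yr.
have r0 : 0 < r by apply: le_lt_trans xr; exact: rnorm_ge0.
have [yx|yx] := ltP (rnorm (y - x)) r.
  have sub w : rnorm (w - x) < r -> rnorm (w - a) < 2 * r.
    by move=> wx; have := rnorm_tri x w a; lra.
  by apply: (@schwarz_ball f) => // w /sub; [exact: fd|exact: fM].
have h : rnorm (f y - f x) <= 2 * M.
  apply: le_trans (rnormD _ _) _; rewrite rnormN.
  have := fM x ltac:(lra); have := fM y ltac:(lra); lra.
apply: ler_pM => //; [exact: rnorm_ge0|exact: ltW].
Qed.

(** Cauchy's estimate with 2 M in place of M: the bound of [schwarz_ball] on increments passes to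
    the differential along short multiples of v. *)
Lemma diff_bound f a (r M : R) v : 0 < r ->
  (forall x, rnorm (x - a) < r -> differentiable f x) ->
  (forall x, rnorm (x - a) < r -> rnorm (f x) <= M) ->
  rnorm ('d f a v) * r <= 2 * M * rnorm v.
Proof.
move=> r0 fd fM; have [->|v0] := eqVneq v 0.
  by rewrite linear0 !rnorm0 mul0r mulr0.
have vn0 : 0 < rnorm v by rewrite rnorm_gt0.
have da : differentiable f a by apply: fd; rewrite subrr rnorm0.
rewrite -ler_pdivlMr //; apply/ler_addgt0Pl => e e0.
have ev0 : 0 < e / rnorm v by rewrite divr_gt0.
have [d d0 hd] := differentiable_rnorm da ev0.
pose t := Num.min d r / (2 * rnorm v).
have m0 : 0 < Num.min d r by rewrite lt_min d0.
have t0 : 0 < t by rewrite divr_gt0 // mulr_gt0.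
have tv : rnorm (cc t *: v) = Num.min d r / 2.
  rewrite rnormZ rnorm_cc ger0_norm ?(ltW t0) // /t; field.
  by rewrite gt_eqF.
have md : Num.min d r <= d by rewrite ge_min lexx.
have mr : Num.min d r <= r by rewrite ge_min lexx orbT.
have := hd (a + cc t *: v); rewrite addrAC subrr add0r tv => /(_ ltac:(lra)) h1.
have := @schwarz_ball f a r M (a + cc t *: v) fd fM.
rewrite addrAC subrr add0r tv => /(_ ltac:(lra)); rewrite -ler_pdivlMr // => h2.
set D := f _ - f a in h1 h2.
have h3 := rnormD D (- (D - 'd f a (cc t *: v))).
have h4 : rnorm ('d f a (cc t *: v)) = t * rnorm ('d f a v).
  by rewrite linearZ rnormZ rnorm_cc ger0_norm // ltW.
move: h3; rewrite opprB addrCA subrr addr0 h4 -opprB rnormN => h3.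
rewrite -(ler_pM2l t0).
have tE : Num.min d r / 2 = t * rnorm v by rewrite -tv rnormZ rnorm_cc ger0_norm // ltW.
rewrite tE in h1 h2.
have e1 : e / rnorm v * (t * rnorm v) = t * e by field; rewrite gt_eqF.
have e2 : 2 * M * (t * rnorm v) / r = t * (2 * M * rnorm v / r) by ring.
by rewrite mulrDr; lra.
Qed.

Lemma small_propagates_ball (e tau r M eta : R) : 0 < e -> tau < r -> 0 <= M -> 0 < eta ->
  exists2 d : R, 0 < d & forall f a,
  (forall x, rnorm (x - a) < r -> differentiable f x) ->
  (forall x, rnorm (x - a) < r -> rnorm (f x) <= M) ->
  (forall x, rnorm (x - a) <= e -> rnorm (f x) <= d) ->
  forall y, rnorm (y - a) <= tau -> rnorm (f y) <= eta.
Proof.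
move=> e0 tr M0 eta0; have [d d0 hd] := @small_propagates R e tau r M eta e0 tr M0 eta0.
exists d => // f a fd fM fe y yt.
have [u u1 vE] := unit_direction (y - a).
have un (t : C) : rnorm (a + t *: u - a) <= rnorm t.
  rewrite addrAC subrr add0r rnormZ.
  by rewrite -[leRHS]mulr1; apply: ler_wpM2l => //; exact: rnorm_ge0.
apply: rnorm_rV_le => [|j]; first exact: ltW.
have := hd (fun t => f (a + t *: u) 0 j) _ _ _ (cc (rnorm (y - a))).
rewrite rnorm_cc ger0_norm ?rnorm_ge0 // -vE (addrC a) subrK; apply => //.
- by move=> w wr; apply/slice_cdiff/fd; exact: le_lt_trans (un w) wr.
- move=> w wr; apply: le_trans (rnorm_coord _ _) _; apply: fM.
  exact: le_lt_trans (un w) wr.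
- move=> w wr; apply: le_trans (rnorm_coord _ _) _; apply: fe.
  exact: le_trans (un w) wr.
Qed.

End Balls.
End SeveralVariables.

(** * Limits and local surjectivity of holomorphic maps *)

Section Limits.
Context {R : realType}.
Local Notation C := (CC R).

(** Strict differentiability without continuity of the derivative: f minus its affine part at a is
    o(rho) on the ball of radius 2 rho, and [lipschitz_ball] turns this bound into a Lipschitz
    constant. *)
Lemma strict_diff (E : normedModType C) k (f : E -> 'rV[C]_k) a (r kappa : R) :
  0 < r -> 0 < kappa -> (forall x, rnorm (x - a) < r -> differentiable f x) ->
  exists2 rho : R, 0 < rho & forall x y, rnorm (x - a) < rho -> rnorm (y - a) < rho ->
    rnorm (f y - f x - 'd f a (y - x)) <= kappa * rnorm (y - x).
Proof.
move=> r0 k0 fd.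
have da : differentiable f a by apply: fd; rewrite subrr rnorm0.
have k4 : 0 < kappa / 4 by rewrite divr_gt0.
have [d d0 hd] := differentiable_rnorm da k4.
pose rho := Num.min d r / 2.
have m0 : 0 < Num.min d r by rewrite lt_min d0.
have md : Num.min d r <= d by rewrite ge_min lexx.
have mr : Num.min d r <= r by rewrite ge_min lexx orbT.
have rho0 : 0 < rho by rewrite divr_gt0.
have rE : 2 * rho = Num.min d r by rewrite /rho; field.
exists rho => // x y xr yr.
pose G := f \- ('d f a \+ cst (f a - 'd f a a)).
have GE z : G z = f z - f a - 'd f a (z - a).
  by rewrite /G /= linearB /=; apply/rowP => j; rewrite !mxE; ring.
have Gd z : rnorm (z - a) < 2 * rho -> differentiable G z.
  rewrite rE => zr; apply: differentiableB; first by apply: fd; lra.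
  apply: differentiableD; last exact: differentiable_cst.
  by apply: linear_differentiable; exact: diff_continuous.
have GM z : rnorm (z - a) < 2 * rho -> rnorm (G z) <= kappa * rho / 2.
  rewrite GE => zr; apply: le_trans (hd z _) _; first lra.
  have : kappa / 4 * rnorm (z - a) <= kappa / 4 * (2 * rho).
    by apply: ler_wpM2l; lra.
  lra.
have := lipschitz_ball Gd GM xr yr; rewrite !GE.
have -> : f y - f a - 'd f a (y - a) - (f x - f a - 'd f a (x - a)) =
          f y - f x - 'd f a (y - x).
  have -> : 'd f a (y - x) = 'd f a (y - a) - 'd f a (x - a).
    by rewrite -linearB; congr ('d f a _); rewrite opprB addrA subrK.
  by apply/rowP => j; rewrite !mxE; ring.
have -> : 2 * (kappa * rho / 2) * rnorm (y - x) = (kappa * rnorm (y - x)) * rho by field.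
by rewrite ler_pM2r.
Qed.

(** A solution of f x = w is a fixed point of the simplified Newton map T x = x - (f x - w) A^-1,
    which halves distances and maps the closed ball into itself. *)
Lemma surjective_ball k (f : 'rV[C]_k -> 'rV[C]_k) (A : 'M[C]_k) a (r kappa b : R) :
  A \in unitmx -> 0 <= r -> 0 < b -> (forall v : 'rV[C]_k, rnorm (v *m invmx A) <= b * rnorm v) ->
  kappa * b <= 1 / 2 ->
  (forall x y, rnorm (x - a) <= r -> rnorm (y - a) <= r ->
    rnorm (f y - f x - (y - x) *m A) <= kappa * rnorm (y - x)) ->
  forall w, rnorm (w - f a) * b <= r / 2 -> exists2 x, rnorm (x - a) <= r & f x = w.
Proof.
move=> Au r0 b0 hb kb hf w hw.
have [T TE] : exists T, forall x, T x = x - (f x - w) *m invmx A by eexists.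
have aa : rnorm (a - a) <= r by rewrite subrr rnorm0.
have TB x y : rnorm (x - a) <= r -> rnorm (y - a) <= r ->
    rnorm (T y - T x) <= rnorm (y - x) / 2.
  move=> xr yr.
  have -> : T y - T x = - ((f y - f x - (y - x) *m A) *m invmx A).
    rewrite mulmxBl mulmxK // !TE !mulmxBl.
    by apply/rowP => j; rewrite !mxE; ring.
  rewrite rnormN; apply: le_trans (hb _) _.
  have := hf x y xr yr; rewrite -(ler_pM2l b0) => h; apply: le_trans h _.
  rewrite mulrA (mulrC b); apply: le_trans (ler_wpM2r (rnorm_ge0 _) kb) _.
  by rewrite mul1r mulrC.
have Ta : rnorm (T a - a) <= r / 2.
  rewrite TE addrAC subrr add0r rnormN; apply: le_trans (hb _) _.
  by rewrite mulrC rnorm_dist.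
have TK x : rnorm (x - a) <= r -> rnorm (T x - a) <= r.
  move=> xr; apply: le_trans (rnorm_tri (T a) _ _) _.
  rewrite [leRHS]splitr; apply: lerD => //; apply: le_trans (TB a x aa xr) _.
  by rewrite ler_pM2r.
(* Instead of iterating [T], compactness provides a point that [T] moves least; as [T] halves
   distances, it is fixed. *)
have [x xK hx] : exists2 x, x \in [set y | rnorm (y - a) <= r] &
    forall y, y \in [set y | rnorm (y - a) <= r] -> rnorm (T x - x) <= rnorm (T y - y).
  apply: (@compact_EVT_min _ R (fun x => rnorm (T x - x))).
  - by exists a.
  - exact: compact_rnorm_ball.
  - apply/subspace_continuousP => x xr; apply/cvgrPdist_lt => e e0.
    have e2 : 0 < e / 2 by rewrite divr_gt0.
    apply/nbhs_rnormP; exists (e / 2) => // y yx yr.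
    have := TB x y xr yr.
    have h1 := rnormD (T x - x - (T y - y)) (T y - y).
    have h2 := rnormD (T y - y - (T x - x)) (T x - x).
    have h3 := rnormD (T y - T x) (x - y).
    have E : T y - T x + (x - y) = T y - y - (T x - x).
      by apply/rowP => j; rewrite !mxE; ring.
    move: h1 h2; rewrite !subrK (rnorm_dist (T x - x)) -E => h1 h2 h4.
    rewrite ltr_norml /from_subspace /=; rewrite (rnorm_dist x y) in h3.
    by apply/andP; split; rlra.
have xr : rnorm (x - a) <= r by rewrite inE in xK.
have : rnorm (T x - x) <= rnorm (T (T x) - T x) by apply: hx; rewrite inE; exact: TK.
move=> /le_trans/(_ (TB x (T x) xr (TK x xr))) h.
have Tx : T x = x.
  apply/eqP; rewrite -subr_eq0 -rnorm_eq0 eq_le rnorm_ge0 andbT.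
  by move: (rnorm _) h => n h; lra.
exists x => //; apply/eqP; rewrite -subr_eq0; apply/eqP.
have : (f x - w) *m invmx A = 0.
  have : x - T x = 0 by rewrite Tx subrr.
  by rewrite TE opprB addrCA subrr addr0.
by move/(congr1 (fun u => u *m A)); rewrite mulmxKV // mul0mx.
Qed.

Lemma is_derive_of_eps (f : R -> R) (x l : R) :
  (forall e, 0 < e -> exists2 d : R, 0 < d &
    forall h, `|h| < d -> `|f (x + h) - f x - l * h| <= e * `|h|) -> is_derive x 1 f l.
Proof.
move=> hl.
have hc : h^-1 *: ((f \o shift x) (h *: 1) - f x) @[h --> 0^'] --> l.
  apply/cvgrPdist_lt => e e0.
  have e2 : 0 < e / 2 by rewrite divr_gt0.
  have [d d0 hd] := hl _ e2.
  exists d => // h /=; rewrite sub0r normrN => hd1 h0.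
  have := hd h hd1 => hd2.
  have hn0 : 0 < `|h| by rewrite normr_gt0.
  have -> : l - h^-1 *: (f (h *: 1 + x) - f x) = - (h^-1 * (f (x + h) - f x - l * h)).
    have -> : h *: 1 = h :> R by rewrite /GRing.scale /= mulr1.
    by rewrite [h + x]addrC -[LHS]/(l - h^-1 * (f (x + h) - f x) : R); field.
  rewrite normrN normrM normfV mulrC ltr_pdivrMr //; apply: le_lt_trans hd2 _.
  by rewrite ltr_pM2r //; lra.
by split; [apply/cvg_ex; exists l|exact: cvg_lim hc].
Qed.

(** The real mean value theorem on the segment from a to y, for the real and imaginary parts of the
    coordinates; a zero derivative survives composition with any 1-Lipschitz function p. *)
Lemma zero_diff_cst (E : normedModType C) k (f : E -> 'rV[C]_k) a (r : R) y :
  (forall x, rnorm (x - a) < r -> differentiable f x) ->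
  (forall x, rnorm (x - a) < r -> forall v, 'd f x v = 0) ->
  rnorm (y - a) < r -> f y = f a.
Proof.
move=> fd f0 yr; set v := y - a.
have r0 : 0 < r by apply: le_lt_trans yr; exact: rnorm_ge0.
have seg (t : R) : 0 <= t <= 1 -> rnorm (a + cc t *: v - a) < r.
  move=> /andP[t0 t1]; rewrite addrAC subrr add0r rnormZ rnorm_cc ger0_norm //.
  by apply: le_lt_trans yr; rewrite -[leRHS]mul1r; apply: ler_wpM2r => //; exact: rnorm_ge0.
have v1 : 0 < rnorm v + 1 by have := rnorm_ge0 v; lra.
suff key (p : 'rV[C]_k -> R) : (forall x z, `|p x - p z| <= rnorm (x - z)) -> p (f y) = p (f a).
  apply/rowP => j; apply/eqP; rewrite eq_complex; apply/andP; split; apply/eqP.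
    apply: (key (fun x => complex.Re (x 0 j))) => x z.
    rewrite -ReCN -ReCD; apply: le_trans (Re_le_rnorm _) _.
    by have := rnorm_coord (x - z) j; rewrite !mxE.
  apply: (key (fun x => complex.Im (x 0 j))) => x z.
  rewrite -ImCN -ImCD; apply: le_trans (Im_le_rnorm _) _.
  by have := rnorm_coord (x - z) j; rewrite !mxE.
move=> hp; pose g (t : R) := p (f (a + cc t *: v)).
have gd (t : R) : 0 <= t <= 1 -> is_derive t 1 g 0.
  move=> tt; apply: is_derive_of_eps => e e0.
  have ev : 0 < e / (rnorm v + 1) by rewrite divr_gt0.
  have [d d0 hd] := differentiable_rnorm (fd _ (seg t tt)) ev.
  exists (d / (rnorm v + 1)); first by rewrite divr_gt0.
  move=> h; rewrite ltr_pdivlMr // => hh; rewrite mul0r subr0.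
  have dE : a + cc (t + h) *: v - (a + cc t *: v) = cc h *: v.
    by rewrite opprD addrACA subrr add0r ccD scalerDl addrAC subrr add0r.
  have nE : rnorm (cc h *: v) <= `|h| * (rnorm v + 1).
    by rewrite rnormZ rnorm_cc; apply: ler_wpM2l => //; lra.
  have := hd (a + cc (t + h) *: v); rewrite dE => /(_ (le_lt_trans nE hh)).
  rewrite f0 ?subr0; last exact: seg.
  move=> k1; apply: le_trans (hp _ _) _; apply: le_trans k1 _.
  by rewrite mulrAC ler_pdivrMr // -mulrA; apply: ler_wpM2l => //; exact: ltW.
have [c _] : exists2 c : R, c \in `]0, 1[ & g 1 - g 0 = 0 * (1 - 0).
  apply: (@MVT R g (fun=> 0)) => //.
    by move=> x; rewrite in_itv /= => /andP[/ltW x0 /ltW x1]; apply: gd; rewrite x0.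
  apply: within_segment_continuous => x xx.
  apply: differentiable_continuous; apply/derivable1_diffP.
  by have [] := gd x xx.
rewrite mul0r => /eqP; rewrite subr_eq0 => /eqP.
rewrite /g cc1 cc0 scale1r scale0r addr0 /v.
by rewrite (addrC a) subrK.
Qed.

Lemma mulmx_bounded l k (A : 'M[C]_(l, k)) :
  exists2 b : R, 0 < b & forall v : 'rV[C]_l, rnorm (v *m A) <= b * rnorm v.
Proof.
pose c := \sum_pq rnorm (A pq.1 pq.2).
have c0 : 0 <= c by apply: sumr_ge0 => pq _; exact: rnorm_ge0.
exists (l%:R * c + 1) => [|v]; first by rewrite ltr_wpDl // mulr_ge0.
apply: le_trans (mulmx_rnorm v c0 _) _.
  move=> p q; rewrite /c (bigD1 (p, q)) //= lerDl.
  by apply: sumr_ge0 => pq _; exact: rnorm_ge0.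
by apply: ler_wpM2r; [exact: rnorm_ge0|rewrite lerDl].
Qed.

(** Cauchy's estimate for differences makes the Jacobian matrices at a a Cauchy sequence. Their
    limit is the differential of h because the Schwarz estimate for [f_ j \- f_ i] is uniform in
    j. *)
Lemma weierstrass l k (f_ : nat -> 'rV[C]_l -> 'rV[C]_k) h a (r : R) : 0 < r ->
  (forall i x, rnorm (x - a) < r -> differentiable (f_ i) x) ->
  (forall e : R, 0 < e -> exists N, forall i x, (N <= i)%N -> rnorm (x - a) < r ->
     rnorm (f_ i x - h x) <= e) -> differentiable h a.
Proof.
move=> r0 fd fh.
have aa : rnorm (a - a) < r by rewrite subrr rnorm0.
have cau (e : R) : 0 < e -> exists N, forall i j x, (N <= i)%N -> (N <= j)%N ->
    rnorm (x - a) < r -> rnorm (f_ i x - f_ j x) <= e.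
  move=> e0; have e2 : 0 < e / 2 by rewrite divr_gt0.
  have [N hN] := fh _ e2; exists N => i j x Ni Nj xr.
  have := rnorm_tri (h x) (f_ i x) (f_ j x); rewrite (rnorm_dist (h x)).
  by have := hN i x Ni xr; have := hN j x Nj xr; rlra.
have dB i j x : rnorm (x - a) < r -> differentiable (f_ i \- f_ j) x.
  by move=> xr; apply: differentiableB; exact: fd.
have [J JE] : exists J, forall i v, 'd (f_ i) a v = v *m J i.
  by exists (fun i => jacobian (f_ i) a) => i v; rewrite mul_rV_lin1.
have dJ (e : R) i j (v : 'rV[C]_l) : (forall x, rnorm (x - a) < r -> rnorm (f_ i x - f_ j x) <= e) ->
    rnorm (v *m (J i - J j)) * r <= 2 * e * rnorm v.
  move=> hij; have := @diff_bound _ _ _ (f_ i \- f_ j) a r e v r0 (dB i j) hij.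
  have -> // : 'd (f_ i \- f_ j) a v = v *m (J i - J j).
  rewrite [RHS]mulmxBr -(JE i) -(JE j).
  exact: (congr1 (@^~ v) (diffB (fd i a aa) (fd j a aa))).
have delta1 p : rnorm (delta_mx 0 p : 'rV[C]_l) <= 1.
  apply: rnorm_rV_le => // j; rewrite mxE /=.
  by case: (_ == _); rewrite ?rnorm1 // rnorm0.
have ent p q : exists c, forall e : R, 0 < e -> exists N, forall i, (N <= i)%N ->
    rnorm (J i p q - c) < e.
  apply: cauchy_limit => e e0.
  have e4 : 0 < e * r / 4 by rewrite divr_gt0 // mulr_gt0.
  have [N hN] := cau _ e4; exists N => i j Ni Nj.
  have h1 := dJ _ i j (delta_mx 0 p) (fun x xr => hN i j x Ni Nj xr).
  have : rnorm (J i p q - J j p q) * r <= 2 * (e * r / 4).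
    rewrite -[leRHS]mulr1; apply: le_trans (le_trans _ h1) _.
      apply: ler_wpM2r; first exact: ltW.
      have := rnorm_coord (delta_mx 0 p *m (J i - J j)) q.
      by rewrite -rowE !mxE.
    by apply: ler_wpM2l => //; rewrite mulr_ge0 // ltW.
  by rewrite -(ltr_pM2r r0); have := mulr_gt0 e0 r0; lra.
have [L hL] : exists L : 'M[C]_(l, k), forall e : R, 0 < e -> exists N, forall i, (N <= i)%N ->
    forall p q, rnorm (J i p q - L p q) <= e.
  have [u hu] := choice (fun pq : 'I_l * 'I_k => ent pq.1 pq.2).
  exists (\matrix_(p, q) u (p, q)) => e e0.
  have [n hn] := choice (fun pq => hu pq e e0).
  exists (\max_pq n pq)%N => i Ni p q; rewrite mxE; apply: ltW.
  by apply: (hn (p, q)); apply: leq_trans Ni; exact: leq_bigmax.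
have Lc : continuous (mulmxr L : 'rV[C]_l -> 'rV[C]_k).
  have [b b0 hb] := mulmx_bounded L.
  move=> x; apply/rnorm_continuous_at => e e0; exists (e / b); first by rewrite divr_gt0.
  move=> y; rewrite ltr_pdivlMr // mulrC /= -mulmxBl; exact: le_lt_trans.
apply: (differentiable_of_rnorm Lc) => e e0 /=.
(* With the factor 2 of Schwarz's lemma, a distance e r / 8 between two maps bounds the difference
   of their increments by e / 4 times |y - a|. *)
have e1 : 0 < e * r / 8 by rewrite divr_gt0 // mulr_gt0.
have l1 : 0 < 4 * (l%:R + 1) :> R by rewrite mulr_gt0 // ltr_wpDl.
have e2 : 0 < e / (4 * (l%:R + 1)) by rewrite divr_gt0.
have [N1 h1] := cau _ e1; have [N2 h2] := hL _ e2.
pose i := maxn N1 N2.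
have e4 : 0 < e / 4 by rewrite divr_gt0.
have [d d0 hd] := differentiable_rnorm (fd i a aa) e4.
exists (Num.min d r) => [|y]; first by rewrite lt_min d0.
rewrite lt_min => /andP[/hd k2 yr].
have k3 : rnorm ((y - a) *m (J i - L)) <= e / 4 * rnorm (y - a).
  apply: le_trans (mulmx_rnorm _ (ltW e2) _) _.
    by move=> p q; rewrite !mxE; apply: h2; rewrite leq_maxr.
  apply: ler_wpM2r; first exact: rnorm_ge0.
  rewrite mulrA ler_pdivrMr //; have := mulr_ge0 (ler0n R l) (ltW e0); lra.
(* The Schwarz estimate for [f_ j \- f_ i], with j tending to infinity. *)
have k1 : rnorm (h y - h a - (f_ i y - f_ i a)) <= e / 4 * rnorm (y - a).
  apply/ler_addgt0Pl => eta eta0; have eta2 : 0 < eta / 2 by rewrite divr_gt0.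
  have [N3 h3] := fh _ eta2; pose j := maxn N1 N3.
  have hij x : rnorm (x - a) < r -> rnorm (f_ j x - f_ i x) <= e * r / 8.
    by move=> xr; apply: h1 => //; exact: leq_maxl.
  have := @schwarz_ball _ _ _ (f_ j \- f_ i) a r _ y (dB j i) hij yr.
  have -> : 2 * (e * r / 8) * rnorm (y - a) = e / 4 * rnorm (y - a) * r by field.
  rewrite ler_pM2r //= => kk.
  have j1 := h3 j y (leq_maxr _ _) yr; have j2 := h3 j a (leq_maxr _ _) aa.
  have -> : h y - h a - (f_ i y - f_ i a) =
      (f_ j y - f_ i y - (f_ j a - f_ i a)) + ((f_ j a - h a) - (f_ j y - h y)).
    by apply/rowP => q; rewrite !mxE; ring.
  apply: le_trans (rnormD _ _) _.
  have := rnormD (f_ j a - h a) (- (f_ j y - h y)); rewrite rnormN; rlra.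
have -> : h y - h a - (y - a) *m L = (h y - h a - (f_ i y - f_ i a)) +
    (f_ i y - f_ i a - 'd (f_ i) a (y - a)) + (y - a) *m (J i - L).
  by rewrite JE mulmxBr; apply/rowP => q; rewrite !mxE; ring.
apply: le_trans (rnormD _ _) _.
have := rnormD (h y - h a - (f_ i y - f_ i a)) (f_ i y - f_ i a - 'd (f_ i) a (y - a)).
have := mulr_ge0 (ltW e0) (rnorm_ge0 (y - a)).
rlra.
Qed.

End Limits.

(** * A Kobayashi-type chain distance *)

Section ChainMetric.
Context {R : realType} {k : nat}.
Local Notation C := (CC R).
Local Notation Ck := 'rV[C]_k.
Implicit Types (W U : set Ck) (x y z : Ck) (phi : C -> Ck).

Lemma unit_discE (z : C) : unit_disc z <-> rnorm z < 1.
Proof. by rewrite /unit_disc /= rnormE -cc1 cc_lt. Qed.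

Definition disc_in W phi := holomorphic_on unit_disc phi /\ phi @` unit_disc `<=` W.

(* Charging [rnorm b] instead of the Poincare distance from [0] to [b] keeps the
   contraction property and spares the automorphisms of the disc; the two orientations
   make the chain distance symmetric. *)
Definition hstep W x y (t : R) := exists phi b, [/\ disc_in W phi, unit_disc b, t = rnorm b &
  (x = phi 0 /\ y = phi b) \/ (x = phi b /\ y = phi 0)].

Inductive hchain W : Ck -> Ck -> R -> Prop :=
| hchain_nil x : hchain W x x 0
| hchain_cons x y z t l : hstep W x y t -> hchain W y z l -> hchain W x z (t + l).

Lemma unit_disc0 : unit_disc (0 : C).
Proof. by apply/unit_discE; rewrite rnorm0. Qed.

Lemma hstep_ge0 W x y t : hstep W x y t -> 0 <= t.
Proof. by move=> [phi [b [_ _ -> _]]]; exact: rnorm_ge0. Qed.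

Lemma hchain_ge0 W x y l : hchain W x y l -> 0 <= l.
Proof. by elim=> // {}x {}y z t {}l /hstep_ge0 t0 _; exact: addr_ge0. Qed.

Lemma hstep_sym W x y t : hstep W x y t -> hstep W y x t.
Proof.
move=> [phi [b [h1 h2 h3 h4]]]; exists phi, b; split=> //.
by case: h4 => -[-> ->]; [right|left].
Qed.

Lemma hchain_trans W x y z l m : hchain W x y l -> hchain W y z m -> hchain W x z (l + m).
Proof.
elim=> [{}x|{}x {}y w t {}l xy _ IH] yz; first by rewrite add0r.
by rewrite -addrA; apply: hchain_cons xy _; exact: IH.
Qed.

Lemma hchain_step W x y t : hstep W x y t -> hchain W x y t.
Proof. by move=> h; rewrite -[t]addr0; apply: hchain_cons h _; exact: hchain_nil. Qed.

Lemma hchain_sym W x y l : hchain W x y l -> hchain W y x l.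
Proof.
elim=> [{}x|{}x {}y w t {}l xy _ IH]; first exact: hchain_nil.
by rewrite addrC; apply: hchain_trans IH _; apply: hchain_step; exact: hstep_sym.
Qed.

(** Composition with g turns discs in W into discs in W' with the same marked points; every
    contraction property below comes from this. *)
Lemma hchain_map W W' (g : Ck -> Ck) x y l : holomorphic_on W g -> g @` W `<=` W' ->
  hchain W x y l -> hchain W' (g x) (g y) l.
Proof.
move=> gh gW; elim=> [{}x|{}x {}y w t {}l [phi [b [[ph pW] hb tE h]]] _ IH].
  exact: hchain_nil.
apply: hchain_cons IH; exists (g \o phi), b; split=> //.
  split=> [z zd|_ [z zd <-]].
    by apply: differentiable_comp; [exact: ph|apply: gh; apply: pW; exists z].
  by apply: gW; exists (phi z) => //; apply: pW; exists z.
by case: h => -[-> ->]; [left|right].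
Qed.

(** Chain distance less than e; the distance itself, which would be infinite between points without
    a chain, is never formed. *)
Definition chain_lt W x y (e : R) := exists2 l, l < e & hchain W x y l.

Lemma chain_lt_refl W x e : 0 < e -> chain_lt W x x e.
Proof. by move=> e0; exists 0 => //; exact: hchain_nil. Qed.

Lemma chain_lt_sym W x y e : chain_lt W x y e -> chain_lt W y x e.
Proof. by move=> [l le /hchain_sym h]; exists l. Qed.

Lemma chain_lt_trans y W x z d e : chain_lt W x y d -> chain_lt W y z e -> chain_lt W x z (d + e).
Proof.
move=> [l ld h1] [m me h2]; exists (l + m); first exact: ltrD.
exact: hchain_trans h1 h2.
Qed.

Lemma chain_lt_le W x y d e : d <= e -> chain_lt W x y d -> chain_lt W x y e.
Proof. by move=> de [l ld h]; exists l => //; exact: lt_le_trans de. Qed.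

Lemma chain_lt_map W W' (g : Ck -> Ck) x y e : holomorphic_on W g -> g @` W `<=` W' ->
  chain_lt W x y e -> chain_lt W' (g x) (g y) e.
Proof. by move=> gh gW [l le h]; exists l => //; exact: hchain_map gh gW h. Qed.

Lemma chain_lt_sub W W' x y e : W `<=` W' -> chain_lt W x y e -> chain_lt W' x y e.
Proof.
move=> sub; apply: (@chain_lt_map W W' id); last by move=> _ [z Wz <-]; exact: sub.
by move=> z _; exact: ex_diff.
Qed.

(** The affine disc of radius r around x in the direction of y costs |y - x| / r. Bounding [m] by 1
    keeps the marked point in the unit disc. *)
Lemma chain_lt_nbhs W x e : open W -> W x -> 0 < e ->
  exists2 d : R, 0 < d & forall y, rnorm (y - x) < d -> W y /\ chain_lt W x y e.
Proof.
move=> /open_rnormP Wo Wx e0; have [r r0 hr] := Wo x Wx.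
pose m := Num.min e 1.
have m0 : 0 < m by rewrite lt_min e0 ltr01.
have m1 : m <= 1 by rewrite ge_min lexx orbT.
have me : m <= e by rewrite ge_min lexx.
exists (r * m) => [|y yx]; first exact: mulr_gt0.
have yr : rnorm (y - x) < r.
  by apply: lt_le_trans yx _; rewrite -[leRHS]mulr1 ler_pM2l.
split; first exact: hr.
have [u u1 vE] := unit_direction (y - x).
pose phi (t : C) : Ck := x + (cc r * t) *: u.
have bm : rnorm (cc (rnorm (y - x) / r)) < m.
  rewrite rnorm_cc ger0_norm ?divr_ge0 ?rnorm_ge0 ?(ltW r0) //.
  by rewrite ltr_pdivrMr // mulrC.
exists (rnorm (cc (rnorm (y - x) / r))); first exact: lt_le_trans me.
apply: hchain_step; exists phi, (cc (rnorm (y - x) / r)); split.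
- split=> [t _|_ [t /unit_discE t1 <-]].
    apply: differentiableD; first exact: differentiable_cst.
    have -> : (fun t : C => (cc r * t) *: u) = (fun t : C => t *: (cc r *: u)).
      by apply/funext => s; rewrite scalerA mulrC.
    by apply: (@differentiableZl C C _ id); exact: ex_diff.
  apply: hr; rewrite /phi addrAC subrr add0r rnormZ rnormM rnorm_cc ger0_norm ?(ltW r0) //.
  rewrite -[ltRHS]mulr1 -mulrA ltr_pM2l //; apply: le_lt_trans t1.
  by rewrite -[leRHS]mulr1; apply: ler_wpM2l => //; exact: rnorm_ge0.
- by apply/unit_discE; exact: lt_le_trans m1.
- by [].
- left; rewrite /phi mulr0 scale0r addr0; split=> //.
  by rewrite -ccM mulrCA divff ?gt_eqF // mulr1 -vE addrC subrK.
Qed.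

Lemma disc_in_continuous W phi (z : C) : disc_in W phi -> unit_disc z -> {for z, continuous phi}.
Proof. by move=> [ph _] /ph; exact: differentiable_continuous. Qed.

(** The intermediate value theorem along the radius from 0 to b; minimum and maximum allow for both
    orientations of a step. *)
Lemma disc_crossing W phi b x0 (rho : R) : disc_in W phi -> unit_disc b ->
  Num.min (rnorm (phi 0 - x0)) (rnorm (phi b - x0)) <= rho <=
  Num.max (rnorm (phi 0 - x0)) (rnorm (phi b - x0)) ->
  exists s, [/\ unit_disc s, rnorm s <= rnorm b & rnorm (phi s - x0) = rho].
Proof.
move=> hphi hb hrho.
have bd (t : R) : 0 <= t <= 1 -> rnorm (cc t * b) <= rnorm b.
  move=> /andP[t0 t1]; rewrite rnormM rnorm_cc ger0_norm //.
  by rewrite -[leRHS]mul1r; apply: ler_wpM2r => //; exact: rnorm_ge0.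
have bu (t : R) : 0 <= t <= 1 -> unit_disc (cc t * b).
  by move=> /bd h; apply/unit_discE; apply: le_lt_trans h _; exact/unit_discE.
have [] := @IVT R (fun t => rnorm (phi (cc t * b) - x0)) 0 1 rho ler01.
- apply: within_segment_continuous => t tt; apply/cvgrPdist_lt => e e0.
  have [d d0 hd] := (rnorm_continuous_at _ _).1 (disc_in_continuous hphi (bu t tt)) e e0.
  have b1 : 0 < rnorm b + 1 by have := rnorm_ge0 b; lra.
  apply/nbhs_ballP; exists (d / (rnorm b + 1)) => /=; first by rewrite divr_gt0.
  move=> s; rewrite /ball /= ltr_pdivlMr // => hs.
  have := hd (cc s * b); rewrite -mulrBl -ccB rnormM rnorm_cc => hh.
  have {hh}/hh : `|s - t| * rnorm b < d.
    apply: le_lt_trans hs; rewrite distrC; apply: ler_wpM2l => //; lra.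
  rewrite /=; set p := phi (cc s * b); set q := phi (cc t * b) => pq.
  have := rnorm_tri q p x0; have := rnorm_tri p q x0; rewrite (rnorm_dist q p).
  rewrite ltr_norml; move: pq => pq h1 h2; apply/andP; split; rlra.
- by rewrite cc0 cc1 mul0r mul1r.
move=> t; rewrite in_itv /= => tt h; exists (cc t * b); split => //.
  exact: bu.
exact: bd.
Qed.

(* The factor 2 accounts for a last disc traversed from the marked point to the center. *)
Lemma hchain_crossing W x0 (rho : R) x y l : hchain W x y l ->
  rnorm (x - x0) < rho -> rho <= rnorm (y - x0) ->
  exists s l', [/\ rnorm (s - x0) = rho, l' <= 2 * l & hchain W x s l'].
Proof.
elim=> [{}x h1 h2|{}x z {}y t {}l xz zy IH xrho yrho].
  by move: (lt_le_trans h1 h2); rewrite ltxx.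
have l0 := hchain_ge0 zy; have t0 := hstep_ge0 xz.
have [zrho|zrho] := ltP (rnorm (z - x0)) rho.
  have [s [l' [h1 h2 h3]]] := IH zrho yrho.
  by exists s, (t + l'); split=> //; [lra|exact: hchain_cons xz h3].
have [phi [b [hphi hb tE h]]] := xz.
have [s [hs sb srho]] : exists s, [/\ unit_disc s, rnorm s <= rnorm b & rnorm (phi s - x0) = rho].
  apply: disc_crossing hphi hb _; case: h => -[<- <-].
    by rewrite ge_min le_max (ltW xrho) zrho /= orbT.
  by rewrite ge_min le_max (ltW xrho) zrho orbT.
have st : hchain W (phi 0) (phi s) (rnorm s).
  by apply: hchain_step; exists phi, s; split => //; left.
exists (phi s); case: h => -[xE zE].
  by exists (rnorm s); rewrite xE; split=> //; rewrite tE in t0 *; rlra.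
exists (rnorm b + rnorm s); split=> //; first by rewrite tE; rlra.
by apply: hchain_cons st; exists phi, b; split=> //; right.
Qed.

(** * Hyperbolicity and the topology of the chain distance *)

Definition hyperbolic W := forall x y, W x -> W y -> x <> y -> exists2 e : R, 0 < e & ~ chain_lt W x y e.

Lemma hyperbolic_sub W U : W `<=` U -> hyperbolic U -> hyperbolic W.
Proof.
move=> sub h x y Wx Wy xy; have [e e0 he] := h x y (sub _ Wx) (sub _ Wy) xy.
by exists e => // /(chain_lt_sub sub).
Qed.

Lemma compact_rnorm_sphere x (r : R) : compact [set y : Ck | rnorm (y - x) = r].
Proof.
have -> : [set y | rnorm (y - x) = r] =
    [set y | rnorm (y - x) <= r] `&` [set y | r <= rnorm (y - x)].
  apply/seteqP; split=> y /= => [->//|[h1 h2]].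
  by apply/eqP; rewrite eq_le h1.
apply: (@subclosed_compact _ _ [set y | rnorm (y - x) <= r]).
- by apply: closedI; [exact: closed_rnorm_le|exact: closed_rnorm_ge].
- exact: compact_rnorm_ball.
- by move=> y [].
Qed.

(* Barth's argument: chains are continuous, so they cross the sphere, which is compact. *)
Lemma chain_lt_ball W x (rho : R) : open W -> hyperbolic W -> W x -> 0 < rho ->
  exists2 e : R, 0 < e & forall y, chain_lt W x y e -> rnorm (y - x) < rho.
Proof.
move=> Wo hyp Wx rho0; have [r r0 hr] := (open_rnormP W).1 Wo x Wx.
pose q := Num.min rho (r / 2).
have q0 : 0 < q by rewrite lt_min rho0 divr_gt0.
have qr : q < r by have : q <= r / 2 by [rewrite ge_min lexx orbT]; lra.
have qrho : q <= rho by rewrite ge_min lexx.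
have : \forall e \near (0 : R)^'+, forall s, rnorm (s - x) = q -> ~ chain_lt W x s e.
  have /compact_near_coveringP nc := @compact_rnorm_sphere x q.
  apply: (nc R (0 : R)^'+ (fun e s => ~ chain_lt W x s e)) => s /= sq.
  have Ws : W s by apply: hr; rewrite sq.
  have xs : x <> s by move=> xs; move: sq; rewrite xs subrr rnorm0; lra.
  have [e e0 he] := hyp x s Wx Ws xs.
  have e2 : 0 < e / 2 by rewrite divr_gt0.
  have [d d0 hd] := chain_lt_nbhs Wo Ws e2.
  have n1 : nbhs s [set y | rnorm (y - s) < d] by apply/nbhs_rnormP; exists d.
  have n2 : (0 : R)^'+ [set y | y < e / 2] by exact: nbhs_right_lt.
  exists ([set y | rnorm (y - s) < d], [set y | y < e / 2]) => // -[y t] [/= /hd[_ ys] te] xy.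
  apply: he; rewrite [e]splitr; apply: chain_lt_trans (chain_lt_sym ys).
  exact: chain_lt_le (ltW te) xy.
move=> he.
near (0 : R)^'+ => e.
have e0 : 0 < e by near: e; exact: nbhs_right_gt.
have h : forall s, rnorm (s - x) = q -> ~ chain_lt W x s e by near: e.
(* Halved because the chain up to the crossing may be twice as long. *)
exists (e / 2) => [|y [l le yl]]; first by rewrite divr_gt0.
rewrite ltNge; apply/negP => yrho.
have := @hchain_crossing W x q x y l yl; rewrite subrr rnorm0 => /(_ q0 (le_trans qrho yrho)).
move=> [s [l' [sq l'l sl']]]; apply: (h s sq); exists l' => //; lra.
Unshelve. all: by end_near. Qed.

Lemma bounded_rnorm U : bounded_set U -> exists M : R, forall x, U x -> rnorm x <= M.
Proof.
move=> [m [mreal hm]]; exists (`|complex.Re m| + 1) => x Ux.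
rewrite -cc_le -rnormE; apply: hm => //.
have mE : m = cc (complex.Re m).
  case/orP: mreal => [/ge0_cc//|m0].
  have : 0 <= - m by rewrite oppr_ge0.
  by move=> /ge0_cc; rewrite ReCN ccN => /oppr_inj.
by rewrite {1}mE cc_lt; have := ler_norm (complex.Re m); lra.
Qed.

(** By Schwarz's lemma a disc bounded by M moves its marked point by at most 2 M times its length,
    so the length of a chain controls the distance of its ends. *)
Lemma bounded_hyperbolic U : bounded_set U -> hyperbolic U.
Proof.
move=> /bounded_rnorm[M hM] x y Ux Uy xy.
have M0 : 0 <= M by apply: le_trans (hM x Ux); exact: rnorm_ge0.
have key a b l : hchain U a b l -> rnorm (a - b) <= 2 * M * l.
  elim=> [{}a|{}a z {}b t {}l [phi [c [[ph pU] hc tE h]]] _ IH].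
    by rewrite subrr rnorm0 mulr0.
  have : rnorm (a - z) <= 2 * M * t.
    have := @schwarz_ball R k C phi 0 1 M c.
    rewrite mulr1 subr0 -tE => hs.
    have : rnorm (phi c - phi 0) <= 2 * M * t.
      apply: hs => [w|w|]; rewrite ?subr0; last by rewrite tE; exact/unit_discE.
        by move=> /unit_discE/ph.
      by move=> /unit_discE wd; apply: hM; apply: pU; exists w.
    by case: h => -[-> ->]; rewrite // rnorm_dist.
  have := rnorm_tri z a b; rewrite mulrDr; lra.
have d0 : 0 < rnorm (x - y) by rewrite rnorm_gt0 subr_eq0; exact/eqP.
have K0 : 0 < 2 * M + 1 by lra.
exists (rnorm (x - y) / (2 * M + 1)) => [|[l le /[dup] /hchain_ge0 l0 /key]].
  by rewrite divr_gt0.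
by move: le; rewrite ltr_pdivlMr // => le h; clear xy; lra.
Qed.

Lemma poincare_dist_step (t : R) : 0 <= t < 1 / 2 -> ln ((1 + t) / (1 - t)) <= 4 * t.
Proof.
move=> /andP[t0 t1].
have -> : (1 + t) / (1 - t) = 1 + 2 * t / (1 - t) by field; rewrite gt_eqF //; lra.
apply: le_trans (le_ln1Dx _) _.
  by apply: lt_le_trans (_ : 0 <= _); [lra|rewrite divr_ge0 // ?mulr_ge0 //; lra].
rewrite ler_pdivrMr; last lra.
nra.
Qed.

(** In a chain shorter than 1 / 2 every marked point has modulus below 1 / 2, and its Poincare
    distance to 0 is then at most four times that modulus. Short chains thus bound the Kobayashi
    distance. *)
Lemma kobayashi_hyperbolicW U : kobayashi_hyperbolic U -> hyperbolic U.
Proof.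
move=> kob x y Ux Uy xy; have := kob x y Ux Uy xy; rewrite /kobayashi_dist => inf0.
have key a b l : hchain U a b l -> l < 1 / 2 -> exists2 l', l' <= 4 * l & disc_chain U a b l'.
  elim=> [{}a _|{}a z {}b t {}l /[dup] /hstep_ge0 t0 [phi [c [[ph pU] hc tE h]]] zb IH tl].
    by exists 0; rewrite ?mulr0 //; exact: disc_chain_nil.
  have l0 := hchain_ge0 zb.
  have [|l' l'l hl'] := IH; first lra.
  exists (ln ((1 + t) / (1 - t)) + l').
    by rewrite mulrDr; apply: lerD => //; apply: poincare_dist_step; apply/andP; split; lra.
  case: h => -[aE zE]; rewrite zE in hl'; rewrite aE.
    have -> : ln ((1 + t) / (1 - t)) = poincare_dist 0 c.
      by rewrite /poincare_dist /= mulr0 subr0 divr1 sub0r -[modulus _]/(rnorm _) rnormN tE.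
    by apply: disc_chain_cons hl' => //; exact: unit_disc0.
  have -> : ln ((1 + t) / (1 - t)) = poincare_dist c 0.
    by rewrite /poincare_dist /= rmorph0 mul0r !subr0 divr1 -[modulus _]/(rnorm _) tE.
  by apply: disc_chain_cons hl' => //; exact: unit_disc0.
have [r r0 hr] : exists2 r : R, 0 < r & forall l, disc_chain U x y l -> r <= l.
  move: inf0; set S := [set l%:E | l in disc_chain U x y]%E => inf0.
  have lb l : disc_chain U x y l -> (ereal_inf S <= l%:E)%E.
    by move=> hl; apply: ereal_inf_lbound; exists l.
  case E : (ereal_inf S) inf0 lb => [r| |] // r0 lb.
    by exists r => // l /lb; rewrite lee_fin.
  (* An infinite Kobayashi distance means that no chain exists, so any bound serves. *)
  by exists 1 => // l /lb.
exists (Num.min (1 / 2) (r / 8)) => [|[l]].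
  by rewrite lt_min !divr_gt0.
rewrite lt_min => /andP[l1 l2] hl.
by have [l' h1 /hr h2] := key _ _ _ hl l1; clear xy inf0; lra.
Qed.

End ChainMetric.

(** * Iteration of a holomorphic self-map *)

Lemma diff_compE (K : numFieldType) (E F G : normedModType K) (f : E -> F) (g : F -> G)
    (x : E) : differentiable f x -> differentiable g (f x) ->
  forall v, 'd (g \o f) x v = 'd g (f x) ('d f x v).
Proof. by move=> fd gd v; rewrite diff_comp. Qed.

Lemma diff_subc (K : numFieldType) (E F : normedModType K) (f : E -> F) (x v : E) (b : F) :
  differentiable f x -> 'd (f \- cst b) x v = 'd f x v.
Proof.
by move=> fd; rewrite (diffB fd (differentiable_cst b x)) diff_cst /= subr0.
Qed.

Lemma diff_iter_fixed (K : numFieldType) (E : normedModType K) (f : E -> E) (c v : E)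
    (a : K) n : f c = c -> differentiable f c -> 'd f c v = a *: v ->
  differentiable (iter n f) c /\ 'd (iter n f) c v = a ^+ n *: v.
Proof.
move=> fc fd fv; have itc j : iter j f c = c by elim: j => //= j ->.
elim: n => [|n [IHd IH]].
  have -> : iter 0 f = id by [].
  by split; [exact: ex_diff|rewrite expr0 scale1r diff_val].
have fd' : differentiable f (iter n f c) by rewrite (itc n).
have -> : iter n.+1 f = f \o iter n f by [].
split; first exact: differentiable_comp.
by rewrite (diff_compE IHd fd') IH (itc n) linearZ /= fv scalerA exprSr.
Qed.

Section Dynamics.
Context {R : realType} {k : nat}.
Local Notation C := (CC R).
Local Notation Ck := 'rV[C]_k.

Definition seq_lim (u : nat -> Ck) (l : Ck) :=
  forall e : R, 0 < e -> exists N, forall i, (N <= i)%N -> rnorm (u i - l) < e.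

Lemma seq_lim_unique u l m : seq_lim u l -> seq_lim u m -> l = m.
Proof.
move=> hl hm; apply/eqP; rewrite -subr_eq0; apply/eqP/rnorm_eps => e e0.
have e2 : 0 < e / 2 by rewrite divr_gt0.
have [N hN] := hl _ e2; have [M hM] := hm _ e2.
have h1 := hN (maxn N M) (leq_maxl _ _); have h2 := hM (maxn N M) (leq_maxr _ _).
have := rnorm_tri (u (maxn N M)) l m; rewrite (rnorm_dist l (u _)); rlra.
Qed.

Lemma seq_lim_continuous u l (f : Ck -> Ck) : {for l, continuous f} -> seq_lim u l ->
  seq_lim (fun i => f (u i)) (f l).
Proof.
move=> /rnorm_continuous_at fc hu e /fc[d d0 hd]; have [N hN] := hu d d0.
by exists N => i /hN; exact: hd.
Qed.

Section SelfMap.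
Context (W : set Ck) (g : Ck -> Ck).
Context (Wo : open W) (Whyp : hyperbolic W).
Context (gh : holomorphic_on W g) (gW : g @` W `<=` W).

Lemma iter_stable n z : W z -> W (iter n g z).
Proof. by move=> Wz; elim: n => // n IH /=; apply: gW; exists (iter n g z). Qed.

Lemma iter_image n : iter n g @` W `<=` W.
Proof. by move=> _ [z Wz <-]; exact: iter_stable. Qed.

Lemma iter_holomorphic n : holomorphic_on W (iter n g).
Proof.
elim: n => [|n IH] z Wz; first exact: ex_diff.
by apply: (@differentiable_comp _ _ _ _ (iter n g) g); [exact: IH|apply: gh; exact: iter_stable].
Qed.

Lemma chain_lt_iter n x y e : chain_lt W x y e -> chain_lt W (iter n g x) (iter n g y) e.
Proof. exact: chain_lt_map (iter_holomorphic n) (@iter_image n). Qed.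

Lemma seq_lim_chain_lt u l (e : R) : W l -> seq_lim u l -> 0 < e ->
  exists N, forall i, (N <= i)%N -> chain_lt W l (u i) e.
Proof.
move=> Wl hu e0; have [d d0 hd] := chain_lt_nbhs Wo Wl e0.
by have [N hN] := hu d d0; exists N => i /hN/hd[].
Qed.

Lemma chain_lt_seq_lim u l : W l -> (forall e, 0 < e -> exists N, forall i, (N <= i)%N ->
  chain_lt W l (u i) e) -> seq_lim u l.
Proof.
move=> Wl hu e e0; have [d d0 hd] := chain_lt_ball Wo Whyp Wl e0.
by have [N hN] := hu d d0; exists N => i /hN/hd.
Qed.

(** Time can be run backwards: for a return near q at a time j >= a, applying g^(j - a) carries the
    points at times a and n to those at times j and j - a + n, which are close to the points at
    times 0 and n - a. *)
Lemma recurrent_isometry q n a e : W q ->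
  (forall d, 0 < d -> forall N, exists2 j, (N <= j)%N & chain_lt W q (iter j g q) d) ->
  (a <= n)%N -> chain_lt W (iter a g q) (iter n g q) e ->
  forall d, 0 < d -> chain_lt W q (iter (n - a) g q) (e + d).
Proof.
move=> Wq rec an h d d0; have d2 : 0 < d / 2 by rewrite divr_gt0.
have [j aj hj] := rec _ d2 a.
have h1 : chain_lt W (iter j g q) (iter (j - a + n) g q) e.
  have := chain_lt_iter (j - a) h.
  by rewrite -!iterD subnK.
have h2 : chain_lt W (iter (j - a + n) g q) (iter (n - a) g q) (d / 2).
  have := chain_lt_sym (chain_lt_iter (n - a) hj).
  rewrite -iterD; congr (chain_lt _ (iter _ _ _) _ _).
  by rewrite -{2}(subnK an) addnA addnAC subnK // addnC.
have -> : e + d = d / 2 + e + d / 2 by field.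
by apply: chain_lt_trans h2; exact: chain_lt_trans hj h1.
Qed.

(* After Calka: finitely many points of the orbit form a net of the part of the orbit in
   the ball, and since [g] is isometric along the orbit, subtracting the time of a net
   point from a return time gives an earlier return, so the gaps are bounded. *)
Lemma recurrent_orbit_compact q : W q ->
  (forall d, 0 < d -> forall N, exists2 j, (N <= j)%N & chain_lt W q (iter j g q) d) ->
  exists B A, [/\ compact B, B `<=` W &
    forall n, exists b y, [/\ (b <= A)%N, B y & iter n g q = iter b g y]].
Proof.
move=> Wq rec; have [r r0 hr] := (open_rnormP W).1 Wo q Wq.
have r2 : 0 < r / 2 by rewrite divr_gt0.
pose B := [set y : Ck | rnorm (y - q) <= r / 2].
have BW : B `<=` W by move=> y /= yr; apply: hr; apply: le_lt_trans yr _; lra.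
have [e e0 he] := chain_lt_ball Wo Whyp Wq r2.
have [A hA] : exists A, forall n, B (iter n g q) ->
    exists a, [/\ (0 < a)%N, (a <= A)%N & chain_lt W (iter a g q) (iter n g q) (e / 2)].
  have /compact_near_coveringP nc := @compact_rnorm_ball R k q (r / 2).
  have : \forall A \near \oo, forall z, B z -> forall n, z = iter n g q ->
      exists a, [/\ (0 < a)%N, (a <= A)%N & chain_lt W (iter a g q) z (e / 2)].
    apply: (nc nat \oo (fun A z => forall n, z = iter n g q ->
      exists a, [/\ (0 < a)%N, (a <= A)%N & chain_lt W (iter a g q) z (e / 2)])) => y By.
    have Wy := BW _ By.
    have e8 : 0 < e / 8 by rewrite divr_gt0.
    have [d d0 hd] := chain_lt_nbhs Wo Wy e8.
    have ny : nbhs y [set z | rnorm (z - y) < d] by apply/nbhs_rnormP; exists d.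
    have [[n0 hn0]|hno] := pselect (exists n, rnorm (iter n g q - y) < d); last first.
      exists ([set z | rnorm (z - y) < d], setT) => [|[z A] [/= zd _] n zE].
        by split=> //; exact: filterT.
      by exfalso; apply: hno; exists n; rewrite -zE.
    (* The time near y is made positive by adding a return time, which makes the descent in [down]
       strict. *)
    have [a a0 ha] : exists2 a, (0 < a)%N & chain_lt W y (iter a g q) (e / 4).
      have [_ yn0] := hd _ hn0.
      have [j j1 hj] := rec _ e8 1%N.
      exists (n0 + j)%N; first by rewrite addn_gt0 j1 orbT.
      have -> : e / 4 = e / 8 + e / 8 by field.
      apply: chain_lt_trans yn0 _; rewrite iterD; exact: chain_lt_iter.
    exists ([set z | rnorm (z - y) < d], [set A | (a <= A)%N]) => [|[z A] [/= /hd[_ yz] aA] n _].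
      by split=> //; exists a.
    exists a; split=> //.
    have -> : e / 2 = e / 4 + e / 4 by field.
    apply: chain_lt_trans (chain_lt_sym ha) _; apply: chain_lt_le yz; lra.
  by move=> [A _ /(_ A (leqnn A)) h]; exists A => n Bn; exact: h Bn n erefl.
pose Ret n := chain_lt W q (iter n g q) e.
have RetB n : Ret n -> B (iter n g q) by move=> /he/ltW.
have down n : Ret n -> (A <= n)%N -> exists2 m, Ret m & (m < n <= m + A)%N.
  move=> Rn An; have [a [a0 aA han]] := hA n (RetB n Rn).
  have an : (a <= n)%N by exact: leq_trans An.
  exists (n - a)%N.
    have e2 : 0 < e / 2 by rewrite divr_gt0.
    by have := recurrent_isometry Wq rec an han e2; rewrite -splitr.
  by rewrite ltn_subrL a0 (leq_trans a0 an) /= -{1}(subnK an) leq_add2l.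
exists B, A; split => //; first exact: compact_rnorm_ball.
move=> n; have [j nj Rj] := rec e e0 n.
suff [m [Rm mn nmA]] : exists m, [/\ Ret m, (m <= n)%N & (n <= m + A)%N].
  exists (n - m)%N, (iter m g q); split; [|exact: RetB|by rewrite -iterD subnK].
  by rewrite leq_subLR.
(* Descent from a return time not before n by steps of at most A. It ends at a return time m with m
   <= n <= m + A, possibly at time 0 once the time is below A. *)
elim: j {-2}j (leqnn j) nj Rj => [|j IH] i ij ni Ri.
  by exists i; split=> //; move: ij ni; rewrite leqn0 => /eqP -> //; rewrite leqn0 => /eqP->.
have [iA|Ai] := ltnP i A.
  exists 0%N; split=> //; last by rewrite add0n; apply: leq_trans ni (ltnW iA).
  exact: chain_lt_refl.
have [m Rm /andP[mi imA]] := down i Ri Ai.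
have [mn|nm] := leqP m n; first by exists m; split=> //; exact: leq_trans ni imA.
by apply: IH Rm; [rewrite -ltnS; exact: leq_trans mi ij|exact: ltnW].
Qed.

(** The orbit of g c, at the times t i, tends to c by hypothesis and to g c by continuity, so c is
    fixed. The whole sequence converges because an orbit that is within chain distance e of a fixed
    point stays so. *)
Lemma attracting_fixed (t : nat -> nat) c : W c ->
  (forall z, W z -> seq_lim (fun i => iter (t i) g z) c) ->
  g c = c /\ forall z, W z -> seq_lim (fun n => iter n g z) c.
Proof.
move=> Wc hc; have gc : g c = c.
  have Wgc : W (g c) by exact: (iter_stable 1).
  apply: (@seq_lim_unique (fun i => iter (t i) g (g c))); last exact: hc.
  have := seq_lim_continuous (differentiable_continuous (gh Wc)) (hc c Wc).
  by move=> h e /h[N hN]; exists N => i /hN; rewrite -iterS iterSr.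
split=> // z Wz; apply: chain_lt_seq_lim => // e e0.
have [N hN] := seq_lim_chain_lt Wc (hc z Wz) e0.
exists (t N) => n tn; have := chain_lt_iter (n - t N) (hN N (leqnn N)).
rewrite -iterD subnK //.
by have -> : iter (n - t N) g c = c by elim: (n - t N)%N => //= j ->.
Qed.

(** By Cauchy's estimate the differential of g^n at c has norm at most 1 / 2, and on an eigenvector
    it is multiplication by a^n. *)
Lemma attracting_eigenvalue (c : Ck) n (r : R) : g c = c -> 0 < r ->
  (forall x, rnorm (x - c) < r -> W x) ->
  (forall x, rnorm (x - c) < r -> rnorm (iter n g x - c) <= r / 4) ->
  forall a : C, eigenvalue (jacobian g c) a -> `|a| < 1.
Proof.
move=> gc r0 rW hr a /eigenvalueP[v vE v0].
have Wc : W c by apply: rW; rewrite subrr rnorm0.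
have dg : 'd g c v = a *: v by rewrite -vE mul_rV_lin1.
have [hc dit] := diff_iter_fixed n gc (gh Wc) dg.
have hd x : rnorm (x - c) < r -> differentiable (iter n g \- cst c) x.
  move=> xr; apply: differentiableB; last exact: differentiable_cst.
  by apply: iter_holomorphic; exact: rW.
have := @diff_bound R k _ (iter n g \- cst c) c r (r / 4) v r0 hd hr.
rewrite (diff_subc _ _ hc) dit.
have vn0 : 0 < rnorm v by rewrite rnorm_gt0.
rewrite rnormZ rnormX => h.
have {}h : rnorm a ^+ n <= 1 / 2.
  have rv : 0 < rnorm v * r by rewrite mulr_gt0.
  by rewrite -(ler_pM2r rv) mulrA; apply: le_trans h _; rewrite le_eqVlt; apply/orP; left; apply/eqP; field.
rewrite rnormE -cc1 cc_lt ltNge; apply/negP => a1.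
by have := exprn_ege1 n a1; lra.
Qed.

(** * Spreading of the convergence to the identity *)

Section Extension.
Context (t : nat -> nat).
Local Notation conv z := (seq_lim (fun i => iter (t i) g z) z).

(** Iterates do not increase the chain distance, so convergence at the single point z controls them
    on a whole neighbourhood. *)
Lemma conv_locally z (e : R) : W z -> conv z -> 0 < e ->
  exists d N, [/\ 0 < d :> R, forall y, rnorm (y - z) < d -> W y &
   forall i y, (N <= i)%N -> rnorm (y - z) < d -> rnorm (iter (t i) g y - y) < e].
Proof.
move=> Wz hz e0; have e2 : 0 < e / 2 by rewrite divr_gt0.
have [d d0 hd] := chain_lt_ball Wo Whyp Wz e2.
have d2 : 0 < d / 2 by rewrite divr_gt0.
have [N hN] := seq_lim_chain_lt Wz hz d2.
have [r r0 hr] := chain_lt_nbhs Wo Wz d2.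
exists (Num.min r (e / 2)), N; split; first by rewrite lt_min r0.
  by move=> y; rewrite lt_min => /andP[/hr[]].
move=> i y Ni; rewrite lt_min => /andP[/hr[_ zy] ye].
have : rnorm (iter (t i) g y - z) < e / 2.
  apply: hd; rewrite [d]splitr; apply: chain_lt_trans (hN i Ni) _.
  exact: chain_lt_iter.
have := rnorm_tri z (iter (t i) g y) y; rewrite (rnorm_dist z y); rlra.
Qed.

Lemma conv_uniform K : compact K -> K `<=` W -> (forall z, K z -> conv z) ->
  forall e : R, 0 < e -> exists N, forall i y, (N <= i)%N -> K y ->
    rnorm (iter (t i) g y - y) < e.
Proof.
move=> /compact_near_coveringP nc KW hK e e0.
have : \forall i \near \oo, forall y, K y -> rnorm (iter (t i) g y - y) < e.
  apply: (nc nat \oo (fun i y => rnorm (iter (t i) g y - y) < e)) => z Kz.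
  have [d [N [d0 _ hd]]] := conv_locally (KW _ Kz) (hK _ Kz) e0.
  exists ([set y | rnorm (y - z) < d], [set i | (N <= i)%N]) => [|[y i] [/= yd Ni]].
    by split; [apply/nbhs_rnormP; exists d|exists N].
  exact: hd.
by move=> [N _ hN]; exists N => i y /hN; apply.
Qed.

(** A Vitali-type theorem: the set of points near which the iterates tend to the identity is closed
    in W. Near a limit point z of it, contraction keeps the iterates bounded; smallness of g^(t i) -
    id on a little ball around a nearby point a then spreads to a ball that contains z. *)
Lemma conv_extend O : connected W -> open O -> O !=set0 -> O `<=` W ->
  (forall z, O z -> conv z) -> forall z, W z -> conv z.
Proof.
move=> Wc Oo [p Op] OW hO.
pose B := [set z | W z /\ exists2 r : R, 0 < r & forall y, rnorm (y - z) < r -> W y /\ conv y].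
suff BW : B = W by move=> z; rewrite -BW => -[_ [r r0 /(_ z)]]; rewrite subrr rnorm0 => /(_ r0)[].
have Bo : open B.
  apply/open_rnormP => z [Wz [r r0 hr]]; exists r => // y yr.
  split; first by have [] := hr y yr.
  exists (r - rnorm (y - z)); first by rewrite subr_gt0.
  move=> x xr; apply: hr; have := rnorm_tri y x z; rlra.
apply: Wc.
- exists p; split; first exact: OW.
  have [r r0 hr] := (open_rnormP O).1 Oo p Op.
  by exists r => // y /hr Oy; split; [exact: OW|exact: hO].
- by exists B => //; apply/seteqP; split=> [z Bz|z []//]; split=> //; case: Bz.
exists (closure B); first exact: closed_closure.
apply/seteqP; split=> [z Bz|z [Wz Bz]].
  by split; [case: Bz|exact: subset_closure].
(* A chain shorter than e from z ends within 1 of z. Three links shorter than e / 3 will lead from z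
   to the iterate of a, and from there, along the image of a chain through z, to the iterate of
   y. *)
have [e e0 he] := chain_lt_ball Wo Whyp Wz ltr01.
have e3 : 0 < e / 3 by rewrite divr_gt0.
have [d d0 hd] := chain_lt_nbhs Wo Wz e3.
(* With a within d / 8 of z, the ball of radius d / 8 around z lies in that of radius d / 4 around
   a, well inside the ball of radius d / 2 where the bound 1 + d holds. *)
have d8 : 0 < d / 8 by rewrite divr_gt0.
have [a [[Wa [r r0 hr]] /= az]] : B `&` [set y | rnorm (y - z) < d / 8] !=set0.
  by apply: Bz; apply/nbhs_rnormP; exists (d / 8).
have aconv : conv a by have [] := hr a ltac:(by rewrite subrr rnorm0).
have [N hN] := aconv _ d8.
pose F i := iter (t i) g \- id.
have ya y : rnorm (y - a) < d / 2 -> rnorm (y - z) < d.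
  by have := rnorm_tri a y z; rlra.
have FM i y : (N <= i)%N -> rnorm (y - a) < d / 2 -> rnorm (F i y) <= 1 + d.
  move=> Ni /ya yd; have [_ zy] := hd y yd.
  have [_ za] := hd a ltac:(rlra).
  have ha : rnorm (iter (t i) g a - z) < d.
    by have := hN i Ni; have := rnorm_tri a (iter (t i) g a) z; rlra.
  have [_ zga] := hd _ ha.
  have h1 : chain_lt W z (iter (t i) g y) (e / 3 + (e / 3 + e / 3)).
    apply: chain_lt_trans zga _; apply: chain_lt_iter.
    exact: chain_lt_trans (chain_lt_sym za) zy.
  have -> : F i y = (iter (t i) g y - z) - (y - z) by rewrite /F /= opprB addrA subrK.
  have := rnormD (iter (t i) g y - z) (- (y - z)); rewrite rnormN.
  have : rnorm (iter (t i) g y - z) < 1 by apply: he; apply: chain_lt_le h1; lra.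
  by rlra.
have Fd i y : rnorm (y - a) < d / 2 -> differentiable (F i) y.
  move=> /ya/hd[Wy _]; apply: differentiableB; [exact: iter_holomorphic|exact: ex_diff].
have [rho [rho0 rhor]] : exists rho : R, 0 < rho /\ rho < r by exists (r / 2); split; lra.
have Kconv := @conv_uniform [set y | rnorm (y - a) <= rho] (@compact_rnorm_ball R k a rho).
have {}Kconv : forall eta : R, 0 < eta -> exists N, forall i y, (N <= i)%N ->
    rnorm (y - a) <= rho -> rnorm (F i y) <= eta.
  move=> eta eta0; have [||M hM] := Kconv _ _ eta eta0.
  - by move=> y /= yr; have [] := hr y (le_lt_trans yr rhor).
  - by move=> y /= yr; have [] := hr y (le_lt_trans yr rhor).
  by exists M => i y Mi yr; apply: ltW; exact: hM.
have wide y : rnorm (y - a) <= d / 4 -> conv y.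
  move=> yd4 eta eta0; have eta2 : 0 < eta / 2 by rewrite divr_gt0.
  have d42 : d / 4 < d / 2 by lra.
  have d1 : 0 <= 1 + d by lra.
  have [del del0 hdel] := @small_propagates_ball R k (Ck : normedModType C) rho (d / 4) (d / 2) (1 + d) (eta / 2)
    rho0 d42 d1 eta2.
  have [M hM] := Kconv del del0.
  exists (maxn N M) => i; rewrite geq_max => /andP[Ni Mi].
  apply: (le_lt_trans (y := eta / 2)); last lra.
  exact: (hdel (F i) a (Fd i) (fun x => FM i x Ni) (fun x => hM i x Mi) y yd4).
split=> //; exists (d / 8) => // y yz.
split; first by have [] := hd y ltac:(rlra).
by apply: wide; have := rnorm_tri z y a; rewrite (rnorm_dist z a); rlra.
Qed.

End Extension.
End SelfMap.
End Dynamics.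

(** * Topological preliminaries *)

Section Topology.
Context {R : realType} {k : nat}.
Local Notation C := (CC R).
Local Notation Ck := 'rV[C]_k.

Lemma uniform_rnormP (K : set Ck) (F : nat -> Ck -> Ck) (h : Ck -> Ck) :
  {uniform K, F @ \oo --> h} <->
  forall e : R, 0 < e -> exists N, forall i y, (N <= i)%N -> K y -> rnorm (F i y - h y) < e.
Proof.
split=> [hF e e0|hF].
  have e0' : 0 < cc e :> C by rewrite -cc0 cc_lt.
  have : nbhs (h : {uniform` K -> Ck}) [set g | forall y, K y -> rnorm (g y - h y) < e].
    apply/uniform_nbhs; exists [set xy | ball xy.1 (cc e) xy.2]; split.
      exact: (entourage_ball _ (PosNum e0')).
    move=> g hg y Ky; have := hg y Ky.
    by rewrite /= -ball_normE /ball_ /= rnormE cc_lt rnorm_dist.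
  by move=> /hF[N _ hN]; exists N => i y /hN; apply.
move=> A /uniform_nbhs[E [entE EA]].
move: entE; rewrite -entourage_ballE => -[r /= r0 hr].
have rE := ge0_cc (ltW r0).
have [|N hN] := hF (complex.Re r); first by move: r0; rewrite rE -cc0 cc_lt.
exists N => // i Ni; apply: EA => y Ky; apply: hr => /=.
by rewrite -ball_normE /ball_ /= rnormE rE cc_lt rnorm_dist; exact: hN.
Qed.

Lemma connected_locally_cst (W : set Ck) (T : Type) (h : Ck -> T) : connected W ->
  (forall z, W z -> exists2 r : R, 0 < r & forall y, rnorm (y - z) < r -> W y /\ h y = h z) ->
  forall x y, W x -> W y -> h y = h x.
Proof.
move=> Wc hloc x y Wx Wy; pose B := [set z | W z /\ h z = h x].
suff BW : B = W by move: Wy; rewrite -BW => -[].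
apply: Wc; first by exists x.
- exists B; last by apply/seteqP; split=> [z [Wz hz]|z []//]; split.
  apply/open_rnormP => z [Wz hz]; have [r r0 hr] := hloc z Wz.
  by exists r => // u /hr[Wu hu]; split=> //; rewrite hu.
exists (closure B); first exact: closed_closure.
apply/seteqP; split=> [z [Wz hz]|z [Wz Bz]].
  by split=> //; apply: subset_closure.
have [r r0 hr] := hloc z Wz.
have [|u [[Wu hu] /= /hr[_ uz]]] := Bz [set u | rnorm (u - z) < r].
  by apply/nbhs_rnormP; exists r.
by split=> //; rewrite -uz.
Qed.

Lemma connected_rnorm_ball (x : Ck) (r : R) : connected [set y | rnorm (y - x) < r].
Proof.
have [r0|r0] := leP r 0.
  have -> : [set y | rnorm (y - x) < r] = set0.
    apply/seteqP; split=> // y /= yr.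
    by have := le_lt_trans (rnorm_ge0 _) (lt_le_trans yr r0); rewrite ltxx.
  exact: connected0.
pose seg (y : Ck) := (fun t : R => x + cc t *: (y - x)) @` `[0, 1].
have -> : [set y | rnorm (y - x) < r] = \bigcup_(y in [set y | rnorm (y - x) < r]) seg y.
  apply/seteqP; split=> [y yr|z [y /= yr [t /=]]].
    exists y => //; exists 1; first by rewrite /= in_itv /= ler01 lexx.
    by rewrite cc1 scale1r addrC subrK.
  rewrite in_itv /= => /andP[t0 t1] <-; rewrite addrAC subrr add0r rnormZ rnorm_cc ger0_norm //.
  by apply: le_lt_trans yr; rewrite -[leRHS]mul1r; apply: ler_wpM2r => //; exact: rnorm_ge0.
apply: bigcup_connected.
  exists x => y _; exists 0; first by rewrite /= in_itv /= lexx ler01.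
  by rewrite cc0 scale0r addr0.
move=> y _; apply: connected_continuous_connected; first exact: segment_connected.
apply: continuous_subspaceT => t; apply/cvg_rnormP => e e0.
have v1 : 0 < rnorm (y - x) + 1 by have := rnorm_ge0 (y - x); rlra.
apply/nbhs_ballP; exists (e / (rnorm (y - x) + 1)) => /=; first by rewrite divr_gt0.
move=> s; rewrite /ball /= ltr_pdivlMr // => hs.
have -> : x + cc s *: (y - x) - (x + cc t *: (y - x)) = cc (s - t) *: (y - x).
  by rewrite opprD addrACA subrr add0r ccB scalerBl.
rewrite rnormZ rnorm_cc; apply: le_lt_trans hs; rewrite distrC.
by apply: ler_wpM2l => //; rewrite lerDl.
Qed.

Lemma connected_component_open (V : set Ck) x : open V -> open (connected_component V x).
Proof.
move=> /open_rnormP Vo; apply/open_rnormP => y hy.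
have Vy : V y by exact: connected_component_sub hy.
have [r r0 hr] := Vo y Vy; exists r => // z zr.
rewrite (same_connected_component hy).
apply: (@connected_component_max _ V [set z | rnorm (z - y) < r] y) => //.
  by rewrite /= subrr rnorm0.
exact: connected_rnorm_ball.
Qed.

Lemma compact_le_bigcup (F : nat -> set Ck) J : (forall j, compact (F j)) ->
  compact [set z | exists2 j, (j <= J)%N & F j z].
Proof.
move=> Fc; elim: J => [|J IH].
  have -> : [set z | exists2 j, (j <= 0)%N & F j z] = F 0%N.
    by apply/seteqP; split=> [z [j]|z Fz]; [rewrite leqn0 => /eqP ->|exists 0%N].
  exact: Fc.
have -> : [set z | exists2 j, (j <= J.+1)%N & F j z] =
    [set z | exists2 j, (j <= J)%N & F j z] `|` F J.+1.
  apply/seteqP; split=> [z [j]|z [[j jJ Fz]|Fz]].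
  - by rewrite leq_eqVlt => /orP[/eqP ->|]; [right|left; exists j].
  - by exists j => //; exact: leqW.
  - by exists J.+1.
exact: (compactU IH (Fc _)).
Qed.

Lemma seq_lim_compact (u : nat -> Ck) l (K : set Ck) : compact K -> (forall i, K (u i)) ->
  seq_lim u l -> K l.
Proof.
move=> Kc uK ul; apply: (compact_closed _ Kc); first exact: norm_hausdorff.
move=> A /nbhs_rnormP[d d0 hd]; have [N hN] := ul d d0.
by exists (u N); split=> //; apply: hd; exact: hN.
Qed.

End Topology.

Lemma subsequence_ge s : subsequence s -> forall i, (i <= s i)%N.
Proof. by move=> hs; elim=> // i IH; apply: leq_ltn_trans IH (hs _ _ _). Qed.

Section Iterates.
Context {R : realType} {k : nat}.
Local Notation C := (CC R).
Local Notation Ck := 'rV[C]_k.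
Context (U : set Ck) (f : Ck -> Ck) (hf : holomorphic_on U f)
  (hfo : open_map_on U f).

Lemma iter_differentiable n w : (forall j, U (iter j f w)) -> differentiable (iter n f) w.
Proof.
move=> Uw; elim: n => [|n IH]; first exact: ex_diff.
by apply: (@differentiable_comp _ _ _ _ (iter n f) f); [exact: IH|apply: hf; exact: Uw].
Qed.

Lemma iter_open n (O : set Ck) : open O -> (forall j w, O w -> U (iter j f w)) ->
  open (iter n f @` O).
Proof.
move=> Oo OU; elim: n => [|n IH].
  by have -> : iter 0 f @` O = O by rewrite image_id.
have -> : iter n.+1 f @` O = f @` (iter n f @` O).
  by apply/seteqP; split=> [_ [w Ow <-]|_ [_ [w Ow <-] <-]]; [exists (iter n f w) => //; exists w|exists w].
by apply: hfo => // _ [w Ow <-]; exact: OU.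
Qed.

End Iterates.

(** * Dynamics on the component *)

Section Component.
Context {R : realType} {k : nat}.
Local Notation C := (CC R).
Local Notation Ck := 'rV[C]_k.
Context (U : set Ck) (f : Ck -> Ck) (hf : holomorphic_on U f)
  (hfo : open_map_on U f) (S : set Ck) (hSf : f @` S `<=` S) (V W : set Ck)
  (hV : V = (closure S `&` U)°) (hW : exists2 x, V x & W = connected_component V x)
  (UW : forall n z, W z -> U (iter n f z)).

Lemma V_open : open V.
Proof. by rewrite hV; exact: open_interior. Qed.

Lemma W_open : open W.
Proof. by have [x Vx ->] := hW; apply: connected_component_open; exact: V_open. Qed.

Lemma W_connected : connected W.
Proof. by have [x Vx ->] := hW; exact: component_connected. Qed.

Lemma WV : W `<=` V.
Proof. by have [x Vx ->] := hW; exact: connected_component_sub. Qed.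

Lemma W_component w : W w -> W = connected_component V w.
Proof. by have [x Vx ->] := hW; exact: same_connected_component. Qed.

Lemma W_maximal (B : set Ck) w : connected B -> B `<=` V -> B w -> W w -> B `<=` W.
Proof.
by move=> Bc BV Bw Ww; rewrite (W_component Ww); exact: connected_component_max.
Qed.

Lemma iter_W_differentiable n z : W z -> differentiable (iter n f) z.
Proof. by move=> Wz; apply: (iter_differentiable hf) => j; exact: UW. Qed.

Lemma iter_closure n z : W z -> closure S (iter n f z).
Proof.
move=> Wz; elim: n => [|n IH].
  by have := WV Wz; rewrite hV => /interior_subset[].
have fc : {for iter n f z, continuous f}.
  by apply: differentiable_continuous; apply: hf; exact: UW.
move=> A /fc /IH[y [Sy Ay]]; exists (f y); split=> //.
by apply: hSf; exists y.
Qed.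

Lemma iter_W_open n (O : set Ck) : open O -> O `<=` W -> open (iter n f @` O).
Proof. by move=> Oo OW; apply: (iter_open hfo) => // j w /OW; exact: UW. Qed.

(** The image of W is open and lies in U and in the closure of the invariant set, hence in the
    interior that defines V. *)
Lemma iter_V n z : W z -> V (iter n f z).
Proof.
move=> Wz; have : open (iter n f @` W) by apply: iter_W_open => //; exact: W_open.
rewrite openE => /(_ (iter n f z)) h; rewrite hV.
have := h ltac:(by exists z); apply: filterS => _ [w Ww <-]; split; last exact: UW.
exact: iter_closure.
Qed.

Lemma iter_absorb n z : W z -> W (iter n f z) -> forall w, W w -> W (iter n f w).
Proof.
move=> Wz Wnz w Ww; apply: (@W_maximal (iter n f @` W) (iter n f z)) => //.
- apply: connected_continuous_connected; first exact: W_connected.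
  apply: continuous_in_subspaceT => y; rewrite inE => Wy.
  by apply: differentiable_continuous; exact: iter_W_differentiable.
- by move=> _ [y Wy <-]; exact: iter_V.
Qed.

(** For the least positive return time m, the remainder modulo m of any return time is again a
    return time, so it vanishes by minimality. One returning point is enough, by [iter_absorb]. *)
Lemma return_period n z : (0 < n)%N -> W z -> W (iter n f z) ->
  exists m, [/\ (0 < m)%N, forall w, W w -> W (iter m f w) &
    forall j w, W w -> W (iter j f w) -> (m %| j)%N].
Proof.
move=> n0 Wz Wnz.
pose P j := (0 < j)%N && `[< forall w, W w -> W (iter j f w) >].
have exP : exists j, P j.
  by exists n; rewrite /P n0; apply/asboolP; exact: iter_absorb Wz Wnz.
case: (ex_minnP exP) => m /andP[m0 /asboolP Wm] mmin.
exists m; split=> // j w Ww Wj.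
have Wmul q y : W y -> W (iter (q * m) f y).
  by move=> Wy; rewrite iterM; elim: q => //= q IH; exact: Wm.
have : W (iter (j %% m) f (iter (j %/ m * m) f w)).
  by rewrite -iterD addnC -divn_eq.
move=> /(iter_absorb (Wmul _ _ Ww)) Wr.
rewrite /dvdn; case: posnP => // r0.
have := mmin (j %% m)%N; rewrite /P r0 => /(_ (introT (asboolP _) Wr)).
by rewrite leqNgt ltn_mod m0.
Qed.

(** * The return map on the component *)

Section Period.
Context (hyp : hyperbolic U) (m : nat) (m0 : (0 < m)%N) (Wm : forall w, W w -> W (iter m f w))
  (mdvd : forall j w, W w -> W (iter j f w) -> (m %| j)%N).
Local Notation g := (iter m f).

Lemma WU : W `<=` U.
Proof. by move=> z Wz; exact: (UW 0). Qed.

Lemma W_hyperbolic : hyperbolic W.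
Proof. exact: hyperbolic_sub WU hyp. Qed.

Lemma g_holomorphic : holomorphic_on W g.
Proof. by move=> z; exact: iter_W_differentiable. Qed.

Lemma gW : g @` W `<=` W.
Proof. by move=> _ [z Wz <-]; exact: Wm. Qed.

Lemma iter_gE n z : iter n g z = iter (n * m) f z.
Proof. by rewrite iterM. Qed.

(** Times of passage near q can be subtracted: if [p i] and [p j] are near q, then g^(b - a) maps
    [p i] to [p j], hence q to a point near [p j] and so near q. *)
Lemma recurrent_limit p0 : recurrent_point U f W p0 -> exists2 q, W q &
  forall d : R, 0 < d -> forall N, exists2 j, (N <= j)%N & chain_lt W q (iter j g q) d.
Proof.
move=> [Wp0 [s [ss _ Kc KW]]]; set K := closure _ in Kc KW.
pose p i := iter (s i) f p0.
have Kp i : K (p i) by apply: subset_closure; exists i.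
have Wp i : W (p i) by exact: KW.
have [q [Kq qcl]] : K `&` cluster (p @ \oo) !=set0.
  by apply: Kc; exists 0%N => // i _; exact: Kp.
have freq (d : R) N : 0 < d -> exists2 i, (N <= i)%N & rnorm (p i - q) < d.
  move=> d0; have pN : (p @ \oo) (p @` [set i | (N <= i)%N]).
    by exists N => // i Ni; exists i.
  have qd : nbhs q [set y | rnorm (y - q) < d] by apply/nbhs_rnormP; exists d.
  by have [_ [[i Ni <-] h]] := qcl _ _ pN qd; exists i.
have Wq : W q by exact: KW.
exists q => // d d0 N; have d2 : 0 < d / 2 by rewrite divr_gt0.
have [e e0 he] := chain_lt_nbhs W_open Wq d2.
have [i _ /he[_ hi]] := freq e 0%N e0.
(* Such an index gives s j >= s i + N m, so the two times differ by at least N steps of g. *)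
have [j ij /he[_ hj]] := freq e (s i + N * m)%N e0.
have [/dvdnP[a sa] /dvdnP[b sb]] : (m %| s i)%N /\ (m %| s j)%N.
  by split; apply: (mdvd Wp0); exact: Wp.
have ab : (N + a <= b)%N.
  have := leq_trans ij (subsequence_ge ss j); rewrite sa sb -mulnDl leq_pmul2r //.
  by rewrite addnC.
have aleb := leq_trans (leq_addl N a) ab.
exists (b - a)%N; first by rewrite -(leq_add2r a) subnK.
rewrite [d]splitr; apply: chain_lt_trans hj _; apply: chain_lt_sym.
have := chain_lt_iter g_holomorphic gW (b - a) hi.
by rewrite /p sa sb -!iter_gE -iterD subnK.
Qed.

Lemma iterates_uniform s h (K : set Ck) : iterates_cvg U f W s h -> compact K -> K `<=` W ->
  forall e : R, 0 < e -> exists N, forall i y, (N <= i)%N -> K y ->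
    rnorm (iter (s i) f y - h y) < e.
Proof. by move=> [_ hs] Kc KW; apply/uniform_rnormP; exact: hs. Qed.

Lemma W_closed_ball z : W z ->
  exists2 r : R, 0 < r & [set y : Ck | rnorm (y - z) <= r] `<=` W.
Proof.
move=> Wz; have [r r0 hr] := (open_rnormP W).1 W_open z Wz.
exists (r / 2); first by rewrite divr_gt0.
by move=> y /= yr; apply: hr; apply: le_lt_trans yr _; lra.
Qed.

Lemma iterates_pointwise s h z : iterates_cvg U f W s h -> W z ->
  seq_lim (fun i => iter (s i) f z) (h z).
Proof.
move=> hs Wz e e0; have [r r0 rW] := W_closed_ball Wz.
have [N hN] := iterates_uniform hs (@compact_rnorm_ball R k z r) rW e0.
by exists N => i Ni; apply: hN; rewrite //= subrr rnorm0 ltW.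
Qed.

Lemma limit_differentiable s h z : iterates_cvg U f W s h -> W z -> differentiable h z.
Proof.
move=> hs Wz; have [r r0 rW] := W_closed_ball Wz.
apply: (@weierstrass R k k (fun i => iter (s i) f) h z r r0).
  by move=> i x xr; apply: iter_W_differentiable; apply: rW; exact: ltW.
move=> e e0; have [N hN] := iterates_uniform hs (@compact_rnorm_ball R k z r) rW e0.
by exists N => i x Ni xr; apply: ltW; apply: hN => //; exact: ltW.
Qed.

Lemma limit_constant s h : iterates_cvg U f W s h -> (forall z, W z -> jacobian h z = 0) ->
  forall x y, W x -> W y -> h y = h x.
Proof.
move=> hs h0; apply: connected_locally_cst; first exact: W_connected.
move=> z Wz; have [r r0 rW] := W_closed_ball Wz.
have rW' x : rnorm (x - z) < r -> W x by move=> xr; apply: rW; exact: ltW.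
exists r => // y yr; split; first exact: rW'.
apply: (zero_diff_cst (r := r)) yr => x /rW' Wx; first exact: limit_differentiable hs Wx.
move=> v; have := mul_rV_lin1 ('d h x) v.
by rewrite -/(jacobian h x) h0 // mulmx0 => <-.
Qed.

(** Confines the orbit under f, and not only under [iter m f], to finitely many images of [B]; when
    [B] is a compact subset of W, limits along the orbit stay in their union. *)
Lemma iter_orbit_finite q B A : (forall n, exists b y, [/\ (b <= A)%N, B y & iter n g q = iter b g y]) ->
  forall n, exists2 j, (j <= m + A * m)%N & (iter j f @` B) (iter n f q).
Proof.
move=> hB n; have [b [y [bA By qy]]] := hB (n %/ m)%N.
exists (n %% m + b * m)%N.
  by apply: leq_add; [apply: ltnW; rewrite ltn_mod|rewrite leq_mul2r bA orbT].
by exists y => //; rewrite iterD -iter_gE -qy iter_gE -iterD addnC -divn_eq.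
Qed.

Lemma seq_lim_shift (u : nat -> Ck) l N : seq_lim u l -> seq_lim (fun i => u (i + N)%N) l.
Proof.
move=> hu e /hu[M hM]; exists M => i Mi; apply: hM.
exact: leq_trans Mi (leq_addr _ _).
Qed.

(** W is a connected part of the basin, since residues modulo m reduce orbits under f to orbits
    under [iter m f]. Conversely, a connected part of the basin that contains c lies in V, hence in
    W. *)
Lemma basin_component c : W c -> g c = c -> (forall z, W z -> seq_lim (fun n => iter n g z) c) ->
  W = connected_component (basin V f (orbit_of_period f m c)) c.
Proof.
move=> Wc gc hc; apply/seteqP; split.
  apply: connected_component_max => //; last exact: W_connected.
  move=> z Wz; split=> [n j _|N No ON]; first exact: iter_V.
  have hj (j : 'I_m) : exists n0, forall n, (n0 <= n)%N -> N (iter j f (iter n g z)).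
    have Nj : N (iter j f c) by apply: ON; exists j => //=; exact: ltn_ord.
    have [d d0 hd] := (open_rnormP N).1 No _ Nj.
    have fj : {for c, continuous (iter j f)}.
      by apply: differentiable_continuous; exact: iter_W_differentiable.
    have [n0 hn0] := seq_lim_continuous fj (hc z Wz) d0.
    by exists n0 => n /hn0/hd.
  have [n0 hn0] := choice hj.
  exists ((\max_j n0 j).+1 * m)%N => // n /= nm.
  have nE : n = (n %% m + n %/ m * m)%N by rewrite addnC -divn_eq.
  have hm : (n %% m < m)%N by rewrite ltn_mod.
  rewrite nE iterD -iter_gE; apply: (hn0 (Ordinal hm)).
  apply: leq_trans (leq_bigmax (Ordinal hm)) _.
  by apply: ltnW; rewrite leq_divRL.
move=> z hz; apply: (@W_maximal (connected_component (basin V f (orbit_of_period f m c)) c) c) hz => //.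
- exact: component_connected.
(* That the first iterate of y is defined within V says that y lies in V. *)
- by move=> y /connected_component_sub[/(_ 1%N)/(_ 0%N isT)].
- apply: connected_component_refl.
  split=> [n j _|N No ON]; first exact: iter_V.
  exists 0%N => // n _; apply: ON; exists (n %% m)%N; first by rewrite /= ltn_mod.
  have -> : iter n f c = iter (n %% m) f (iter (n %/ m) g c).
    by rewrite iter_gE -iterD addnC -divn_eq.
  by have -> : iter (n %/ m) g c = c by elim: (n %/ m)%N => //= j ->.
Qed.

(** The orbit of q stays in a compact union of images of a part of W, so the constant h q is f^j y
    for some y in W, even when h q itself is outside W. *)
Lemma limit_rank0 s h q : subsequence s -> iterates_cvg U f W s h ->
  (forall z, W z -> jacobian h z = 0) -> W q ->
  (forall d : R, 0 < d -> forall N, exists2 j, (N <= j)%N & chain_lt W q (iter j g q) d) ->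
  attracting_basin_component V f W.
Proof.
move=> ss hs h0 Wq rec.
have [B [A [Bc BW hB]]] := recurrent_orbit_compact W_open W_hyperbolic g_holomorphic gW Wq rec.
have [j _ [y By yE]] : exists2 j, (j <= m + A * m)%N & (iter j f @` B) (h q).
  apply: (@seq_lim_compact _ _ (fun i => iter (s i) f q) (h q)
    [set z | exists2 j, (j <= m + A * m)%N & (iter j f @` B) z]).
  - apply: (@compact_le_bigcup _ _ (fun j => iter j f @` B)) => j.
    apply: continuous_compact => //; apply: continuous_in_subspaceT => z.
    by rewrite inE => /BW Wz; apply: differentiable_continuous; exact: iter_W_differentiable.
  - by move=> i; exact: (iter_orbit_finite hB).
  - exact: iterates_pointwise.
have Wy : W y by exact: BW.
(* With e more steps the total time from y is j m, so f^e carries h q into W. *)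
pose e := (j * m.-1)%N.
have ej : (e + j = j * m)%N by rewrite /e addnC -mulnS prednK.
pose c := iter e f (h q).
have cE : c = iter j g y by rewrite /c -yE -iterD ej iter_gE.
have Wc : W c by rewrite cE; exact: (iter_stable gW j Wy).
have ec : {for h q, continuous (iter e f)}.
  apply: differentiable_continuous; apply: (iter_differentiable hf) => i.
  by rewrite -yE -iterD; exact: UW.
have unif (K : set Ck) (eta : R) : compact K -> K `<=` W -> 0 < eta ->
    exists N, forall i z, (N <= i)%N -> K z -> rnorm (iter (s i + e) f z - c) < eta.
  move=> Kc KW eta0; have [d d0 hd] := (rnorm_continuous_at _ _).1 ec eta eta0.
  have [N hN] := iterates_uniform hs Kc KW d0.
  exists N => i z Ni Kz; rewrite addnC iterD; apply: hd.
  by rewrite -(limit_constant hs h0 Wq (KW _ Kz)); exact: hN.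
have [r r0 rW] := W_closed_ball Wc.
have [r1 r10 rW1] := W_closed_ball Wq.
have Kq : [set z : Ck | rnorm (z - q) <= r1] q by rewrite /= subrr rnorm0 ltW.
(* From index N on, f^(s i + e) sends q into a ball inside W, so these times are multiples of m. *)
have [N hN] := unif _ _ (@compact_rnorm_ball R k q r1) rW1 r0.
pose t i := ((s (i + N)%N + e) %/ m)%N.
have tE i z : iter (t i) g z = iter (s (i + N)%N + e) f z.
  rewrite iter_gE divnK //; apply: (mdvd Wq); apply: rW; apply: ltW.
  by apply: hN => //; exact: leq_addl.
have tlim z : W z -> seq_lim (fun i => iter (t i) g z) c.
  move=> Wz eta eta0; have [rz rz0 rzW] := W_closed_ball Wz.
  have [M hM] := unif _ _ (@compact_rnorm_ball R k z rz) rzW eta0.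
  exists M => i Mi; rewrite tE; apply: hM; last by rewrite /= subrr rnorm0 ltW.
  exact: leq_trans Mi (leq_addr _ _).
have [gc hc] := attracting_fixed W_open W_hyperbolic g_holomorphic gW Wc tlim.
exists m, c; split => //; last exact: basin_component.
split=> // [n _|a]; first exact: iter_V.
have r4 : 0 < r / 4 by rewrite divr_gt0.
have [M hM] := unif _ _ (@compact_rnorm_ball R k c r) rW r4.
apply: (@attracting_eigenvalue R k W g g_holomorphic gW c (t M) r gc r0).
  by move=> x xr; apply: rW; exact: ltW.
move=> x xr; rewrite tE; apply: ltW; apply: hM; first exact: leq_addr.
exact: ltW.
Qed.

(** An inverse function theorem with the same ball for h and for all late f^(s i): near z0 they
    differ from the linear map A by small Lipschitz errors, and for f^(s i) - h the Lipschitz bound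
    comes from uniform convergence. *)
Lemma limit_open_image s h z0 : iterates_cvg U f W s h -> W z0 ->
  jacobian h z0 \in unitmx -> exists beta I, [/\ 0 < beta :> R,
    forall w, rnorm (w - h z0) < beta -> exists2 z, W z & h z = w &
    forall i w, (I <= i)%N -> rnorm (w - h z0) < beta -> exists2 z, W z & iter (s i) f z = w].
Proof.
move=> hs Wz0 Au; set A := jacobian h z0 in Au.
have AE v : 'd h z0 v = v *m A.
  have dh : differentiable h z0 by exact: limit_differentiable hs Wz0.
  by rewrite /A mul_rV_lin1.
have [b b0 hb] := mulmx_bounded (invmx A).
have [r1 r10 rW] := W_closed_ball Wz0.
(* h gets the error kappa and f^(s i) twice as much: 2 kappa b = 1 / 2 is the threshold of
   [surjective_ball]. *)
pose kappa := 1 / (4 * b).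
have k0 : 0 < kappa by rewrite divr_gt0 // mulr_gt0.
have kb : kappa * b = 1 / 4 by rewrite /kappa; field; rewrite gt_eqF.
have [r2 r20 hstrict] : exists2 rho : R, 0 < rho & forall x y, rnorm (x - z0) < rho ->
    rnorm (y - z0) < rho -> rnorm (h y - h x - 'd h z0 (y - x)) <= kappa * rnorm (y - x).
  apply: (strict_diff r10 k0) => x xr; apply: limit_differentiable hs _.
  by apply: rW; exact: ltW.
(* [lipschitz_ball] on the ball of radius 2 r needs f^(s i) - h on the ball of radius 4 r. *)
pose r := Num.min r1 r2 / 4.
have m12 : 0 < Num.min r1 r2 by rewrite lt_min r10.
have mr1 : Num.min r1 r2 <= r1 by rewrite ge_min lexx.
have mr2 : Num.min r1 r2 <= r2 by rewrite ge_min lexx orbT.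
have r0 : 0 < r by rewrite divr_gt0.
have rr1 : 4 * r <= r1 by rewrite /r; lra.
have rr2 : r < r2 by rewrite /r; lra.
have inW x : rnorm (x - z0) <= r -> W x.
  by move=> xr; apply: rW; apply: le_trans xr _; lra.
have hsurj : forall w, rnorm (w - h z0) * b <= r / 2 -> exists2 x, rnorm (x - z0) <= r & h x = w.
  apply: (@surjective_ball R k h A z0 r kappa b Au (ltW r0) b0 hb); first by rewrite kb; lra.
  move=> x y xr yr; rewrite -AE.
  by apply: hstrict; [exact: le_lt_trans xr rr2|exact: le_lt_trans yr rr2].
(* A target within beta of h z0 is within 2 beta of f^(s i) z0, and 2 beta b = r / 2 is what
   [surjective_ball] admits. *)
pose beta := r / (4 * b).
have beta0 : 0 < beta by rewrite divr_gt0 // mulr_gt0.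
have betab : beta * b = r / 4 by rewrite /beta; field; rewrite gt_eqF.
have [N1 h1] := iterates_uniform hs (@compact_rnorm_ball R k z0 r1) rW (mulr_gt0 k0 r0).
have [N2 h2] := iterates_uniform hs (@compact_rnorm_ball R k z0 r1) rW beta0.
exists beta, (maxn N1 N2); split=> // [w wb|i w].
  have [|z zr zw] := hsurj w; last by exists z => //; exact: inW.
  have := ltW wb; rewrite -(ler_pM2r b0) betab => hh; apply: le_trans hh _; lra.
rewrite geq_max => /andP[Ni1 Ni2] wb.
have isurj : forall w, rnorm (w - iter (s i) f z0) * b <= r / 2 ->
    exists2 x, rnorm (x - z0) <= r & iter (s i) f x = w.
  apply: (@surjective_ball R k (iter (s i) f) A z0 r (2 * kappa) b Au (ltW r0) b0 hb).
    by rewrite -mulrA kb; lra.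
  move=> x y xr yr; rewrite -AE.
  have k1 : rnorm (h y - h x - 'd h z0 (y - x)) <= kappa * rnorm (y - x).
    by apply: hstrict; [exact: le_lt_trans xr rr2|exact: le_lt_trans yr rr2].
  have k2 : rnorm ((iter (s i) f \- h) y - (iter (s i) f \- h) x) * (2 * r) <=
      2 * (kappa * r) * rnorm (y - x).
    have r2r : r < 2 * r by rewrite mulr_natl mulr2n ltrDl.
    have r4r w' : rnorm (w' - z0) < 2 * (2 * r) -> rnorm (w' - z0) <= r1.
      move=> hw; apply: ltW; apply: lt_le_trans hw _; apply: le_trans rr1.
      by rewrite mulrA -natrM.
    apply: (@lipschitz_ball R k _ (iter (s i) f \- h) z0) => [w'|w'||].
    - move=> /r4r hw; have Ww := rW _ hw.
      by apply: differentiableB; [exact: iter_W_differentiable|exact: limit_differentiable hs Ww].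
    - by move=> /r4r hw; apply: ltW; exact: h1.
    - exact: le_lt_trans r2r.
    - exact: le_lt_trans r2r.
  have {}k2 : rnorm ((iter (s i) f \- h) y - (iter (s i) f \- h) x) <= kappa * rnorm (y - x).
    have r2p : 0 < 2 * r by rewrite mulr_gt0.
    rewrite -(ler_pM2r r2p); apply: le_trans k2 _.
    by rewrite le_eqVlt; apply/orP; left; apply/eqP; ring.
  have -> : iter (s i) f y - iter (s i) f x - 'd h z0 (y - x) =
    ((iter (s i) f \- h) y - (iter (s i) f \- h) x) + (h y - h x - 'd h z0 (y - x)).
    by apply/rowP => j; rewrite !mxE; ring.
  apply: le_trans (rnormD _ _) _.
  have -> : 2 * kappa * rnorm (y - x) = kappa * rnorm (y - x) + kappa * rnorm (y - x) by ring.
  exact: lerD.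
have [|z zr zw] := isurj w; last by exists z => //; exact: inW.
have h3 : rnorm (iter (s i) f z0 - h z0) < beta by apply: h2 => //=; rewrite subrr rnorm0 ltW.
have h4 : rnorm (w - iter (s i) f z0) <= 2 * beta.
  have := rnorm_tri (h z0) w (iter (s i) f z0); rewrite (rnorm_dist (h z0)); rlra.
by rewrite -(ler_pM2r b0) -mulrA betab in h4; apply: le_trans h4 _; lra.
Qed.

(** Meant for differences of times, which tend to infinity but need not increase. Each new index is
    taken past the last time, and t i >= i does the rest. *)
Lemma increasing_extraction (t : nat -> nat) : (forall i, (i <= t i)%N) ->
  exists2 p, (forall i, (i <= p i)%N) & subsequence (t \o p).
Proof.
move=> ht; pose p := fix p n := if n is n'.+1 then (t (p n')).+1 else 0%N.
have step n : (t (p n) < t (p n.+1))%N by exact: ht.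
exists p.
  by elim=> // n IH; rewrite /= ltnS; exact: leq_trans IH (ht _).
move=> i j /subnKC <-; elim: (j - i.+1)%N => [|d IH]; first by rewrite addn0; exact: step.
by rewrite addnS; exact: ltn_trans IH (step _).
Qed.

(** For o = f^e (h z), both g^(t j) z and its image g^(t (2 j)) z under g^(tau j) are near o; as
    g^(tau j) does not increase the chain distance, it moves o itself only slightly. *)
Lemma limit_full_rank s h z0 : subsequence s -> iterates_cvg U f W s h -> W z0 ->
  jacobian h z0 \in unitmx -> siegel_domain U f W.
Proof.
move=> ss hs Wz0 Au.
have [beta [I [beta0 hh hi]]] := limit_open_image hs Wz0 Au.
pose B := [set w | rnorm (w - h z0) < beta].
have Bo : open B.
  apply/open_rnormP => w wb; exists (beta - rnorm (w - h z0)); first by rewrite subr_gt0.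
  by move=> y yw; rewrite /B /=; have := rnorm_tri w y (h z0); rlra.
have Bh : B (h z0) by rewrite /B /= subrr rnorm0.
have BU j w : B w -> U (iter j f w).
  by move=> /(hi I w (leqnn I))[z Wz <-]; rewrite -iterD; exact: UW.
(* Points of [B] are reached from W at time s I; e more steps make the total s I m, so f^e maps [B]
   into W. *)
pose e := (s I * m.-1)%N.
have es : (e + s I = s I * m)%N by rewrite /e addnC -mulnS prednK.
have We w : B w -> W (iter e f w).
  move=> /(hi I w (leqnn I))[z Wz <-]; rewrite -iterD es -iter_gE.
  exact: (iter_stable gW).
(* Every late f^(s i) reaches h z0 from W, and f^e sends it back into W; so s (I + i) + e is a
   return time and the division is exact. *)
pose t i := ((s (I + i)%N + e) %/ m)%N.
have tm i : (t i * m = s (I + i)%N + e)%N.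
  have [z Wz zE] := hi (I + i)%N (h z0) (leq_addr _ _) Bh.
  rewrite divnK //; apply: (mdvd Wz); rewrite addnC iterD zE; exact: We.
have tlt : {homo t : i j / (i < j)%N}.
  move=> i j ij; rewrite -(ltn_pmul2r m0) !tm ltn_add2r; apply: ss.
  by rewrite ltn_add2l.
have tgap i d : (d <= t (i + d) - t i)%N.
  elim: d => // d IH; have := tlt (i + d)%N (i + d.+1)%N; rewrite addnS => /(_ (ltnSn _)) h1.
  have h2 : (t i <= t (i + d))%N by rewrite (ltnW_homo tlt) // leq_addr.
  by apply: leq_ltn_trans IH _; apply: ltn_sub2r => //; exact: leq_ltn_trans h1.
pose tau j := (t (j + j) - t j)%N.
have tau_ge j : (j <= tau j)%N by exact: tgap.
pose O := iter e f @` B.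
have Oo : open O by apply: (iter_open hfo).
have OW : O `<=` W by move=> _ [w Bw <-]; exact: We.
have Oconv o : O o -> seq_lim (fun j => iter (tau j) g o) o.
  move=> Oo'; have Wo' : W o by exact: OW.
  have [w Bw wo] := Oo'; have [z Wz zw] := hh w Bw.
  have ec : {for w, continuous (iter e f)}.
    by apply: differentiable_continuous; apply: (iter_differentiable hf) => j; exact: BU.
  have zlim : seq_lim (fun i => iter (t i) g z) o.
    have := seq_lim_shift I (iterates_pointwise hs Wz); rewrite zw.
    move=> /(seq_lim_continuous ec); rewrite wo => h1 d /h1[N hN].
    by exists N => i /hN; rewrite -iterD iter_gE tm (addnC I) (addnC e).
  apply: (chain_lt_seq_lim W_open W_hyperbolic Wo') => d d0.
  have d2 : 0 < d / 2 by rewrite divr_gt0.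
  have [N hN] := seq_lim_chain_lt W_open Wo' zlim d2.
  exists N => j Nj; rewrite [d]splitr.
  apply: chain_lt_trans (hN (j + j)%N _) _; first exact: leq_trans (leq_addr _ _).
  have := chain_lt_sym (chain_lt_iter g_holomorphic gW (tau j) (hN j Nj)).
  rewrite -iterD subnK //; apply: (ltnW_homo tlt); exact: leq_addr.
have On : O !=set0 by exists (iter e f (h z0)), (h z0).
have conv := conv_extend W_open W_hyperbolic g_holomorphic gW W_connected Oo On OW Oconv.
have [p p_ge tp] := increasing_extraction tau_ge.
exists (fun i => tau (p i) * m)%N.
  by move=> i j ij; rewrite ltn_pmul2r //; exact: tp.
split=> [i z Wz j _|K Kc KW]; first exact: UW.
apply/uniform_rnormP => d d0.
have [N hN] := conv_uniform W_open W_hyperbolic g_holomorphic gW Kc KW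
  (fun z Kz => conv z (KW z Kz)) d0.
exists N => i y Ni Ky; rewrite -iter_gE; apply: hN => //.
exact: leq_trans Ni (p_ge i).
Qed.

End Period.
End Component.

(** The rank is a maximum over the points of W: if it is 0, every Jacobian vanishes, and otherwise
    the value k is attained at a point. *)
Lemma holomorphic_rank_witness (R : realType) (k : nat) (W : set 'rV[CC R]_k)
    (h : 'rV[CC R]_k -> 'rV[CC R]_k) : ~ (0 < holomorphic_rank W h < k)%N ->
  (forall z, W z -> jacobian h z = 0) \/ exists2 z, W z & jacobian h z \in unitmx.
Proof.
set P := fun r : 'I_k.+1 => `[< exists2 z, W z & \rank (jacobian h z) = r >].
have rankE : holomorphic_rank W h = (\max_(r < k.+1 | P r) r)%N by [].
have le_rank z : W z -> (\rank (jacobian h z) <= holomorphic_rank W h)%N.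
  move=> Wz; have rk : (\rank (jacobian h z) < k.+1)%N by rewrite ltnS rank_leq_row.
  rewrite rankE; apply: (leq_bigmax_cond (Ordinal rk)).
  by apply/asboolP; exists z.
have [r0 _|rpos] := posnP (holomorphic_rank W h).
  left=> z Wz; apply/eqP; rewrite -mxrank_eq0 -leqn0 -r0; exact: le_rank.
rewrite /= => /negP; rewrite -leqNgt => kr; right.
have [|r Pr rE] := @eq_bigmax_cond _ P (fun r : 'I_k.+1 => nat_of_ord r).
  apply/card_gt0P; apply: contrapT => hP; move: rpos; rewrite rankE big_pred0 // => r.
  by apply/negP => Pr; apply: hP; exists r.
move: Pr; rewrite unfold_in => /asboolP[z Wz zr]; exists z => //.
rewrite -row_free_unit /row_free eqn_leq rank_leq_row zr.
by move: kr; rewrite rankE; move: rE; rewrite /in_mem /= => ->.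
Qed.

Theorem theorem3p4 (R : realType) (k : nat)
  (U : set 'rV[CC R]_k) (f : 'rV[CC R]_k -> 'rV[CC R]_k)
  (hUo : open U) (hUc : connected U)
  (hUb : bounded_set U \/ kobayashi_hyperbolic U)
  (hf : holomorphic_on U f) (hfo : open_map_on U f)
  (hbar : forall q, boundary U q -> psh_barrier U q)
  (C : set 'rV[CC R]_k) (hCU : C `<=` U) (hCf : f @` C `<=` C)
  (V : set 'rV[CC R]_k) (hV : V = (closure C `&` U)°) (hV0 : V !=set0)
  (W : set 'rV[CC R]_k)
  (hW : exists2 x, V x & W = connected_component V x)
  (p0 : 'rV[CC R]_k) (hp0 : recurrent_point U f W p0) :
  [\/ attracting_basin_component V f W,
      siegel_domain U f W
    | forall h : 'rV[CC R]_k -> 'rV[CC R]_k, is_iterate_limit U f W h ->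
        (0 < holomorphic_rank W h < k)%N].
Proof.
have [all_intermediate|/existsNP[h /not_implyP[[s ss hs] hrank]]] :=
  pselect (forall h, is_iterate_limit U f W h -> (0 < holomorphic_rank W h < k)%N).
  exact: Or33.
(* Convergence on W includes that the iterates at the times s i are defined there, and s (n + 1) >
   n. *)
have UW n z : W z -> U (iter n f z).
  by move=> Wz; apply: (hs.1 n.+1 z Wz); exact: subsequence_ge.
have hyp : hyperbolic U.
  by case: hUb; [exact: bounded_hyperbolic|exact: kobayashi_hyperbolicW].
have [Wp0 [s' [ss' _ _ KW]]] := hp0.
(* Index 1 and not 0, as s' 0 may be 0 and a positive return time is required. *)
have s'1 : (0 < s' 1)%N by exact: subsequence_ge.
have Ws'1 : W (iter (s' 1%N) f p0) by apply: KW; apply: subset_closure; exists 1%N.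
have [m [m0 Wm mdvd]] := return_period hf hfo hCf hV hW UW s'1 Wp0 Ws'1.
have [q Wq rec] := recurrent_limit hf hV hW UW m0 Wm mdvd hp0.
have [h0|[z Wz hz]] := holomorphic_rank_witness hrank.
  apply: Or31; exact: (limit_rank0 hf hfo hCf hV hW UW hyp m0 Wm mdvd ss hs h0 Wq rec).
apply: Or32; exact: (limit_full_rank hf hfo hV hW UW hyp m0 Wm mdvd ss hs Wz hz).
Qed.
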